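(* Assume that $U$ is closed-valued with Borel graph, that $f,g$ satisfy the regularity conditions stated in the context, and that $u^0\in\mathfrak U$ is $\tau$-optimal, with trajectory $x^0=x^{u^0}$. Let the limit $$\lim_{t\to\infty,\,\xi\to0}I_\xi(t)=\int_0^\infty\frac{\partial g}{\partial x}(t,x^0(t),u^0(t))A_0(t)\,dt$$ be well-defined and finite. Then the pair $(x^0,u^0)$ is normal and there exists a unique $\tau$-vanishing multiplier $(\lambda^0,\psi^0)\in\Lambda$. Moreover, for every $(\lambda^0,\psi^0)\in\Lambda$ the following conditions are equivalent: 1) the Lagrange multiplier $(\lambda^0,\psi^0)$ is $\tau$-vanishing; 2) $\liminf_{n\to\infty}\|\psi^0(\tau_n)A_0(\tau_n)\|=0$; 3) $\lim_{t\to\infty}\|\psi^0(t)A_0(t)\|=0$; 4) $\lambda^0=1$ and $\displaystyle\psi^0(T)=\int_T^\infty\frac{\partial g}{\partial x}(t,x^0(t),u^0(t))A_0(t)\,dt\;A_0^{-1}(T)$ for all $T\in\mathbb T$.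
   Context: Setting. $\mathbb T=[0,\infty)$, $\mathbb X=\mathbb R^m$, $\mathbb L$ is the space of real $m\times m$ matrices, $\mathbb U$ is a finite-dimensional Euclidean space. $U$ assigns to each $t\in\mathbb T$ a subset $U(t)\subset\mathbb U$; $\mathfrak U$ is the set of Borel measurable locally bounded $u:\mathbb T\to\mathbb U$ with $u(t)\in U(t)$. Let $f:\mathbb T\times\mathbb X\times\mathbb U\to\mathbb X$, $g:\mathbb T\times\mathbb X\times\mathbb U\to\mathbb R$, $x_{**}\in\mathbb X$. For $u\in\mathfrak U$, $x^u$ solves $\dot x=f(t,x,u(t))$, $x(0)=x_{**}$, and $J^u(T)=\int_0^T g(t,x^u(t),u(t))\,dt$. Integrals over $[T,\infty)$ are limits of integrals over $[T,S]$ as $S\to\infty$. Regularity conditions on $f,g$: each of $a=f,\ g,\ \partial f/\partial x,\ \partial g/\partial x$ is defined on $\mathbb T\times\mathbb X\times\mathbb U$, is Carath\'eodory (Borel in $t$ for all $(x,u)$, continuous in $(x,u)$ for a.e. $t$), and for each compact $K\subset\mathbb X\times\mathbb U$ there are locally integrable $L^a_K,M^a_K:\mathbb T\to\mathbb T$ with $\|a(t,x,u)-a(t,y,u)\|\le L^a_K(t)\|x-y\|$ and $\|a(t,x,u)\|\le M^a_K(t)$ for all $(x,u),(y,u)\in K$, $t\in\mathbb T$. Moreover $f$ has sublinear growth in $x$: for each compact $C\subset\mathbb U$ there is a locally integrable $l_C$ with $\|f(t,x,u)\|\le l_C(t)(1+\|x\|)$ for $u\in C$. $\tau=(\tau_n)_{n\in\mathbb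 N}$ is a sequence of times with $\tau_n\uparrow\infty$; $u^0\in\mathfrak U$ is $\tau$-optimal if $\limsup_{n\to\infty}\sup_{u\in\mathfrak U}(J^u(\tau_n)-J^{u^0}(\tau_n))=0$. Multipliers. Shadow prices $\psi$ and $\partial g/\partial x$ are row vectors. $\mathcal H(x,t,u,\lambda,\psi)=\psi f(t,x,u)+\lambda g(t,x,u)$ for $\lambda\ge0$. A Lagrange multiplier associated with $(x^0,u^0)$ is a nontrivial pair $(\lambda,\psi)\in[0,1]\times C(\mathbb T,\mathbb X)$ with, for a.e. $t$, $\dot\psi(t)=-\frac{\partial\mathcal H}{\partial x}(x^0(t),t,u^0(t),\lambda,\psi(t))$ and $\sup_{p\in U(t)}\mathcal H(x^0(t),t,p,\lambda,\psi(t))=\mathcal H(x^0(t),t,u^0(t),\lambda,\psi(t))$. $\Lambda$ is the set of such multipliers with either $\lambda=1$, or $\lambda=0$ and $\|\psi(0)\|=1$. The pair $(x^0,u^0)$ is normal if it has an associated Lagrange multiplier with $\lambda=1$ (equivalently $\lambda>0$, up to scaling). Consider the system (S) for $(\psi,x,\lambda)$, $\lambda\ge0$: $\dot\psi=-\frac{\partial\mathcal H}{\partial x}(x(t),t,u^0(t),\lambda,\psi(t))$, $\dot x=f(t,x(t),u^0(t))$, $\dot\lambda=0$. A Lagrange multiplier $(\lambda^0,\psi^0)$ associated with $(x^0,u^0)$ is $\tau$-vanishing if there are a subsequence $\tau'$ of $\tau$ and solutions $(\psi_n,x_n,\lambda_n)$ of (S) converging pointwise to $(\psi^0,x^0,\lambda^0)$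 with $\psi_n(\tau'_n)=0$ for every $n$. For $\xi\in\mathbb X$: $\dot x_\xi=f(t,x_\xi,u^0(t))$, $x_\xi(0)=x_{**}+\xi$; $\dot A_\xi=\frac{\partial f}{\partial x}(t,x_\xi(t),u^0(t))A_\xi$, $A_\xi(0)=1_{\mathbb L}$ (identity); $I_\xi(T)=\int_0^T\frac{\partial g}{\partial x}(t,x_\xi(t),u^0(t))A_\xi(t)\,dt$. $A_0,I_0$ correspond to $\xi=0$. The limit ''$t\to\infty,\ \xi\to0$'' is a joint limit. *)

(* Defs.v *)
From HB Require Import structures.
From mathcomp Require Import all_boot all_order all_algebra.
From mathcomp Require Import all_classical all_reals all_analysis.

Set Implicit Arguments.
Unset Strict Implicit.
Unset Printing Implicit Defensive.

Export Order.TTheory GRing.Theory Num.Theory numFieldNormedType.Exports.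

Global Open Scope classical_set_scope.
Global Open Scope ring_scope.

(* Time is [0, +oo[: a function of time is a function on R of which only the
   values at t >= 0 are ever used.  States and controls are column vectors,
   shadow prices and gradients are row vectors. *)

(* Integrands such as t |-> g t (x t) (u t) with g only Caratheodory are Lebesgue
   but in general not Borel measurable, hence the completed measure. *)
Notation leb R := (@completed_lebesgue_measure R).

(* Euclidean norm on vectors, Frobenius norm on matrices. *)
Definition enorm {R : realType} {p q : nat} (A : 'M[R]_(p, q)) : R :=
  Num.sqrt (\sum_(i < p) \sum_(j < q) A i j ^+ 2).

Section analysis.
Context {R : realType}.

Definition loc_integrable (h : R -> R) : Prop :=
  forall T : R, 0 <= T -> (leb R).-integrable `[0, T] (EFin \o h).

Definition borel_fun {V : normedModType R} (h : R -> V) : Prop :=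
  measurable_fun `[0 : R, +oo[ (h : R -> g_sigma_algebraType (@open V)).

Definition int_vec {n : nat} (h : R -> 'rV[R]_n) (a b : R) : 'rV[R]_n :=
  \row_j \int[leb R]_(t in `[a, b]) h t 0 j.

Definition improper {n : nat} (h : R -> 'rV[R]_n) (a : R) : 'rV[R]_n :=
  lim (int_vec h a S @[S --> +oo]).

(* Since all norms on a finite-dimensional space are equivalent, the choice of
   the norm is immaterial here. *)
Definition abs_continuous {V : normedModType R} (T : R) (x : R -> V) : Prop :=
  forall e : R, 0 < e -> exists2 d : R, 0 < d &
    forall (n : nat) (a b : 'I_n -> R),
      (forall i, [/\ 0 <= a i, a i <= b i & b i <= T]) ->
      trivIset [set: 'I_n] (fun i => `]a i, b i[%classic) ->
      \sum_(i < n) (b i - a i) < d ->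
      \sum_(i < n) `|x (b i) - x (a i)| < e.

(* x' = v on [0, +oo[, in the sense of Caratheodory *)
Definition solves {V : normedModType R} (x v : R -> V) : Prop :=
  (forall T : R, 0 <= T -> abs_continuous T x) /\
  {ae leb R, forall t : R, 0 <= t -> is_derive t (1 : R) x (v t)}.

Definition gradient {n : nat} (h : 'cV[R]_n -> R) (x : 'cV[R]_n) : 'rV[R]_n :=
  \row_j 'D_(delta_mx j 0) h x.

Definition jacobian_mx {n p : nat} (h : 'cV[R]_n -> 'cV[R]_p) (x : 'cV[R]_n) :
    'M[R]_(p, n) :=
  \matrix_(i, j) ('D_(delta_mx j 0) h x) i 0.

End analysis.

Section control_problem.
Context {R : realType} {m k : nat}.
Variables (f : R -> 'cV[R]_m -> 'cV[R]_k -> 'cV[R]_m)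
          (g : R -> 'cV[R]_m -> 'cV[R]_k -> R).
Variables (U : R -> set 'cV[R]_k) (x_init : 'cV[R]_m).
Variable tau : nat -> R.

Definition dfdx (t : R) (x : 'cV[R]_m) (p : 'cV[R]_k) : 'M[R]_m :=
  jacobian_mx (fun y => f t y p) x.

Definition dgdx (t : R) (x : 'cV[R]_m) (p : 'cV[R]_k) : 'rV[R]_m :=
  gradient (fun y => g t y p) x.

Definition regular {V : normedModType R} (nrm : V -> R)
    (a : R -> 'cV[R]_m -> 'cV[R]_k -> V) : Prop :=
  [/\ forall x p, borel_fun (fun t => a t x p),
      {ae leb R, forall t : R, 0 <= t ->
        continuous (fun z : 'cV[R]_m * 'cV[R]_k => a t z.1 z.2)} &
      forall K : set ('cV[R]_m * 'cV[R]_k), compact K ->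
        exists L M : R -> R,
        [/\ loc_integrable L /\ loc_integrable M,
            forall t : R, 0 <= t -> 0 <= L t /\ 0 <= M t,
            forall (t : R) x y p, 0 <= t -> K (x, p) -> K (y, p) ->
              nrm (a t x p - a t y p) <= L t * enorm (x - y) &
            forall (t : R) x p, 0 <= t -> K (x, p) -> nrm (a t x p) <= M t]].

Definition sublinear_growth : Prop :=
  forall C : set 'cV[R]_k, compact C -> exists2 l : R -> R, loc_integrable l &
    forall (t : R) x p, 0 <= t -> C p -> enorm (f t x p) <= l t * (1 + enorm x).

Definition regularity_conditions : Prop :=
  [/\ forall (t : R) x p, 0 <= t -> differentiable (fun y => f t y p) x /\
                              differentiable (fun y => g t y p) x,
      regular enorm f /\ regular Num.norm g,
      regular enorm dfdx /\ regular enorm dgdx &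
      sublinear_growth].

Definition closed_valued : Prop := forall t : R, 0 <= t -> closed (U t).

Definition borel_graph : Prop :=
  <<s (@open (R * 'cV[R]_k)%type) >> [set z | 0 <= z.1 /\ U z.1 z.2].

Definition admissible : set (R -> 'cV[R]_k) := [set u |
  [/\ borel_fun u,
      forall T : R, 0 <= T -> exists M, forall t : R, 0 <= t <= T -> enorm (u t) <= M &
      forall t : R, 0 <= t -> U t (u t)]].

Definition trajectory (x1 : 'cV[R]_m) (u : R -> 'cV[R]_k) (x : R -> 'cV[R]_m) :
    Prop :=
  solves x (fun t => f t (x t) (u t)) /\ x 0 = x1.

Definition payoff (u : R -> 'cV[R]_k) (x : R -> 'cV[R]_m) (T : R) : R :=
  \int[leb R]_(t in `[0, T]) g t (x t) (u t).

Definition times_to_infinity : Prop :=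
  [/\ forall n, 0 <= tau n,
      {homo tau : i j / (i <= j)%N >-> i <= j} &
      tau n @[n --> \oo] --> +oo].

(* The trajectory of a control is unique on [0, +oo[, so that the supremum over
   pairs (control, trajectory) is the supremum over controls. *)
Definition processes : set ((R -> 'cV[R]_k) * (R -> 'cV[R]_m)) :=
  [set z | admissible z.1 /\ trajectory x_init z.1 z.2].

Definition tau_optimal (u0 : R -> 'cV[R]_k) (x0 : R -> 'cV[R]_m) : Prop :=
  processes (u0, x0) /\
  limn_esup (fun n => ereal_sup
    [set (payoff z.1 z.2 (tau n) - payoff u0 x0 (tau n))%:E
       | z in processes]) = 0%E.

Definition hamiltonian (x : 'cV[R]_m) (t : R) (p : 'cV[R]_k) (lambda : R)
    (psi : 'rV[R]_m) : R :=
  (psi *m f t x p) 0 0 + lambda * g t x p.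

Definition dHdx (x : 'cV[R]_m) (t : R) (p : 'cV[R]_k) (lambda : R)
    (psi : 'rV[R]_m) : 'rV[R]_m :=
  gradient (fun y => hamiltonian y t p lambda psi) x.

(* Two shadow prices are identified when they agree on [0, +oo[; continuity of
   psi is part of [solves]. *)
Definition multiplier (x0 : R -> 'cV[R]_m) (u0 : R -> 'cV[R]_k)
    (lambda : R) (psi : R -> 'rV[R]_m) : Prop :=
  [/\ 0 <= lambda <= 1,
      lambda <> 0 \/ (exists2 t : R, 0 <= t & psi t <> 0),
      solves psi (fun t => - dHdx (x0 t) t (u0 t) lambda (psi t)) &
      {ae leb R, forall t : R, 0 <= t ->
        ereal_sup [set (hamiltonian (x0 t) t p lambda (psi t))%:E | p in U t]
        = (hamiltonian (x0 t) t (u0 t) lambda (psi t))%:E}].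

Definition normalized_multiplier (x0 : R -> 'cV[R]_m) (u0 : R -> 'cV[R]_k)
    (lambda : R) (psi : R -> 'rV[R]_m) : Prop :=
  multiplier x0 u0 lambda psi /\
  (lambda = 1 \/ (lambda = 0 /\ enorm (psi 0) = 1)).

Definition normal_pair (x0 : R -> 'cV[R]_m) (u0 : R -> 'cV[R]_k) : Prop :=
  exists psi, multiplier x0 u0 1 psi.

Definition solves_system (u0 : R -> 'cV[R]_k) (psi : R -> 'rV[R]_m)
    (x : R -> 'cV[R]_m) (lambda : R -> R) : Prop :=
  [/\ forall t : R, 0 <= t -> 0 <= lambda t,
      solves psi (fun t => - dHdx (x t) t (u0 t) (lambda t) (psi t)),
      solves x (fun t => f t (x t) (u0 t)) &
      solves lambda (fun=> 0)].

Definition tau_vanishing (x0 : R -> 'cV[R]_m) (u0 : R -> 'cV[R]_k)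
    (lambda0 : R) (psi0 : R -> 'rV[R]_m) : Prop :=
  multiplier x0 u0 lambda0 psi0 /\
  exists (sub : nat -> nat) (psi_ : nat -> R -> 'rV[R]_m)
         (x_ : nat -> R -> 'cV[R]_m) (lambda_ : nat -> R -> R),
  [/\ {homo sub : i j / (i < j)%N},
      forall n, solves_system u0 (psi_ n) (x_ n) (lambda_ n),
      forall t : R, 0 <= t -> [/\ psi_ n t @[n --> \oo] --> psi0 t,
                              x_ n t @[n --> \oo] --> x0 t &
                              lambda_ n t @[n --> \oo] --> lambda0] &
      forall n, psi_ n (tau (sub n)) = 0].

Definition fundamental_matrix (u0 : R -> 'cV[R]_k) (x : R -> 'cV[R]_m)
    (A : R -> 'M[R]_m) : Prop :=
  solves A (fun t => dfdx t (x t) (u0 t) *m A t) /\ A 0 = 1%:M.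

Definition dg_along (u0 : R -> 'cV[R]_k) (x : R -> 'cV[R]_m)
    (A : R -> 'M[R]_m) (t : R) : 'rV[R]_m :=
  dgdx t (x t) (u0 t) *m A t.

End control_problem.

(* Main.v *)
Require Import Defs.
From HB Require Import structures.
From mathcomp Require Import all_boot all_order all_algebra.
From mathcomp Require Import all_classical all_reals all_analysis.
From mathcomp Require Import measurable_realfun.
From mathcomp Require Import ring lra.
Import Order.TTheory GRing.Theory Num.Theory numFieldNormedType.Exports.
Set Implicit Arguments.
Unset Strict Implicit.
Unset Printing Implicit Defensive.
Local Open Scope classical_set_scope.
Local Open Scope ring_scope.

(* The end point is free, so the costate is explicit: with [I t] the integral of
   dg/dx * A_0 over [0, t] and [l] its limit, the candidate is lambda = 1 and
   psi t = (l - I t) * A_0(t)^-1, and only the maximum condition is at stake.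

   If it failed on a non-null set of times, a measurable selection would give a
   control better for the Hamiltonian by some eps > 0 on a set of positive measure
   inside some [0, T].  Switch to it on a subset of measure d.  After T the new
   trajectory is x_xi for some xi = O(d), and the mean value theorem in xi with the
   joint limit of I_xi(t) gives J_xi(t) - J_0(t) = l xi + o(|xi|) uniformly in large t.
   The payoff thus increases by eps d - o(d) at all large times, contradicting
   tau-optimality.

   For every multiplier, psi A_0 = psi(0) - lambda I; hence each of the four conditions
   says that psi(0) = lambda l. *)

(** The candidate is natural because $\psi(T) A_0(T) = l - I(T)$ is the linear form that gives the
    first-order gain earned after T by a perturbation of the initial state. Adding it at the end
    point reduces the infinite horizon to a free end point problem on [0, T], where the classical
    needle computation applies.

    Two obstacles shape the rest. The projection of a Borel set need not be Borel, so the set of bad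
    times is only known to be analytic, while the better control must be Borel: capacitability
    yields a compact part of the graph over a set of positive measure, and on a compact set the
    lexicographically least point is a Borel selection. Moreover the coefficients are bounded only
    by locally integrable functions, so a needle on an arbitrary set of measure d may move the
    trajectory by more than O(d); the needles are therefore placed where these functions are
    themselves bounded. *)

(* The measurable type carrying [leb R], whose measurable sets are the Lebesgue ones. *)
Notation lebT R := (caratheodory_type (R:=R)
  (T:=lebesgue_stieltjes_measure_ocitv_type__canonical__measurable_structure_SemiRingOfSets R)
  (wlength idfun)^*%mu).

(** * Lebesgue and Borel measurability *)

Section lebesgue_completion.
Context {R : realType}.
Implicit Types (h : R -> R) (D : set R).

Lemma leb_lebesgue (A : set R) : leb R A = lebesgue_measure A.
Proof. by []. Qed.

Lemma leb_measurable (A : set R) : measurable A -> measurable (A : set (lebT R)).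
Proof. by move=> mA; apply: sub_caratheodory. Qed.

Lemma measurable_leb_id : measurable_fun [set: lebT R] (idfun : lebT R -> measurableTypeR R).
Proof. by move=> _ Y mY; rewrite setTI preimage_id; exact: leb_measurable. Qed.

Lemma measurable_fun_leb d (T : measurableType d) D (h : R -> T) :
  measurable D -> measurable_fun D h -> measurable_fun (D : set (lebT R)) (h : lebT R -> T).
Proof.
by move=> mD mh _ Y mY; apply: leb_measurable; apply: mh.
Qed.

Lemma ae_lebesgue_leb (P : R -> Prop) :
  {ae @lebesgue_measure R, forall t, P t} -> {ae leb R, forall t, P t}.
Proof.
move=> [N [mN N0 PN]]; exists N; split => //; exact: leb_measurable.
Qed.

(** Both measures restrict the same outer measure, so a null set of the completion still sits in a
    Borel null set. *)
Lemma leb_negligible (N : set R) :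
  (leb R).-negligible N -> exists B : set R, [/\ measurable B, leb R B = 0%E & N `<=` B].
Proof.
move=> negN.
have : (@lebesgue_measure R).-negligible N.
  apply/negligible_outer_measure.
  case: negN => A [mA A0 NA].
  apply/eqP; rewrite eq_le outer_measure_ge0 andbT.
  by rewrite -A0; apply: le_outer_measure.
by case=> B [mB B0 NB]; exists B.
Qed.

(** Every superlevel set of [h] at a rational is a Borel set [A q] up to a null set [N q]. The
    supremum of the rationals [q] with [t] in [A q] is Borel in [t] and recovers [h t] off the
    countable union of the [N q]. Theorems on Borel functions thus become available for the
    completed measure. *)
Lemma borel_rep h : measurable_fun [set: lebT R] (h : lebT R -> R) ->
  exists2 h' : R -> R, measurable_fun setT h' & {ae leb R, forall t, h t = h' t}.
Proof.
move=> mh.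
have key (q : rat) : exists A, exists N, [/\ measurable (A : set R),
    (leb R).-negligible N & A `|` N = [set t : R | ratr q < h t] ].
  have : measurable ([set t : R | ratr q < h t] : set (lebT R)).
    rewrite [X in measurable X](_ : _ = setT `&` h @^-1` `]ratr q, +oo[%classic).
      by apply: mh.
    by rewrite setTI; apply/seteqP; split => t /=; rewrite in_itv/= andbT.
  move=> mS.
  have : (completed_algebra_gen (@lebesgue_measure R)).-sigma.-measurable
      [set t : R | ratr q < h t].
    by rewrite completed_caratheodory_measurable; exact: mS.
  rewrite g_sigma_completed_algebra_genE => -[A mA [N negN AN]].
  exists A, N; split => //.
  case: negN => B [mB B0 NB]; exists B; split => //; exact: leb_measurable.
pose A q := projT1 (cid (key q)).
pose N q := projT1 (cid (projT2 (cid (key q)))).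
have AN q : [/\ measurable (A q), (leb R).-negligible (N q) & A q `|` N q = [set t : R | ratr q < h t] ].
  exact: (projT2 (cid (projT2 (cid (key q))))).
(* Extended values, because at exceptional times the supremum may run over no rational or over
   unbounded ones; [fine] then returns a real and keeps measurability. *)
pose H t : \bar R := ereal_sup [set (ratr q)%:E | q in [set q | A q t]].
exists (fun t => fine (H t)).
  suff mH : measurable_fun [set: R] H.
    by apply: (measurableT_comp _ mH); exact: fine_measurable.
  apply: (measurability _ (ErealGenOInfty.measurableE R)) => /=.
  move=> _ [_ [c ->] <-].
  rewrite setTI (_ : _ @^-1` _ = \bigcup_(q in [set q : rat | c < ratr q]) A q); last first.
    apply/seteqP; split => t /=.
      rewrite in_itv/= andbT => /ereal_sup_gt [_ [q /= Aq <-]]; rewrite lte_fin => cq.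
      by exists q.
    move=> [q /= cq Aq]; rewrite in_itv/= andbT; apply: (@lt_le_trans _ _ (ratr q)%:E).
      by rewrite lte_fin.
    by apply: ereal_sup_ubound; exists q.
  rewrite bigcup_mkcond; apply: bigcupT_measurable_rat => q.
  by case: ifP => // _; have [] := AN q.
have : (leb R).-negligible (\bigcup_n N (odflt 0 (unpickle n))).
  by apply: negligible_bigcup => n; have [] := AN (odflt 0 (unpickle n)).
apply: negligibleS => t /= hne.
apply: contrapT => nN; apply: hne.
suff -> : H t = (h t)%:E by [].
have AE q : A q t <-> ratr q < h t.
  have [_ _ E] := AN q; split => [Aq|qh].
    have : (A q `|` N q) t by left.
    by rewrite E.
  have : (A q `|` N q) t by rewrite E.
  case => // Nq; exfalso; apply: nN; exists (pickle q) => //.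
  by rewrite pickleK.
apply/eqP; rewrite eq_le; apply/andP; split.
  by apply: ge_ereal_sup => _ [q /= /AE qh <-]; rewrite lee_fin ltW.
rewrite leNgt; apply/negP => Hlt.
have [c [ch Hc]] : exists c, c < h t /\ (H t < c%:E)%E.
  move: Hlt; case: (H t) => [r| |] //.
    rewrite lte_fin => rh; exists ((r + h t) / 2); rewrite lte_fin; split.
      by rewrite midf_lt.
    by rewrite midf_lt.
  by move=> _; exists (h t - 1); rewrite ltNyr ltrBlDr ltrDl; split.
have [q] := rat_in_itvoo ch; rewrite in_itv/= => /andP[cq qh].
have : ((ratr q)%:E <= H t)%E by apply: ereal_sup_ubound; exists q => //; apply/AE.
by move=> /le_lt_trans/(_ Hc); rewrite lte_fin ltNge (ltW cq).
Qed.

(** The identity from the Lebesgue sets to the Borel sets is measurable and pushes one measure to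
    the other, so this is a change of variables. *)
Lemma integral_leb D h' : measurable D -> measurable_fun setT h' ->
    (leb R).-integrable D (EFin \o h') ->
  (@lebesgue_measure R).-integrable D (EFin \o h') /\
  \int[leb R]_(t in D) h' t = \int[@lebesgue_measure R]_(t in D) h' t.
Proof.
move=> mD mh' ih'.
have mE : measurable_fun setT (EFin \o h') by apply/measurable_EFinP.
have I1 := @integrable_pushforward _ _ _ _ _ _ measurable_leb_id (leb R) D (EFin \o h') mE ih' mD.
have I2 := @integral_pushforward _ _ _ _ _ _ measurable_leb_id (leb R) D (EFin \o h') mE ih' mD.
split.
  apply/integrableP; split; first exact: measurable_funS mE.
  move/integrableP : I1 => [_].
  rewrite [X in (X < _)%E -> _](eq_measure_integral (@lebesgue_measure R));
    [by []|exact: measurable_leb_id|by []].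
move: I2; rewrite [X in X = _](eq_measure_integral (@lebesgue_measure R));
  [move=> I2|exact: measurable_leb_id|by []].
by rewrite /Rintegral [X in _ = fine X]I2.
Qed.

End lebesgue_completion.

(** * Absolute continuity and vanishing derivatives *)

Section derivative_bound.
Context {R : realType} {V : normedModType R}.
Implicit Types (x : R -> V) (s : R) (v : V).

(** Written without a quotient, the estimate includes [r = s] and transfers entry by entry to
    matrices. *)
Lemma is_derive_bound x s v : is_derive s (1 : R) x v ->
  forall e : R, 0 < e -> exists2 d : R, 0 < d &
    forall r, `|r - s| < d -> `|x r - x s - (r - s) *: v| <= e * `|r - s|.
Proof.
move=> [dx dxv] e e0.
have : h^-1 *: ((x \o shift s) (h *: (1 : R)) - x s) @[h --> 0^'] --> v.
  by rewrite -dxv; exact: dx.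
move=> /cvgrPdist_le /(_ e e0) /nbhs_ballP [d /= d0 H].
exists d => // r rs; have [->|rs0] := eqVneq r s.
  by rewrite !subrr scale0r subr0 !normr0 mulr0.
have rs0' : r - s != 0 by rewrite subr_eq0.
have := H (r - s); rewrite /ball/= sub0r normrN => /(_ rs rs0').
rewrite [(r - s) *: 1]mulr1 subrK => {}H.
have -> : x r - x s - (r - s) *: v = (r - s) *: ((r - s)^-1 *: (x r - x s) - v).
  by rewrite scalerBr scalerA divff // scale1r.
by rewrite normrZ mulrC ler_wpM2r // distrC.
Qed.

Lemma bound_is_derive x s v :
  (forall e : R, 0 < e -> exists2 d : R, 0 < d &
    forall r, `|r - s| < d -> `|x r - x s - (r - s) *: v| <= e * `|r - s|) ->
  is_derive s (1 : R) x v.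
Proof.
move=> H.
have L : h^-1 *: ((x \o shift s) (h *: (1 : R)) - x s) @[h --> 0^'] --> v.
  apply/cvgrPdist_le => e e0; have [d d0 Hd] := H _ e0.
  apply/nbhs_ballP; exists d => //= h; rewrite /ball/= sub0r normrN => hd h0.
  have := Hd (h + s); rewrite addrK => /(_ hd).
  have -> : x (h + s) - x s - h *: v = h *: (h^-1 *: (x (h + s) - x s) - v).
    by rewrite scalerBr scalerA divff // scale1r.
  rewrite normrZ mulrC ler_pM2r ?normr_gt0 // distrC.
  by rewrite [h *: 1]mulr1.
apply: DeriveDef; first by apply/cvg_ex; exists v.
exact: (@cvg_lim _ (@norm_hausdorff _ _)).
Qed.

End derivative_bound.

Section real_induction.
Context {R : realType}.

(** The supremum of the times where [P] holds can neither fall short of [T] nor fail to be reached.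
    The step leads from any [t] slightly before [s] to any [r] slightly after it, so one rule
    handles both the passage to the limit and the continuation. *)
Lemma real_induction (T : R) (P : R -> Prop) : 0 <= T -> P 0 ->
  (forall s : R, 0 <= s <= T -> exists2 e : R, 0 < e & forall t r : R,
     0 <= t -> s - e < t -> t <= s -> s <= r -> r <= T -> r < s + e -> P t -> P r) ->
  P T.
Proof.
move=> T0 P0 step.
pose S := [set t | 0 <= t <= T /\ P t].
have S0 : S 0 by split => //; rewrite lexx.
have hS : has_sup S by split; [exists 0|exists T => t [/andP[]]].
pose s := sup S.
have s0 : 0 <= s by apply: ub_le_sup => //; case: hS.
have sT : s <= T by apply: ge_sup => [|t [/andP[]]//]; exists 0.
have [|e e0 H] := step s; first by rewrite s0.
have [t [/andP[t0 tT] Pt] st] := sup_adherent e0 hS.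
have ts : t <= s by apply: ub_le_sup; [case: hS|split; rewrite ?t0].
have [sT'|Ts] := ltP s T; last first.
  have <- : s = T by apply/eqP; rewrite eq_le sT.
  by apply: (H t) => //; rewrite ltrDl.
pose r := Num.min T (s + e / 2).
have sr : s < r by rewrite lt_min sT' ltrDl divr_gt0.
have rT : r <= T by rewrite ge_min lexx.
have Pr : P r.
  apply: (H t) => //; first exact: ltW.
  rewrite gt_min; apply/orP; right; rewrite ltrD2l.
  by rewrite ltr_pdivrMr // ltr_pMr // ltr1n.
have : r <= s by apply: ub_le_sup; [case: hS|split => //; rewrite rT (le_trans s0 (ltW sr))].
by rewrite leNgt sr.
Qed.

End real_induction.

Section absolutely_continuous.
Context {R : realType}.

(** An ordered list can be lengthened by one interval at a time, which suits an induction better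
    than the indexed families of [abs_continuous]; the order provides the disjointness. *)
Lemma ac_interval_list (V : normedModType R) (T : R) (x : R -> V) (d e : R) (l : seq (R * R)) :
  (forall (n : nat) (a b : 'I_n -> R),
      (forall i, [/\ 0 <= a i, a i <= b i & b i <= T]) ->
      trivIset [set: 'I_n] (fun i => `]a i, b i[%classic) ->
      \sum_(i < n) (b i - a i) < d ->
      \sum_(i < n) `|x (b i) - x (a i)| < e) ->
  all (fun p => [&& 0 <= p.1, p.1 <= p.2 & p.2 <= T]) l ->
  pairwise (fun p q => p.2 <= q.1) l ->
  \sum_(p <- l) (p.2 - p.1) < d ->
  \sum_(p <- l) `|x p.2 - x p.1| < e.
Proof.
move=> H al pl; rewrite !(big_nth (0, 0)) !big_mkord => ld.
apply: (H (size l) (fun i => (nth (0,0) l i).1) (fun i => (nth (0,0) l i).2)) => //.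
  by move=> i; have /and3P[] := all_nthP (0,0) al i (ltn_ord i).
move/(pairwiseP (0,0)): pl => pl.
have K (i j : 'I_(size l)) : (i < j)%N ->
    `](nth (0,0) l i).1, (nth (0,0) l i).2[%classic
    `&` `](nth (0,0) l j).1, (nth (0,0) l j).2[%classic !=set0 -> False.
  move=> ij [t /= []]; rewrite !in_itv/= => /andP[_ t1] /andP[t2 _].
  have := pl i j (ltn_ord i) (ltn_ord j) ij.
  by rewrite leNgt (lt_trans t2 t1).
move=> i j _ _ ne; apply/val_inj; case: (ltngtP i j) => //= ij.
  by have := K _ _ ij ne.
by rewrite setIC in ne; have := K _ _ ij ne.
Qed.

(** Real induction replaces a Vitali covering. At a time with zero derivative the increment is
    charged to [e] times the elapsed time; at an exceptional time a whole interval inside a small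
    open set [O] joins a list. The total length of the list stays below [d], so absolute continuity
    bounds its share by [e]. *)
Lemma ac_zero_derivative (T : R) (y : R -> R) : 0 <= T -> abs_continuous T y ->
  {ae leb R, forall t : R, 0 <= t -> is_derive t (1 : R) y 0} -> y T = y 0.
Proof.
move=> T0 ac dy.
apply/eqP; rewrite -subr_eq0 -normr_le0; apply/ler_addgt0Pr => e0 e0gt; rewrite add0r.
(* Room for [e * T] from the times with zero derivative and for one more [e] from the list. *)
pose e := e0 / (T + 1).
have T1 : 0 < T + 1 by rewrite ltr_wpDl.
have egt : 0 < e by rewrite divr_gt0.
have [d d0 Hd] := ac _ egt.
have [B [mB B0 NB]] := leb_negligible dy.
pose N := B `|` [set 0].
have mN : measurable N by apply: measurableU.
have N0 : lebesgue_measure N = 0%E.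
  apply/eqP; rewrite -measure_le0.
  by rewrite (le_trans (measureU2 _ _ _))//= -leb_lebesgue B0 lebesgue_measure_set1 adde0.
have [|O [oO NO Od]] := lebesgue_regularity_outer mN _ d0; first by rewrite [X in (X < _)%E]N0 ltry.
have mO : measurable O by exact: open_measurable.
have {}Od : (lebesgue_measure O < d%:E)%E.
  apply: le_lt_trans Od; have := measureU2 (@lebesgue_measure R) mN (measurableD mO mN).
  by rewrite setDUK // [X in (_ <= X + _)%E -> _]N0 add0e.
pose P (t : R) := exists l : seq (R * R), [/\
  all (fun p => [&& 0 <= p.1, p.1 <= p.2 & p.2 <= t]) l,
  pairwise (fun p q => p.2 <= q.1) l,
  ((\sum_(p <- l) (p.2 - p.1))%:E <= lebesgue_measure (O `&` `[0%R, t]))%E &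
  `|y t - y 0| <= e * t + \sum_(p <- l) `|y p.2 - y p.1| ].
have [l [al pl sl yl]] : P T.
  apply: real_induction => //.
    by exists [::]; split => //; rewrite big_nil ?mulr0 ?subrr ?normr0 ?addr0.
  move=> s /andP[s0 sT]; have [Ns|Ns] := pselect (N s).
    have [e1 /= e10 He1] : exists2 e1 : R, 0 < e1 & ball s e1 `<=` O.
      by apply/nbhs_ballP; exact: open_nbhs_nbhs (conj oO (NO _ Ns)).
    exists e1 => // t r t0 set ts sr rT rse [l [al pl sl yl]].
    exists (rcons l (t, r)); split.
    - rewrite all_rcons/= t0 (le_trans ts sr) lexx/=.
      apply: sub_all al => p /and3P[-> -> p2] /=.
      by rewrite (le_trans p2) // (le_trans ts sr).
    - rewrite -cats1 pairwise_cat pl /= andbT; apply/allrelP => p q.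
      by move=> /(allP al)/and3P[_ _ p2]; rewrite inE => /eqP->.
    - rewrite -cats1 big_cat big_seq1/=.
      have sub : (O `&` `[0%R, t]) `|` `]t, r[ `<=` O `&` `[0%R, r].
        move=> u /= [[Ou]|]; rewrite !in_itv/=.
          by move=> /andP[-> ut]; split => //=; rewrite (le_trans ut)// (le_trans ts sr).
        move=> /andP[tu ur]; split; last first.
          by rewrite (le_trans t0 (ltW tu)) (ltW ur).
        apply: He1; rewrite /ball/= ltr_distlC; apply/andP; split; last exact: lt_trans rse.
        exact: lt_trans tu.
      apply: (@le_trans _ _ (lebesgue_measure ((O `&` `[0%R, t]) `|` `]t, r[))).
        rewrite measureU//=; [|exact: measurableI|].
          rewrite lebesgue_measure_itv/= EFinD leeD // lte_fin.
          case: ltP => //; rewrite ?lee_fin ?subr_le0 //.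
        apply/seteqP; split => u //= [[_]]; rewrite !in_itv/= => /andP[_ ut] /andP[].
        by rewrite ltNge ut.
      apply: le_measure; rewrite ?inE //; last exact: measurableI.
      by apply: measurableU => //; exact: measurableI.
    - rewrite -cats1 big_cat big_seq1/= addrA.
      have -> : y r - y 0 = (y t - y 0) + (y r - y t) by ring.
      apply: le_trans (ler_normD _ _) _; rewrite lerD2r (le_trans yl)// lerD2r.
      by rewrite ler_pM2l //; exact: le_trans sr.
  have sp : 0 < s.
    rewrite lt_neqAle s0 andbT; apply/eqP => s00; apply: Ns; right.
    by rewrite -s00.
  have ds : is_derive s (1 : R) y 0.
    apply: contrapT => nd; apply: Ns; left; apply: NB => /= H; exact/nd/H.
  have [e1 e10 H] := is_derive_bound ds egt.
  exists e1 => // t r t0 set ts sr rT rse [l [al pl sl yl]].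
  exists l; split => //.
  - apply: sub_all al => p /and3P[-> -> p2] /=.
    by rewrite (le_trans p2) // (le_trans ts sr).
  - apply: le_trans sl _; apply: le_measure; rewrite ?inE; try exact: measurableI.
    move=> u /= [Ou]; rewrite !in_itv/= => /andP[-> ut]; split => //=.
    by rewrite (le_trans ut)// (le_trans ts sr).
  - have H1 : `|y r - y s| <= e * (r - s).
      have := H r; rewrite scaler0 subr0 ger0_norm ?subr_ge0//; apply.
      by rewrite ltrBlDl.
    have H2 : `|y s - y t| <= e * (s - t).
      have := H t; rewrite scaler0 subr0 (distrC t) (distrC (y t)) [`|s - t|]ger0_norm ?subr_ge0//; apply.
      by rewrite ltrBlDl -ltrBlDr.
    have -> : y r - y 0 = (y r - y s) + ((y s - y t) + (y t - y 0)) by ring.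
    apply: le_trans (ler_normD _ _) _; apply: le_trans (lerD H1 (ler_normD _ _)) _.
    apply: le_trans (lerD (lexx _) (lerD H2 yl)) _.
    by rewrite le_eqVlt; apply/orP; left; apply/eqP; ring.
apply: le_trans yl _.
have sd : \sum_(p <- l) (p.2 - p.1) < d.
  rewrite -lte_fin; apply: le_lt_trans sl _; apply: le_lt_trans Od.
  by apply: le_measure; rewrite ?inE //; exact: measurableI.
have := ac_interval_list Hd al pl sd => /ltW le2.
apply: le_trans (lerD (lexx _) le2) _.
by rewrite -[X in _ + X]mulr1 -mulrDr /e divfK // gt_eqF.
Qed.

End absolutely_continuous.

(** * Primitives of locally integrable functions *)

Section primitives.
Context {R : realType}.
Implicit Types (h b : R -> R) (s t T c : R).

Definition lmeas h :=
  measurable_fun (`[0, +oo[%classic : set (lebT R)) (h : lebT R -> R).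

Definition prim h t : R := \int[leb R]_(s in `[0, t]) h s.

Lemma measurable_leb_itv (i : interval R) : measurable ([set` i] : set (lebT R)).
Proof. by apply: leb_measurable; exact: measurable_itv. Qed.
Hint Resolve measurable_leb_itv : core.

Lemma measurable_leb_set1 s : measurable ([set s] : set (lebT R)).
Proof. by apply: leb_measurable. Qed.
Hint Resolve measurable_leb_set1 : core.

Lemma leb_itv_lty s t : (leb R `[s, t]%classic < +oo)%E.
Proof.
by rewrite leb_lebesgue lebesgue_measure_itv/=; case: ifP => //; rewrite -EFinB ltry.
Qed.

Lemma loc_integrable_lmeas h : loc_integrable h -> lmeas h.
Proof.
move=> hi; rewrite /lmeas.
have -> : `[0, +oo[%classic = \bigcup_i `[0 : R, i%:R]%classic.
  apply/seteqP; split => t /=; rewrite in_itv/= ?andbT.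
    move=> t0; exists (Num.truncn t).+1 => //=; rewrite in_itv/= t0 ltW //.
    exact: truncnS_gt.
  by move=> [i _]; rewrite /= in_itv/= => /andP[].
apply/measurable_fun_bigcup => i; first exact (measurable_leb_itv _).
by apply/measurable_EFinP/(measurable_int (leb R)); exact: hi.
Qed.

Lemma lmeasS h s t : 0 <= s -> lmeas h ->
  measurable_fun (`[s, t]%classic : set (lebT R)) (h : lebT R -> R).
Proof.
move=> s0 mh; apply: measurable_funS mh => //.
by move=> r /=; rewrite !in_itv/= andbT => /andP[sr _]; exact: le_trans sr.
Qed.

(** The dominating function may depend on the horizon, as do the bounds that the regularity
    conditions give on compact sets. *)
Lemma loc_integrable_dom h : lmeas h ->
  (forall T, 0 <= T -> exists2 b, loc_integrable b &
     forall t, 0 <= t <= T -> `|h t| <= b t) ->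
  loc_integrable h.
Proof.
move=> mh hb T T0; have [b bi bh] := hb T T0.
apply: le_integrable (bi T T0) => //.
  by apply/measurable_EFinP; exact: lmeasS.
move=> t /=; rewrite in_itv/= => t0T.
by rewrite lee_fin (le_trans (bh t t0T)) // ler_norm.
Qed.

Lemma loc_integrable_cst c : loc_integrable (fun=> c).
Proof.
move=> T T0; apply/integrableP; split; first exact/measurable_EFinP.
rewrite integral_cst//=; apply: lte_mul_pinfty => //.
exact: leb_itv_lty.
Qed.

Lemma loc_integrableD h1 h2 : loc_integrable h1 -> loc_integrable h2 ->
  loc_integrable (fun t => h1 t + h2 t).
Proof.
move=> i1 i2 T T0; have := integrableD (@measurable_leb_itv _) (i1 T T0) (i2 T T0).
exact.
Qed.

Lemma loc_integrableZ c h : loc_integrable h -> loc_integrable (fun t => c * h t).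
Proof.
move=> i1 T T0; have := integrableZl (@measurable_leb_itv _) c (i1 T T0).
exact.
Qed.

Lemma loc_integrableN h : loc_integrable h -> loc_integrable (fun t => - h t).
Proof. by move=> i1 T T0; have := integrableN (i1 T T0). Qed.

Lemma loc_integrableB h1 h2 : loc_integrable h1 -> loc_integrable h2 ->
  loc_integrable (fun t => h1 t - h2 t).
Proof. by move=> i1 i2; apply: loc_integrableD => //; exact: loc_integrableN. Qed.

Lemma loc_integrable_norm h : loc_integrable h -> loc_integrable (fun t => `|h t|).
Proof. by move=> i1 T T0; have := integrable_norm (i1 T T0). Qed.

Lemma loc_integrable_sum I (r : seq I) (P : pred I) (F : I -> R -> R) :
  (forall i, P i -> loc_integrable (F i)) ->
  loc_integrable (fun t => \sum_(i <- r | P i) F i t).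
Proof.
move=> Fi; elim: r => [|i r IH].
  rewrite (_ : (fun _ => _) = fun=> 0); first exact: loc_integrable_cst.
  by apply/funext => t; rewrite big_nil.
have [Pi|Pi] := boolP (P i).
  rewrite (_ : (fun _ => _) = fun t => F i t + \sum_(j <- r | P j) F j t).
    by apply: loc_integrableD => //; exact: Fi.
  by apply/funext => t; rewrite big_cons Pi.
rewrite (_ : (fun _ => _) = fun t => \sum_(j <- r | P j) F j t) //.
by apply/funext => t; rewrite big_cons (negbTE Pi).
Qed.

Lemma eq_loc_integrable h1 h2 : (forall t, 0 <= t -> h1 t = h2 t) ->
  loc_integrable h1 -> loc_integrable h2.
Proof.
move=> E i1 T T0; apply: eq_integrable (i1 T T0) => //.
by move=> t; rewrite inE/= in_itv/= => /andP[t0 _]; rewrite E.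
Qed.

Lemma integrable_sub h s t : 0 <= s -> loc_integrable h ->
  (leb R).-integrable `[s, t] (EFin \o h).
Proof.
move=> s0 hi; have := hi `|t| (normr_ge0 t); apply: integrableS => //.
move=> r /=; rewrite !in_itv/= => /andP[sr rt].
by rewrite (le_trans s0 sr) (le_trans rt) // ler_norm.
Qed.

Lemma integral_null (N : set R) h : loc_integrable h ->
  measurable (N : set (lebT R)) -> leb R N = 0%E -> N `<=` `[0, +oo[ ->
  \int[leb R]_(t in N) h t = 0.
Proof.
move=> hi mN N0 Np; rewrite /Rintegral null_set_integral; [by []|exact: mN| |exact: N0].
apply/measurable_EFinP; apply: measurable_funS (loc_integrable_lmeas hi); last exact: Np.
exact (measurable_leb_itv _).
Qed.

Lemma prim0 h : loc_integrable h -> prim h 0 = 0.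
Proof.
move=> hi; rewrite /prim set_itv1 integral_null //.
- by rewrite leb_lebesgue lebesgue_measure_set1.
- by move=> t /= ->; rewrite in_itv/= lexx.
Qed.

Lemma primB h s t : loc_integrable h -> 0 <= s <= t ->
  prim h t - prim h s = \int[leb R]_(r in `]s, t]) h r.
Proof.
move=> hi /andP[s0 st]; rewrite /prim.
rewrite (@itv_bndbnd_setU _ _ (BLeft 0) (BRight s) (BRight t)) ?bnd_simp //.
rewrite Rintegral_setU //.
- by rewrite addrC addKr.
- rewrite -itv_bndbnd_setU ?bnd_simp //; apply: hi; exact: le_trans st.
- apply/disj_setPS => r /= []; rewrite !in_itv/= => /andP[_ rs] /andP[].
  by rewrite ltNge rs.
Qed.

Lemma primBcc h s t : loc_integrable h -> 0 <= s <= t ->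
  prim h t - prim h s = \int[leb R]_(r in `[s, t]) h r.
Proof.
move=> hi /[dup] st /andP[s0 st']; rewrite primB // -(@setU1itv _ _ (BRight t) s false) //.
rewrite Rintegral_setU //.
- rewrite (@integral_null [set s]) ?add0r //.
  + exact: lebesgue_measure_set1.
  + by move=> r /= ->; rewrite in_itv/= s0.
- by rewrite (@setU1itv _ _ (BRight t) s false) //; exact: integrable_sub.
- apply/disj_setPS => r /= [->]; rewrite !in_itv/= => /andP[].
  by rewrite ltxx.
Qed.

Lemma prim_le h1 h2 s t : loc_integrable h1 -> loc_integrable h2 -> 0 <= s <= t ->
  (forall r, s <= r <= t -> h1 r <= h2 r) ->
  prim h1 t - prim h1 s <= prim h2 t - prim h2 s.
Proof.
move=> i1 i2 st le; rewrite !primBcc //; case/andP: st => s0 st.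
by apply: le_Rintegral => //; exact: integrable_sub.
Qed.

Lemma primD h1 h2 t : loc_integrable h1 -> loc_integrable h2 -> 0 <= t ->
  prim (fun r => h1 r + h2 r) t = prim h1 t + prim h2 t.
Proof. by move=> i1 i2 t0; rewrite /prim RintegralD //; [exact: i1|exact: i2]. Qed.

Lemma primZ c h t : loc_integrable h -> 0 <= t ->
  prim (fun r => c * h r) t = c * prim h t.
Proof. by move=> i1 t0; rewrite /prim RintegralZl //; exact: i1. Qed.

Lemma primN h t : loc_integrable h -> 0 <= t ->
  prim (fun r => - h r) t = - prim h t.
Proof.
move=> i1 t0; rewrite -mulN1r -primZ //.
by congr (prim _ t); apply/funext => r; rewrite mulN1r.
Qed.

Lemma primB_fun h1 h2 t : loc_integrable h1 -> loc_integrable h2 -> 0 <= t ->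
  prim (fun r => h1 r - h2 r) t = prim h1 t - prim h2 t.
Proof. by move=> i1 i2 t0; rewrite /prim RintegralB //; [exact: i1|exact: i2]. Qed.

Lemma prim_cst c t : 0 <= t -> prim (fun=> c) t = c * t.
Proof.
move=> t0; rewrite /prim Rintegral_cst //.
have E : leb R `[0, t]%classic = t%:E.
  rewrite leb_lebesgue lebesgue_measure_itv/= lte_fin.
  by rewrite lt_neqAle t0 andbT; case: eqP => [<-|]//=; rewrite ?sube0.
by rewrite [X in fine X]E.
Qed.

Lemma prim_sum I (r : seq I) (P : pred I) (F : I -> R -> R) t : 0 <= t ->
  (forall i, P i -> loc_integrable (F i)) ->
  prim (fun s => \sum_(i <- r | P i) F i s) t = \sum_(i <- r | P i) prim (F i) t.
Proof.
move=> t0 Fi; elim: r => [|i r IH].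
  rewrite (_ : (fun _ => _) = fun=> 0); first by rewrite big_nil prim_cst // mul0r.
  by apply/funext => s; rewrite big_nil.
rewrite big_cons; have [Pi|Pi] := boolP (P i).
  rewrite (_ : (fun _ => _) = fun s => F i s + \sum_(j <- r | P j) F j s).
    by rewrite primD ?IH //; [exact: Fi|exact: loc_integrable_sum].
  by apply/funext => s; rewrite big_cons Pi.
rewrite (_ : (fun _ => _) = fun s => \sum_(j <- r | P j) F j s) //.
by apply/funext => s; rewrite big_cons (negbTE Pi).
Qed.

Lemma eq_prim h1 h2 t : (forall r, 0 <= r <= t -> h1 r = h2 r) ->
  prim h1 t = prim h2 t.
Proof.
move=> E; apply: eq_Rintegral => r; rewrite inE/= in_itv/=; exact: E.
Qed.

Lemma prim_mono h s t : loc_integrable h -> 0 <= s <= t ->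
  (forall r, s <= r <= t -> 0 <= h r) -> prim h s <= prim h t.
Proof.
move=> hi st h0; rewrite -subr_ge0 primBcc //; apply: Rintegral_ge0 => r /=.
by rewrite in_itv/=; exact: h0.
Qed.

Lemma prim_ge0 h t : loc_integrable h -> (forall r, 0 <= r <= t -> 0 <= h r) ->
  0 <= prim h t.
Proof. by move=> hi h0; apply: Rintegral_ge0 => r /=; rewrite in_itv/=; exact: h0. Qed.

Lemma prim_dom h b s t : loc_integrable h -> loc_integrable b -> 0 <= s <= t ->
  (forall r, s <= r <= t -> `|h r| <= b r) ->
  `|prim h t - prim h s| <= prim b t - prim b s.
Proof.
move=> hi bi st hb; have [s0 st'] := andP st; have t0 := le_trans s0 st'.
have H1 : prim h t - prim h s <= prim b t - prim b s.
  by apply: prim_le => // r rst; rewrite (le_trans (ler_norm _)) ?hb.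
have H2 : prim (fun r => - b r) t - prim (fun r => - b r) s <= prim h t - prim h s.
  apply: prim_le => //; first exact: loc_integrableN.
  move=> r rst; rewrite lerNl (le_trans _ (hb r rst)) // -normrN ler_norm //.
rewrite !primN // in H2.
by rewrite ler_norml; apply/andP; split; lra.
Qed.

End primitives.

Section fundamental_theorem.
Context {R : realType}.
Implicit Types (h b : R -> R) (s t T c : R).
Hint Resolve measurable_leb_itv : core.
Hint Resolve measurable_leb_set1 : core.

Lemma ae_leb_imply (P Q : R -> Prop) : (forall t, P t -> Q t) ->
  {ae leb R, forall t, P t} -> {ae leb R, forall t, Q t}.
Proof.
by move=> PQ [N [mN N0 PN]]; exists N; split => // t nQ; apply: PN => Pt; apply/nQ/PQ.
Qed.

Lemma ae_leb_imply2 (P P' Q : R -> Prop) : (forall t, P t -> P' t -> Q t) ->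
  {ae leb R, forall t, P t} -> {ae leb R, forall t, P' t} -> {ae leb R, forall t, Q t}.
Proof.
move=> PQ aeP aeP'.
have := @filterI _ _ (ae_filter_ringOfSetsType (leb R)) _ _ aeP aeP'.
by apply: ae_leb_imply => t [Pt P't]; exact: PQ.
Qed.

Lemma ae_leb_eq0 : {ae leb R, forall t, t != 0}.
Proof.
exists [set 0]; split => //; first exact: lebesgue_measure_set1.
by move=> t /= /negP; rewrite negbK => /eqP.
Qed.

(** Lebesgue differentiation is applied to a Borel representative of [h] cut off outside [0, N + 1].
    The conclusion carries back to the open interval, where both primitives agree. *)
Lemma prim_derive h : loc_integrable h ->
  {ae leb R, forall t, 0 <= t -> is_derive t (1 : R) (prim h) (h t)}.
Proof.
move=> hi.
(* The exceptional sets of countably many horizons still form a null set. Time 0 joins it, since a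
   two-sided derivative there involves negative times. *)
suff H (N : nat) : {ae leb R, forall t, 0 < t < N.+1%:R -> is_derive t (1 : R) (prim h) (h t)}.
  have H' := ae_foralln H.
  move: H' ae_leb_eq0; apply: ae_leb_imply2 => t Ht t0 tge.
  apply: (Ht (Num.truncn t)); rewrite lt_neqAle eq_sym t0 tge /=.
  exact: truncnS_gt.
pose D := `[0 : R, N.+1%:R]%classic.
pose h1 := h \_ D.
have mD : measurable (D : set R) by exact: measurable_itv.
have h1m : measurable_fun [set: lebT R] (h1 : lebT R -> R).
  have [+ _] := measurable_restrictT (T1 := lebT R) h (leb_measurable mD); apply.
  by rewrite /D; apply: lmeasS => //; exact: loc_integrable_lmeas.
have h1i : (leb R).-integrable setT (EFin \o h1).
  have [+ _] := integrable_mkcond (mu := leb R) (EFin \o h) (leb_measurable mD).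
  by rewrite restrict_EFin; apply; exact: hi.
have [h' mh' hh'] := borel_rep h1m.
have mh'l : measurable_fun [set: lebT R] (h' : lebT R -> R).
  exact: measurable_fun_leb.
have h'i : (leb R).-integrable setT (EFin \o h').
  apply/integrableP; split; first exact/measurable_EFinP.
  have [_ h1fin] := integrableP _ _ _ h1i.
  apply: le_lt_trans h1fin; rewrite le_eqVlt; apply/orP; left; apply/eqP.
  apply: ae_eq_integral; first exact: measurableT.
  - apply: (measurableT_comp (@abse_measurable R setT)).
    exact/measurable_EFinP.
  - apply: (measurableT_comp (@abse_measurable R setT)).
    exact/measurable_EFinP.
  by move: hh'; apply: ae_leb_imply => t /= ->.
have [h'L _] := integral_leb (@measurableT _ R) mh' h'i.
have [] := @FTC1 R h' (BLeft 0).
- by move=> y; apply: integrableS h'L.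
- by apply: open_integrable_locally => //; exact: openT.
have FP t : 0 <= t <= N.+1%:R -> \int[@lebesgue_measure R]_(s in `[0, t]) h' s = prim h t.
  move=> /andP[t0 tN].
  have := @integral_leb R `[0, t]%classic h' (measurable_itv _) mh'.
  case; first by apply: integrableS h'i => //.
  move=> _ <-; rewrite /prim /Rintegral; congr fine; apply: ae_eq_integral.
  - exact (measurable_leb_itv _).
  - by apply/measurable_EFinP; apply: measurable_funS mh'l.
  - by apply/measurable_EFinP; apply: lmeasS => //; exact: loc_integrable_lmeas.
  move: hh'; apply: ae_leb_imply => s /= <-; rewrite in_itv/= => /andP[s0 st].
  by rewrite /h1 patchE mem_set //= /D/= in_itv/= s0 (le_trans st tN).
move=> B [mB B0 BF].
have Fd : {ae leb R, forall t, 0 < t -> derivable (fun t => \int[@lebesgue_measure R]_(s in `[0, t]) h' s) t 1 /\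
   (fun t => \int[@lebesgue_measure R]_(s in `[0, t]) h' s)^`()%classic t = h' t}.
  apply: ae_lebesgue_leb; exists B; split => // t nt; apply: BF => FE; apply: nt => t0; apply: FE.
move: hh' Fd; apply: ae_leb_imply2 => t h't Ft /andP[t0 tN].
have [dF F't] := Ft t0.
have tE : h t = h' t.
  by rewrite -h't /h1 patchE mem_set //= /D/= in_itv/= !ltW.
apply: (@near_eq_is_derive _ _ _ (fun t => \int[@lebesgue_measure R]_(s in `[0, t]) h' s)).
  near=> s; apply: FP; apply/andP; split; apply/ltW.
    by near: s; exact: lt_nbhsr.
  by near: s; exact: lt_nbhsl.
by apply: DeriveDef => //; rewrite -derive1E F't tE.
Unshelve. all: by end_near. Qed.

End fundamental_theorem.

(** * Absolute continuity of the integral *)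

Section absolute_continuity_of_primitives.
Context {R : realType}.
Implicit Types (h b : R -> R) (s t T c : R).
Hint Resolve measurable_leb_itv : core.
Hint Resolve measurable_leb_set1 : core.

Lemma primBoo h s t : loc_integrable h -> 0 <= s <= t ->
  prim h t - prim h s = \int[leb R]_(r in `]s, t[) h r.
Proof.
move=> hi /[dup] st /andP[s0 st']; rewrite primB //.
move: st'; rewrite le_eqVlt => /predU1P[<-|st'].
  by rewrite set_itvoc0 set_itvoo0.
rewrite -(@setUitv1 _ _ (BRight s) t true) ?bnd_simp //.
rewrite Rintegral_setU //.
- rewrite (@integral_null _ [set t]) ?addr0 //.
  + exact: lebesgue_measure_set1.
  + by move=> r /= ->; rewrite in_itv/= (le_trans s0 (ltW st')).
- rewrite (@setUitv1 _ _ (BRight s) t true) ?bnd_simp //.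
  apply: integrableS (integrable_sub t s0 hi) => //.
  exact: subset_itv_oc_cc.
- apply/disj_setPS => r /= [] + rt; rewrite rt in_itv/= => /andP[_].
  by rewrite ltxx.
Qed.

Lemma prim_disjoint_sum h T n (a b : 'I_n -> R) : loc_integrable h ->
  (forall t, 0 <= t -> 0 <= h t) ->
  (forall i, [/\ 0 <= a i, a i <= b i & b i <= T]) ->
  trivIset [set: 'I_n] (fun i => `]a i, b i[%classic) ->
  0 <= T ->
  \sum_(i < n) (prim h (b i) - prim h (a i)) <= prim h T.
Proof.
move=> hi h0 ab tI T0.
have mh := loc_integrable_lmeas hi.
have E0 i : prim h (b i) - prim h (a i) = \int[leb R]_(r in `]a i, b i[) h r.
  by rewrite primBoo //; have [-> ->] := ab i.
rewrite (eq_bigr _ (fun i _ => E0 i)).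
rewrite -lee_fin -sumEFin.
have E (D : set R) : measurable (D : set (lebT R)) -> D `<=` `[0, T] ->
    ((\int[leb R]_(r in D) h r)%:E = \int[leb R]_(r in D) (h r)%:E)%E.
  move=> mD DT; rewrite /Rintegral fineK //.
  apply: integrable_fin_num => //; apply: integrableS (hi T T0) => //.
have DT i : `]a i, b i[ `<=` `[0, T].
  have [a0 _ bT] := ab i; move=> r /=; rewrite !in_itv/= => /andP[ar rb].
  by rewrite (le_trans a0 (ltW ar)) (le_trans (ltW rb) bT).
rewrite (eq_bigr (fun i => \int[leb R]_(r in `]a i, b i[) (h r)%:E)%E); last first.
  by move=> i _; apply: E.
pose D := \big[setU/set0]_(i <- index_enum 'I_n) `]a i, b i[%classic.
have DT' : D `<=` `[0, T] by rewrite /D; elim/big_ind : _ => // A B AT BT r [/AT|/BT].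
have mD : measurable (D : set (lebT R)).
  apply: (@bigsetU_measurable _ (lebT R)) => i _; exact (measurable_leb_itv _).
have ET := E `[0, T]%classic (measurable_leb_itv _) (@subset_refl _ _).
rewrite /prim ET.
have mhD : measurable_fun (D : set (lebT R)) (EFin \o h : lebT R -> \bar R).
  apply/measurable_EFinP; apply: measurable_funS mh => //.
  by apply: subset_trans DT' _ => r /=; rewrite !in_itv/= => /andP[-> _].
have h0T r : `[0, T]%classic r -> (0 <= (EFin \o h) r)%E.
  by rewrite /= in_itv/= lee_fin => /andP[r0 _]; exact: h0.
have := @ge0_integral_bigsetU _ (lebT R) _ (leb R) 'I_n (fun i => `]a i, b i[%classic) (EFin \o h)
  (index_enum 'I_n) (fun i => measurable_leb_itv _) (index_enum_uniq _) _ mhD _.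
move=> <-.
- apply: ge0_subset_integral.
  + exact: mD.
  + exact (measurable_leb_itv _).
  + by apply/measurable_EFinP; exact: lmeasS.
  + exact: h0T.
  + exact: DT'.
- by apply: sub_trivIset tI.
- by move=> r rD; apply: h0T; exact: DT'.
Qed.

(** The excess of $|h|$ over the level [n] is dominated by $|h|$ and vanishes at each time once [n]
    is large, so dominated convergence applies. *)
Lemma prim_tail h T e : loc_integrable h -> 0 <= T -> 0 < e ->
  exists n : nat, prim (fun t => `|h t| - Num.min `|h t| n%:R) T < e.
Proof.
move=> hi T0 e0.
pose k (n : nat) t : \bar R := (`|h t| - Num.min `|h t| n%:R)%:E.
have mh := lmeasS (t := T) (lexx 0) (loc_integrable_lmeas hi).
have mk n : measurable_fun (`[0, T]%classic : set (lebT R)) (k n : lebT R -> _).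
  have mn := measurableT_comp (@normr_measurable R setT) mh.
  apply/measurable_EFinP; apply: measurable_funB; first exact: mn.
  by apply: measurable_minr; [exact: mn|exact: measurable_cst].
have cvk : {ae leb R, forall t, `[0, T]%classic t -> k n t @[n --> \oo] --> 0%E}.
  apply: aeW => t _; apply: cvg_near_cst; near=> n.
  rewrite /k min_l ?subrr //; near: n.
  exact: nbhs_infty_ger.
have domk : {ae leb R, forall t, forall n, `[0, T]%classic t -> (`|k n t| <= `|h t|%:E)%E}.
  apply: aeW => t n _; rewrite /k /= lee_fin ger0_norm ?subr_ge0 ?ge_min ?lexx //.
  by rewrite gerBl le_min normr_ge0 ler0n.
have ih : (leb R).-integrable `[0, T] (fun t => `|h t|%:E).
  exact: (loc_integrable_norm hi T0).
have [_ _] := @dominated_convergence _ _ _ (leb R) `[0, T]%classic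
   (measurable_leb_itv _) k (cst 0%E) (fun t => `|h t|%:E) mk (measurable_cst _) cvk ih domk.
rewrite integral0 => /fine_cvgP[_ /cvgr_lt /(_ e e0)] [n _ Hn].
by exists n; apply: (Hn n) => /=.
Unshelve. all: by end_near. Qed.

(** The integrand splits into an excess of integral below [e / 2] and a part bounded by [n], whose
    integral is at most [n] times the length. *)
Lemma prim_ac h T : loc_integrable h -> 0 <= T -> abs_continuous T (prim h).
Proof.
move=> hi T0 e e0.
have e2 : 0 < e / 2 by rewrite divr_gt0.
have [n Hn] := prim_tail hi T0 e2.
(* The successor keeps this quotient positive when [n] is 0. *)
exists (e / 2 / n.+1%:R); first by rewrite divr_gt0.
move=> N a b ab tI ds.
pose k t := `|h t| - Num.min `|h t| n%:R.
pose q t := Num.min `|h t| n%:R.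
have mh := loc_integrable_lmeas hi.
have qi : loc_integrable q.
  apply: loc_integrable_dom.
    apply: measurable_minr; last exact: measurable_cst.
    exact: (measurableT_comp (@normr_measurable R setT) mh).
  move=> S S0; exists (fun=> n%:R); first exact: loc_integrable_cst.
  by move=> t _; rewrite /q ger0_norm ?le_min ?normr_ge0 ?ler0n // ge_min lexx orbT.
have ki : loc_integrable k by apply: loc_integrableB => //; exact: loc_integrable_norm.
have k0 t : 0 <= t -> 0 <= k t by move=> _; rewrite subr_ge0 ge_min lexx.
have := prim_disjoint_sum ki k0 ab tI T0 => Hk.
have S1 : \sum_(i < N) `|prim h (b i) - prim h (a i)| <=
    \sum_(i < N) (prim k (b i) - prim k (a i)) + n%:R * \sum_(i < N) (b i - a i).
  rewrite mulr_sumr -big_split /=; apply: ler_sum => i _.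
  have [a0 ai bT] := ab i; have b0 := le_trans a0 ai.
  have st : 0 <= a i <= b i by rewrite a0 ai.
  have H : `|prim h (b i) - prim h (a i)|
      <= prim (fun t => k t + q t) (b i) - prim (fun t => k t + q t) (a i).
    apply: prim_dom => //; first exact: loc_integrableD.
    by move=> r _; rewrite /k /q subrK.
  rewrite (primD ki qi b0) (primD ki qi a0) in H.
  have H1 : prim q (b i) - prim q (a i) <= n%:R * b i - n%:R * a i.
    rewrite -(prim_cst _ b0) -(prim_cst _ a0); apply: prim_le => //.
      exact: loc_integrable_cst.
    by move=> r _; rewrite /q ge_min lexx orbT.
  apply: (le_trans H); rewrite mulrBr.
  by rewrite opprD addrACA lerD2l.
apply: (le_lt_trans S1); rewrite [e]splitr; apply: ltr_leD.
  exact: le_lt_trans Hk Hn.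
have n1 : (0 : R) < n.+1%:R by rewrite ltr0n.
apply: (@le_trans _ _ (n.+1%:R * (e / 2 / n.+1%:R))).
  apply: ler_pM => //; rewrite ?ler0n ?ler_nat //.
    by apply: sumr_ge0 => i _; rewrite subr_ge0; have [] := ab i.
  exact: ltW.
by rewrite mulrC divfK // gt_eqF.
Qed.

(** Stated for all small [d], the condition is an eventuality along a filter, so finitely many of
    them combine without taking a minimum. *)
Lemma ac_near (V : normedModType R) T (x : R -> V) : abs_continuous T x <->
  forall e : R, 0 < e -> \forall d \near 0^'+,
    forall (n : nat) (a b : 'I_n -> R),
      (forall i, [/\ 0 <= a i, a i <= b i & b i <= T]) ->
      trivIset [set: 'I_n] (fun i => `]a i, b i[%classic) ->
      \sum_(i < n) (b i - a i) < d ->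
      \sum_(i < n) `|x (b i) - x (a i)| < e.
Proof.
split=> [ac e e0|H e e0].
  have [d d0 Hd] := ac e e0.
  exists d => //= c; rewrite /ball_/= sub0r normrN => cd c0 n a b ab tI sc.
  apply: Hd => //; apply: lt_trans sc _.
  by rewrite -(gtr0_norm c0).
have H' := H e e0; near (0:R)^'+ => d; exists d => //.
by near: d; exact: H'.
Unshelve. all: by end_near. Qed.

(** The common source of the closure properties: sums, products, norms and entries have increments
    controlled by those of finitely many absolutely continuous functions. *)
Lemma ac_dom (I : finType) (V W : normedModType R) T c (x : I -> R -> V) (z : R -> W) :
  (forall i, abs_continuous T (x i)) ->
  (forall s t, 0 <= s -> s <= t -> t <= T ->
     `|z t - z s| <= c * \sum_i `|x i t - x i s|) ->
  abs_continuous T z.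
Proof.
move=> acx zx; apply/ac_near => e e0.
(* The two added units make [C] positive for an empty [I] and for [c = 0]; the second one also makes
   the final inequality strict. *)
pose C := (`|c| + 1) * (#|I|%:R + 1).
have C0 : 0 < C by rewrite mulr_gt0 // ltr_wpDl.
have eC0 : 0 < e / C by rewrite divr_gt0.
have H i : \forall d \near 0^'+,
    forall (n : nat) (a b : 'I_n -> R),
      (forall i, [/\ 0 <= a i, a i <= b i & b i <= T]) ->
      trivIset [set: 'I_n] (fun i => `]a i, b i[%classic) ->
      \sum_(i < n) (b i - a i) < d ->
      \sum_(j < n) `|x i (b j) - x i (a j)| < e / C.
  by have /ac_near := acx i; exact.
near=> d => n a b ab tI sd.
have Hi i : \sum_(j < n) `|x i (b j) - x i (a j)| < e / C.
  have : forall n (a b : 'I_n -> R),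
      (forall i, [/\ 0 <= a i, a i <= b i & b i <= T]) ->
      trivIset [set: 'I_n] (fun i => `]a i, b i[%classic) ->
      \sum_(i < n) (b i - a i) < d ->
      \sum_(j < n) `|x i (b j) - x i (a j)| < e / C; last exact.
  by move: i; near: d; apply: filter_forall => i; exact: H.
apply: (@le_lt_trans _ _ (\sum_(j < n) (`|c| + 1) * \sum_i `|x i (b j) - x i (a j)|)).
  apply: ler_sum => j _; have [a0 ai bT] := ab j.
  apply: le_trans (zx _ _ a0 ai bT) _; apply: ler_wpM2r; first exact: sumr_ge0.
  by rewrite (le_trans (ler_norm _)) // lerDl.
rewrite -mulr_sumr exchange_big /=.
have c1 : 0 < `|c| + 1 by rewrite ltr_wpDl.
rewrite mulrC -ltr_pdivlMr //.
apply: (@le_lt_trans _ _ (\sum_(i : I) e / C)).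
  by apply: ler_sum => i _; exact/ltW/Hi.
rewrite sumr_const -mulr_natl ltr_pdivlMr // /C.
have I1 : 0 < #|I|%:R + 1 :> R by rewrite ltr_wpDl.
have -> : #|I|%:R * (e / ((`|c| + 1) * (#|I|%:R + 1))) * (`|c| + 1) =
    (#|I|%:R / (#|I|%:R + 1)) * e.
  by field; rewrite !gt_eqF.
rewrite -[X in _ < X]mul1r.
by rewrite ltr_pM2r // ltr_pdivrMr // mul1r ltrDl.
Unshelve. all: by end_near. Qed.

Lemma ac_uniformly_continuous (V : normedModType R) T (x : R -> V) :
  abs_continuous T x -> forall e : R, 0 < e -> exists2 d : R, 0 < d &
    forall s t, 0 <= s <= T -> 0 <= t <= T -> `|t - s| < d -> `|x t - x s| < e.
Proof.
move=> ac e e0; have [d d0 Hd] := ac e e0; exists d => //.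
have K s t : 0 <= s -> s <= t -> t <= T -> t - s < d -> `|x t - x s| < e.
  move=> s0 st tT ts.
  have := Hd 1%N (fun=> s) (fun=> t); rewrite !big_ord1; apply => //.
  by move=> i j _ _ _; rewrite !ord1.
move=> s t /andP[s0 sT] /andP[t0 tT].
have [st|/ltW ts] := leP s t; first by rewrite ger0_norm ?subr_ge0 //; exact: K.
by rewrite distrC (distrC (x t)) ger0_norm ?subr_ge0 //; exact: K.
Qed.

Lemma ac_bounded (V : normedModType R) T (x : R -> V) : 0 <= T -> abs_continuous T x ->
  exists2 M : R, 0 <= M & forall t, 0 <= t <= T -> `|x t| <= M.
Proof.
move=> T0 ac; have [d d0 Hd] := ac_uniformly_continuous ac ltr01.
have [M HM] : exists M : R, forall t, 0 <= t <= T -> `|x t| <= M.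
  apply: (@real_induction _ T (fun u => exists M : R, forall t, 0 <= t <= u -> `|x t| <= M)) => //.
    by exists `|x 0| => t; rewrite andbC => /le_anti <-.
  move=> s /andP[s0 sT]; exists d => // t r t0 sdt ts sr rT rsd [M HM].
  exists (Num.max M (`|x s| + 1)) => u /andP[u0 ur].
  rewrite le_max; have [ut|tu] := leP u t; first by rewrite HM ?u0.
  apply/orP; right; rewrite -lerBlDl (le_trans (lerB_dist _ _)) // ltW //.
  apply: Hd; rewrite ?s0 ?u0 ?(le_trans ur) //.
  rewrite ltr_norml; apply/andP; split; lra.
by exists M => //; rewrite (le_trans (normr_ge0 (x 0))) // HM // lexx.
Qed.

End absolute_continuity_of_primitives.

(** * Calculus of Caratheodory solutions *)

Section scalar_solutions.
Context {R : realType}.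
Implicit Types (x y v w h : R -> R) (s t T c : R).

(** Time 0 is discarded as a null set, because a derivative there sees negative times, at which the
    two functions may differ. *)
Lemma solves_ext (V : normedModType R) (x x' v v' : R -> V) :
  (forall t : R, 0 <= t -> x t = x' t) ->
  {ae leb R, forall t : R, 0 <= t -> v t = v' t} ->
  solves x v -> solves x' v'.
Proof.
move=> xx' vv' [ac dx]; split.
  move=> T T0; apply: (@ac_dom _ unit _ _ T 1 (fun=> x)) => [_|s t s0 st tT].
    exact: ac.
  by rewrite mul1r big_const card_unit /= addr0 !xx' // (le_trans s0 st).
have : {ae leb R, forall t : R, 0 <= t -> v t = v' t /\ t != 0}.
  by move: vv' (@ae_leb_eq0 R); apply: ae_leb_imply2 => t vE t0 tge; split; [exact: vE|].
move: dx; apply: ae_leb_imply2 => t dx vt t0.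
have [<- tn0] := vt t0; apply: near_eq_is_derive (dx t0).
have tp : 0 < t by rewrite lt_neqAle eq_sym tn0.
near=> s; apply: xx'; apply: ltW; near: s; exact: lt_nbhsr.
Unshelve. all: by end_near. Qed.

Lemma prim_solves h : loc_integrable h -> solves (prim h) h.
Proof. by move=> hi; split; [move=> T T0; exact: prim_ac|exact: prim_derive]. Qed.

Lemma solvesD (V : normedModType R) (x y v w : R -> V) : solves x v -> solves y w ->
  solves (fun t => x t + y t) (fun t => v t + w t).
Proof.
move=> [acx dx] [acy dy]; split.
  move=> T T0; apply: (@ac_dom _ bool _ _ T 1 (fun b => if b then x else y)).
    by case; [exact: acx|exact: acy].
  move=> s t s0 st tT; rewrite mul1r big_bool /= opprD addrACA; exact: ler_normD.
move: dx dy; apply: ae_leb_imply2 => t dx dy t0.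
have D := is_deriveD (dx t0) (dy t0); exact: D.
Qed.

Lemma solvesZ (V : normedModType R) c (x v : R -> V) : solves x v ->
  solves (fun t => c *: x t) (fun t => c *: v t).
Proof.
move=> [acx dx]; split.
  move=> T T0; apply: (@ac_dom _ unit _ _ T `|c| (fun=> x)) => [_|s t s0 st tT].
    exact: acx.
  by rewrite big_const card_unit /= addr0 -scalerBr normrZ.
move: dx; apply: ae_leb_imply => t dx t0.
have D := is_deriveZ c (dx t0); exact: D.
Qed.

Lemma solves_cst (V : normedModType R) (a : V) : solves (fun=> a) (fun=> 0).
Proof.
split; last by apply: aeW => t _; exact: is_derive_cst.
move=> T T0; apply: (@ac_dom _ unit _ _ T 0 (fun=> (fun=> 0 : R))) => [_|s t s0 st tT].
  move=> e e0; exists 1 => // n a' b _ _ _.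
  by rewrite big1 // => i _; rewrite subrr normr0.
by rewrite mul0r subrr normr0.
Qed.

Lemma solvesN (V : normedModType R) (x v : R -> V) : solves x v ->
  solves (fun t => - x t) (fun t => - v t).
Proof.
move=> /(solvesZ (-1)); apply: solves_ext => [t _|]; first by rewrite scaleN1r.
by apply: aeW => t _; rewrite scaleN1r.
Qed.

Lemma solvesB (V : normedModType R) (x y v w : R -> V) : solves x v -> solves y w ->
  solves (fun t => x t - y t) (fun t => v t - w t).
Proof. by move=> sx sy; apply: solvesD => //; exact: solvesN. Qed.

Lemma solves_sum (V : normedModType R) I (r : seq I) (P : pred I) (x v : I -> R -> V) :
  (forall i, P i -> solves (x i) (v i)) ->
  solves (fun t => \sum_(i <- r | P i) x i t) (fun t => \sum_(i <- r | P i) v i t).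
Proof.
move=> xv; elim: r => [|i r IH].
  apply: solves_ext (solves_cst 0) => [t _|]; first by rewrite big_nil.
  by apply: aeW => t _; rewrite big_nil.
have [Pi|Pi] := boolP (P i).
  apply: solves_ext (solvesD (xv i Pi) IH) => [t _|]; first by rewrite big_cons Pi.
  by apply: aeW => t _; rewrite big_cons Pi.
apply: solves_ext IH => [t _|]; first by rewrite big_cons (negbTE Pi).
by apply: aeW => t _; rewrite big_cons (negbTE Pi).
Qed.

Lemma solvesM x y v w : solves x v -> solves y w ->
  solves (fun t => x t * y t) (fun t => v t * y t + x t * w t).
Proof.
move=> [acx dx] [acy dy]; split.
  move=> T T0.
  have [M M0 HM] := ac_bounded T0 (acx T T0).
  have [N N0 HN] := ac_bounded T0 (acy T T0).
  apply: (@ac_dom _ bool _ _ T (M + N) (fun b => if b then x else y)).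
    by case; [exact: acx|exact: acy].
  move=> s t s0 st tT; rewrite big_bool /=.
  have -> : x t * y t - x s * y s = (x t - x s) * y t + x s * (y t - y s) by ring.
  apply: (le_trans (ler_normD _ _)); rewrite !normrM.
  have h1 : `|y t| <= N by rewrite HN // (le_trans s0 st).
  have h2 : `|x s| <= M by rewrite HM // s0 (le_trans st tT).
  have := normr_ge0 (x t - x s); have := normr_ge0 (y t - y s).
  move: h1 h2; set a := `|x t - x s|; set b := `|y t - y s|; nra.
move: dx dy; apply: ae_leb_imply2 => t dx dy t0.
have D := is_deriveM (dx t0) (dy t0).
have -> : v t * y t + x t * w t = x t *: w t + y t *: v t.
  by rewrite addrC [v t * _]mulrC.
exact: D.
Qed.

Lemma solves_expR x v : solves x v ->
  solves (fun t => expR (x t)) (fun t => expR (x t) * v t).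
Proof.
move=> [acx dx]; split.
  move=> T T0; have [M M0 HM] := ac_bounded T0 (acx T T0).
  apply: (@ac_dom _ unit _ _ T (expR M) (fun=> x)) => [_|s t s0 st tT].
    exact: acx.
  rewrite big_const card_unit /= addr0.
  have K a b : `|a| <= M -> `|b| <= M -> a <= b -> `|expR b - expR a| <= expR M * `|b - a|.
    move=> aM bM ab; have [|c] := @MVT_segment R expR expR a b ab (fun z _ => is_derive_expR z).
      by apply: continuous_subspaceT => z; exact: continuous_expR.
    rewrite in_itv/= => /andP[_ cb] ->.
    rewrite normrM ger0_norm ?expR_ge0 // ler_wpM2r // ler_expR.
    by rewrite (le_trans cb) // (le_trans (ler_norm _)).
  have h1 : `|x t| <= M by rewrite HM // tT (le_trans s0 st).
  have h2 : `|x s| <= M by rewrite HM // s0 (le_trans st tT).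
  have [ab|/ltW ab] := leP (x s) (x t); first exact: K.
  by rewrite distrC (distrC (x t)); exact: K.
move: dx; apply: ae_leb_imply => t dx t0.
have D := is_derive1_comp (is_derive_expR (x t)) (dx t0); exact: D.
Qed.

(** The difference with the primitive of [v] is absolutely continuous with zero derivative almost
    everywhere, hence constant. From here on equations can be used in integral form. *)
Lemma solves_prim x v : solves x v -> loc_integrable v ->
  forall t, 0 <= t -> x t = x 0 + prim v t.
Proof.
move=> sx vi t t0.
have [ac dy] := solvesB sx (prim_solves vi).
have dy0 : {ae leb R, forall t : R, 0 <= t -> is_derive t (1 : R) (fun t => x t - prim v t) 0}.
  by move: dy; apply: ae_leb_imply => s; rewrite subrr.
have := ac_zero_derivative t0 (ac t t0) dy0.
rewrite prim0 // subr0 => <-; by rewrite subrK.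
Qed.

Lemma solves_of_prim x v : loc_integrable v ->
  (forall t, 0 <= t -> x t = x 0 + prim v t) -> solves x v.
Proof.
move=> vi H; apply: solves_ext (solvesD (solves_cst (x 0)) (prim_solves vi)).
  by move=> t t0; rewrite [RHS]H.
by apply: aeW => t _; rewrite add0r.
Qed.

(** Frozen at its initial value for negative times, the function is continuous on the whole line.
    Borel measurability, and not only Lebesgue measurability, matters later, when trajectories enter
    Borel sets of pairs (time, control). *)
Lemma ac_borel x : (forall T, 0 <= T -> abs_continuous T x) -> 
  measurable_fun (`[0, +oo[%classic : set R) x.
Proof.
move=> acx.
have mx : measurable_fun setT (fun t : R => x (Num.max 0 t)).
  apply: continuous_measurable_fun => t; apply/cvgrPdist_lt => e e0.
  have T0 : 0 <= `|t| + 1 by rewrite addr_ge0.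
  have [d d0 Hd] := ac_uniformly_continuous (acx _ T0) e0.
  apply/nbhs_ballP; exists (Num.min d 1); first by rewrite /= lt_min d0 ltr01.
  move=> s; rewrite /ball/= lt_min => /andP[ts1 ts2].
  have tn := ler_norm t; have tn' := lerNnormlW (lexx `|t|).
  have /andP[a1 a2] : - d < t - s < d by rewrite -ltr_norml.
  have /andP[b1 b2] : - 1 < t - s < 1 by rewrite -ltr_norml.
  have mx0 (u : R) : (Num.max 0 u = u /\ 0 <= u) \/ (Num.max 0 u = 0 /\ u <= 0).
    by case: (leP 0 u) => u0; [left|right; split => //; exact: ltW].
  apply: Hd.
  - by case: (mx0 s) => -[-> ?]; apply/andP; split; lra.
  - by case: (mx0 t) => -[-> ?]; apply/andP; split; lra.
  - rewrite ltr_norml; case: (mx0 s) => -[-> ?]; case: (mx0 t) => -[-> ?];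
    apply/andP; split; lra.
have := measurable_funS (D := (`[0, +oo[%classic : set R)) measurableT (@subsetT _ _) mx.
apply: eq_measurable_fun => t; rewrite inE /= in_itv/= andbT => t0.
by rewrite max_r.
Qed.

Lemma ac_lmeas x : (forall T, 0 <= T -> abs_continuous T x) -> lmeas x.
Proof. by move=> /ac_borel; apply: measurable_fun_leb; exact: measurable_itv. Qed.

Lemma lmeasM h1 h2 : lmeas h1 -> lmeas h2 -> lmeas (fun t => h1 t * h2 t).
Proof. by move=> m1 m2; apply: measurable_funM. Qed.

Lemma lmeasD h1 h2 : lmeas h1 -> lmeas h2 -> lmeas (fun t => h1 t + h2 t).
Proof. by move=> m1 m2; apply: measurable_funD. Qed.

Lemma lmeasN h : lmeas h -> lmeas (fun t => - h t).
Proof. by move=> m1; apply: (measurableT_comp (@oppr_measurable R setT)). Qed.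

Lemma lmeas_norm h : lmeas h -> lmeas (fun t => `|h t|).
Proof. by move=> m1; apply: (measurableT_comp (@normr_measurable R setT)). Qed.

Lemma lmeas_cst c : lmeas (fun=> c).
Proof. exact: measurable_cst. Qed.

Lemma eq_lmeas h1 h2 : (forall t, 0 <= t -> h1 t = h2 t) -> lmeas h1 -> lmeas h2.
Proof.
move=> E; apply: eq_measurable_fun => t; rewrite inE /= in_itv/= andbT; exact: E.
Qed.

Lemma loc_integrableM x h : (forall T, 0 <= T -> abs_continuous T x) ->
  loc_integrable h -> loc_integrable (fun t => x t * h t).
Proof.
move=> acx hi; apply: loc_integrable_dom.
  by apply: lmeasM; [exact: ac_lmeas|exact: loc_integrable_lmeas].
move=> T T0; have [M M0 HM] := ac_bounded T0 (acx T T0).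
exists (fun t => M * `|h t|); first by apply: loc_integrableZ; exact: loc_integrable_norm.
by move=> t tT; rewrite normrM ler_wpM2r // HM.
Qed.

End scalar_solutions.

(** * Matrix norms and matrix-valued solutions *)

Section matrix_norms.
Context {R : realType}.

Lemma mx_entry_le p q (A : 'M[R]_(p, q)) i j : `|A i j| <= `|A|.
Proof.
rewrite [leRHS]/Num.norm /= mx_normrE.
by apply/bigmax_geP; right => /=; exists (i, j).
Qed.

Lemma mx_norm_le p q (A : 'M[R]_(p, q)) c : 0 <= c ->
  (forall i j, `|A i j| <= c) -> `|A| <= c.
Proof.
move=> c0 H; rewrite [leLHS]/Num.norm /= mx_normrE; by apply/bigmax_leP; split => // -[i j] _; exact: H.
Qed.

(** The norm is the largest absolute value of an entry, which is not submultiplicative: an entry of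
    the product is a sum of [q] terms. *)
Lemma mx_norm_mul p q r (A : 'M[R]_(p, q)) (B : 'M[R]_(q, r)) :
  `|A *m B| <= q%:R * `|A| * `|B|.
Proof.
apply: mx_norm_le; first by rewrite !mulr_ge0.
move=> i j; rewrite mxE; apply: (le_trans (ler_norm_sum _ _ _)).
apply: (@le_trans _ _ (\sum_(l < q) `|A| * `|B|)).
  by apply: ler_sum => l _; rewrite normrM ler_pM // mx_entry_le.
by rewrite sumr_const card_ord -[X in X <= _]mulr_natl mulrA.
Qed.

Lemma enorm_ge0 p q (A : 'M[R]_(p, q)) : 0 <= enorm A.
Proof. exact: sqrtr_ge0. Qed.

Lemma norm_le_enorm p q (A : 'M[R]_(p, q)) : `|A| <= enorm A.
Proof.
apply: mx_norm_le; first exact: enorm_ge0.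
move=> i j; rewrite -sqrtr_sqr ler_wsqrtr //.
rewrite (bigD1 i) //= (bigD1 j) //= -addrA lerDl addr_ge0 //.
  by apply: sumr_ge0 => l _; exact: sqr_ge0.
by apply: sumr_ge0 => l _; apply: sumr_ge0 => l' _; exact: sqr_ge0.
Qed.

(** A crude factor is enough: the root of a sum of squares is at most the sum of the absolute
    values, here over [p * q] entries. *)
Lemma enorm_le_norm p q (A : 'M[R]_(p, q)) : enorm A <= (p * q)%:R * `|A|.
Proof.
have sq I (r : seq I) (F : I -> R) : \sum_(i <- r) F i ^+ 2 <= (\sum_(i <- r) `|F i|) ^+ 2.
  elim: r => [|i r IH]; first by rewrite !big_nil expr0n.
  rewrite !big_cons sqrrD real_normK ?num_real // -addrA lerD2l.
  rewrite (le_trans IH) // lerDr mulrn_wge0 // mulr_ge0 //.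
  exact: sumr_ge0.
rewrite /enorm pair_big /= -[leRHS]ger0_norm ?mulr_ge0 // -sqrtr_sqr ler_wsqrtr //.
apply: le_trans (sq _ _ _) _; rewrite lerXn2r ?nnegrE ?sumr_ge0 ?mulr_ge0 //.
apply: (@le_trans _ _ (\sum_(ij : 'I_p * 'I_q) `|A|)).
  by apply: ler_sum => -[i j] _; exact: mx_entry_le.
by rewrite sumr_const card_prod !card_ord -[X in X <= _]mulr_natl.
Qed.

End matrix_norms.

Section matrix_solutions.
Context {R : realType} {p q : nat}.
Implicit Types (X Y V W h : R -> 'M[R]_(p, q)) (s t T : R) (b : R -> R).

Definition mlmeas h := forall i j, lmeas (fun t => h t i j).
Definition mloc h := forall i j, loc_integrable (fun t => h t i j).
Definition mprim h t : 'M[R]_(p, q) := \matrix_(i, j) prim (fun s => h s i j) t.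

Lemma ac_mxP T X : abs_continuous T X <->
  forall i j, abs_continuous T (fun t => X t i j).
Proof.
split=> [ac i j|ac].
  apply: (@ac_dom _ unit _ _ T 1 (fun=> X)) => // s t s0 st tT.
  rewrite mul1r big_const card_unit /= addr0.
  by have := mx_entry_le (X t - X s) i j; rewrite !mxE.
apply: (@ac_dom _ ('I_p * 'I_q)%type _ _ T 1 (fun ij t => X t ij.1 ij.2)) => //= s t s0 st tT.
rewrite mul1r; apply: mx_norm_le; first exact: sumr_ge0.
by move=> i j; rewrite !mxE (bigD1 (i, j)) //= lerDl sumr_ge0.
Qed.

Lemma is_derive_mxP t X (v : 'M[R]_(p, q)) : is_derive t (1 : R) X v <->
  forall i j, is_derive t (1 : R) (fun t => X t i j) (v i j).
Proof.
split=> [dX i j|dX].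
  apply: (@bound_is_derive R R (fun t => X t i j)) => e e0; have [d d0 H] := is_derive_bound dX e0.
  exists d => // r rt; apply: le_trans (H r rt).
  by have := mx_entry_le (X r - X t - (r - t) *: v) i j; rewrite !mxE.
apply: bound_is_derive => e e0.
have : \forall r \near t, forall ij : 'I_p * 'I_q,
    `|X r ij.1 ij.2 - X t ij.1 ij.2 - (r - t) * v ij.1 ij.2| <= e * `|r - t|.
  apply: (@filter_forall _ _ (fun ij r =>
    `|X r ij.1 ij.2 - X t ij.1 ij.2 - (r - t) * v ij.1 ij.2| <= e * `|r - t|) _ (nbhs_filter t)) => -[i j] /=.
  have [d d0 H] := is_derive_bound (dX i j) e0.
  by apply/nbhs_ballP; exists d => // r; rewrite /ball/= distrC; exact: H.
move=> /nbhs_ballP[d /= d0 H]; exists d => // r rt.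
apply: mx_norm_le; first by rewrite mulr_ge0 // ltW.
move=> i j; rewrite !mxE; apply: (H r _ (i, j)).
by rewrite /ball/= distrC.
Qed.

(** Reduces matrix equations to the scalar calculus; the exceptional null sets of the finitely many
    entries are merged into one. *)
Lemma solves_mxP X V : solves X V <->
  forall i j, solves (fun t => X t i j) (fun t => V t i j).
Proof.
split=> [[ac dX] i j|H].
  split; first by move=> T T0; have /ac_mxP := ac T T0; exact.
  by move: dX; apply: ae_leb_imply => t dX t0; have /is_derive_mxP := dX t0; exact.
split; first by move=> T T0; apply/ac_mxP => i j; have [ac _] := H i j; exact: ac.
have : {ae leb R, forall t, forall ij : 'I_p * 'I_q,
    0 <= t -> is_derive t (1 : R) (fun t => X t ij.1 ij.2) (V t ij.1 ij.2)}.
  apply: (@filter_forall _ _ (fun ij t => 0 <= t ->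
    is_derive t (1 : R) (fun t => X t ij.1 ij.2) (V t ij.1 ij.2)) _
    (ae_filter_ringOfSetsType (leb R))) => ij.
  by have [_] := H ij.1 ij.2.
apply: ae_leb_imply => t dX t0; apply/is_derive_mxP => i j.
exact: (dX (i, j)).
Qed.

Lemma mx_solves_prim X V : solves X V -> mloc V ->
  forall t, 0 <= t -> X t = X 0 + mprim V t.
Proof.
move=> /solves_mxP H Vl t t0; apply/matrixP => i j; rewrite !mxE.
exact: (solves_prim (H i j) (Vl i j) t0).
Qed.

Lemma mx_solves_of_prim X V : mloc V ->
  (forall t, 0 <= t -> X t = X 0 + mprim V t) -> solves X V.
Proof.
move=> Vl H; apply/solves_mxP => i j; apply: solves_of_prim => // t t0.
by rewrite [in LHS]H // !mxE.
Qed.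

Lemma mprim_solves V : mloc V -> solves (mprim V) V.
Proof.
move=> Vl; apply: mx_solves_of_prim => // t t0; apply/matrixP => i j.
by rewrite !mxE prim0 // add0r.
Qed.

Lemma mloc_dom h : mlmeas h ->
  (forall T, 0 <= T -> exists2 b, loc_integrable b &
     forall t, 0 <= t <= T -> `|h t| <= b t) -> mloc h.
Proof.
move=> mh H i j; apply: loc_integrable_dom => // T T0.
have [b bi hb] := H T T0; exists b => // t tT.
by rewrite (le_trans _ (hb t tT)) // mx_entry_le.
Qed.

Lemma mprimB h1 h2 t : mloc h1 -> mloc h2 -> 0 <= t ->
  mprim (fun s => h1 s - h2 s) t = mprim h1 t - mprim h2 t.
Proof.
move=> l1 l2 t0; apply/matrixP => i j; rewrite !mxE -primB_fun //.
by congr (prim _ t); apply/funext => s; rewrite !mxE.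
Qed.

Lemma mlocB h1 h2 : mloc h1 -> mloc h2 -> mloc (fun s => h1 s - h2 s).
Proof.
move=> l1 l2 i j; rewrite (_ : (fun _ => _) = fun t => h1 t i j - h2 t i j).
  exact: loc_integrableB.
by apply/funext => t; rewrite !mxE.
Qed.

Lemma mlocD h1 h2 : mloc h1 -> mloc h2 -> mloc (fun s => h1 s + h2 s).
Proof.
move=> l1 l2 i j; rewrite (_ : (fun _ => _) = fun t => h1 t i j + h2 t i j).
  exact: loc_integrableD.
by apply/funext => t; rewrite !mxE.
Qed.

Lemma mlocN h : mloc h -> mloc (fun s => - h s).
Proof.
move=> l i j; rewrite (_ : (fun _ => _) = fun t => - h t i j).
  exact: loc_integrableN.
by apply/funext => t; rewrite !mxE.
Qed.

Lemma eq_mprim h1 h2 t : (forall r, 0 <= r <= t -> h1 r = h2 r) ->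
  mprim h1 t = mprim h2 t.
Proof.
by move=> E; apply/matrixP => i j; rewrite !mxE; apply: eq_prim => r /E ->.
Qed.

Lemma mprim0 h : mloc h -> mprim h 0 = 0.
Proof. by move=> hl; apply/matrixP => i j; rewrite !mxE prim0. Qed.

Lemma mloc_lmeas h : mloc h -> mlmeas h.
Proof. by move=> hl i j; exact: loc_integrable_lmeas. Qed.

Lemma ac_mlmeas X : (forall T, 0 <= T -> abs_continuous T X) -> mlmeas X.
Proof.
by move=> ac i j; apply: ac_lmeas => T T0; have /ac_mxP := ac T T0; exact.
Qed.

Lemma ac_norm (E : normedModType R) T (x : R -> E) :
  abs_continuous T x -> abs_continuous T (fun t => `|x t|).
Proof.
move=> ac; apply: (@ac_dom _ unit _ _ T 1 (fun=> x)) => // s t s0 st tT.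
by rewrite mul1r big_const card_unit /= addr0 ler_dist_dist.
Qed.

Lemma mlmeas_norm h : mlmeas h -> lmeas (fun t => `|h t|).
Proof.
move=> mh.
have K (s : seq ('I_p * 'I_q)) : lmeas (fun t => \big[Num.max/0]_(ij <- s) `|h t ij.1 ij.2|).
  elim: s => [|ij s IH].
    apply: eq_lmeas (@lmeas_cst R 0) => t _; by rewrite big_nil.
  apply: (@eq_lmeas _ (fun t => Num.max `|h t ij.1 ij.2| (\big[Num.max/0]_(ij <- s) `|h t ij.1 ij.2|))).
    by move=> t _; rewrite big_cons.
  by apply: measurable_maxr; [apply: lmeas_norm; exact: mh|exact: IH].
by apply: eq_lmeas (K (index_enum _)) => t _; rewrite [RHS]/Num.norm /= mx_normrE.
Qed.

End matrix_solutions.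

Lemma solves_mulmx {R : realType} (p q r : nat) (X V : R -> 'M[R]_(p, q))
    (Y W : R -> 'M[R]_(q, r)) : solves X V -> solves Y W ->
  solves (fun t => X t *m Y t) (fun t => V t *m Y t + X t *m W t).
Proof.
move=> /solves_mxP sX /solves_mxP sY; apply/solves_mxP => i j.
have := @solves_sum _ _ _ (index_enum 'I_q) xpredT
  (fun l t => X t i l * Y t l j) (fun l t => V t i l * Y t l j + X t i l * W t l j)
  (fun l _ => solvesM (sX i l) (sY l j)).
apply: solves_ext => [t _|]; first by rewrite mxE.
by apply: aeW => t _; rewrite !mxE -big_split.
Qed.

Section matrix_products.
Context {R : realType} {p q r : nat}.

Lemma mlmeas_mul (h1 : R -> 'M[R]_(p, q)) (h2 : R -> 'M[R]_(q, r)) :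
  mlmeas h1 -> mlmeas h2 -> mlmeas (fun t => h1 t *m h2 t).
Proof.
move=> m1 m2 i j.
have K (s : seq 'I_q) : lmeas (fun t => \sum_(l <- s) h1 t i l * h2 t l j).
  elim: s => [|l s IH].
    by apply: eq_lmeas (@lmeas_cst R 0) => t _; rewrite big_nil.
  apply: (@eq_lmeas _ (fun t => h1 t i l * h2 t l j + \sum_(l <- s) h1 t i l * h2 t l j)).
    by move=> t _; rewrite big_cons.
  by apply: lmeasD => //; apply: lmeasM; [exact: m1|exact: m2].
by apply: eq_lmeas (K (index_enum _)) => t _; rewrite mxE.
Qed.

Lemma mloc_mulr (h1 : R -> 'M[R]_(p, q)) (X : R -> 'M[R]_(q, r)) :
  mloc h1 -> (forall T, 0 <= T -> abs_continuous T X) ->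
  mloc (fun t => h1 t *m X t).
Proof.
move=> l1 ac i j.
apply: (@eq_loc_integrable _ (fun t => \sum_l X t l j * h1 t i l)).
  by move=> t _; rewrite mxE; apply: eq_bigr => l _; rewrite mulrC.
apply: loc_integrable_sum => l _; apply: loc_integrableM => // T T0.
by have /ac_mxP := ac T T0; exact.
Qed.

Lemma mloc_mull (X : R -> 'M[R]_(p, q)) (h2 : R -> 'M[R]_(q, r)) :
  (forall T, 0 <= T -> abs_continuous T X) -> mloc h2 ->
  mloc (fun t => X t *m h2 t).
Proof.
move=> ac l2 i j.
apply: (@eq_loc_integrable _ (fun t => \sum_l X t i l * h2 t l j)).
  by move=> t _; rewrite mxE.
apply: loc_integrable_sum => l _; apply: loc_integrableM => // T T0.
by have /ac_mxP := ac T T0; exact.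
Qed.

End matrix_products.

(** * Linear estimates and existence of Caratheodory solutions *)

Section weights.
Context {R : realType}.
Implicit Types (L w u : R -> R) (s t T : R).

Lemma prim_stationary h s t : loc_integrable h -> 0 <= s <= t ->
  (forall r, s < r -> h r = 0) -> prim h t = prim h s.
Proof.
move=> hi st h0; apply/eqP; rewrite -subr_eq0; apply/eqP; rewrite primB //.
rewrite (@eq_Rintegral _ _ _ _ _ (fun=> 0)).
  by rewrite Rintegral_cst ?mul0r //; exact (measurable_leb_itv _).
by move=> r; rewrite inE /= in_itv/= => /andP[sr _]; exact: h0.
Qed.

Lemma prim_dom2 h b s t : loc_integrable h -> loc_integrable b -> 0 <= s -> 0 <= t ->
  (forall r, Num.min s t <= r <= Num.max s t -> `|h r| <= b r) ->
  `|prim h t - prim h s| <= `|prim b t - prim b s|.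
Proof.
move=> hi bi s0 t0 hb; have [st|/ltW ts] := leP s t.
  apply: le_trans (ler_norm _); apply: prim_dom; rewrite ?s0 //.
  by move=> r rst; apply: hb; rewrite min_l // max_r.
rewrite distrC (distrC (prim b t)); apply: le_trans (ler_norm _).
apply: prim_dom; rewrite ?t0 //.
by move=> r rst; apply: hb; rewrite min_r // max_l.
Qed.

Lemma mprim_dom2 p q (h : R -> 'M[R]_(p, q)) b s t : mloc h -> loc_integrable b -> 0 <= s -> 0 <= t ->
  (forall r, Num.min s t <= r <= Num.max s t -> `|h r| <= b r) ->
  `|mprim h t - mprim h s| <= `|prim b t - prim b s|.
Proof.
move=> hi bi s0 t0 hb; apply: mx_norm_le => // i j; rewrite !mxE.
by apply: prim_dom2 => // r rst; rewrite (le_trans (mx_entry_le _ _ _)) ?hb.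
Qed.

(* Either time runs forward from 0 only, or also backward from [s], past which
   nothing moves. *)
Definition base L s := s = 0 \/ 0 <= s /\ forall r, s < r -> L r = 0.

(* [w] dominates the growth of solutions away from the base time [s], in either
   direction of time. *)
Definition weight L s w := [/\ forall T, 0 <= T -> abs_continuous T w,
  forall t, 0 <= t -> 1 <= w t &
  forall t, 0 <= t -> `|prim (fun r => w r * L r) t - prim (fun r => w r * L r) s| <= w t / 2].

(** The exponential of twice the integral of [L] away from [s] works: its derivative is $2 L w$ up
    to sign, so the integral of $w L$ between [s] and [t] has absolute value $(w(t) - 1)/2$. *)
Lemma weight_exists L s : loc_integrable L -> (forall t, 0 <= t -> 0 <= L t) -> base L s ->
  exists w, weight L s w.
Proof.
move=> Li L0 bs.
have s0 : 0 <= s by case: bs => [->|[]].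
(* The sign orients time, forward when [s] is 0 and backward when [L] vanishes past [s], so that the
   exponent is never negative. *)
have [sg [sgE sgL]] : exists sg : R, `|sg| = 1 /\
    forall t, 0 <= t -> 0 <= sg * (prim L t - prim L s).
  case: bs => [->|[_ Ls]].
    exists 1; rewrite normr1; split => // t t0; rewrite mul1r subr_ge0.
    by apply: prim_mono; rewrite ?lexx // => r /andP[r0 _]; exact: L0.
  exists (-1); rewrite normrN1; split => // t t0; rewrite mulN1r opprB subr_ge0.
  have [ts|/ltW st] := leP t s.
    by apply: prim_mono; rewrite ?t0 // => r /andP[tr _]; rewrite L0 // (le_trans t0).
  by rewrite (@prim_stationary _ s t) // s0.
pose w t := expR (2 * sg * (prim L t - prim L s)).
have sw : solves w (fun t => w t * (2 * sg * L t)).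
  apply: solves_expR; apply: solves_ext (solvesZ (2 * sg) (solvesB (prim_solves Li) (solves_cst (prim L s)))).
    by [].
  by apply: aeW => t _; rewrite subr0.
have acw : forall T, 0 <= T -> abs_continuous T w by case: sw.
have wLi : loc_integrable (fun r => w r * L r) by exact: loc_integrableM.
exists w; split => //.
  by move=> t t0; rewrite -expR0 ler_expR -mulrA mulr_ge0 // sgL.
move=> t t0.
have E r : 0 <= r -> w r = w 0 + 2 * sg * prim (fun r => w r * L r) r.
  move=> r0; rewrite -primZ // (solves_prim sw _ r0); last first.
    apply: eq_loc_integrable (loc_integrableZ (2 * sg) wLi) => u _; ring.
  by congr (_ + _); apply: eq_prim => u _; ring.
have ws : w s = 1 by rewrite /w subrr mulr0 expR0.
have Et := E t t0; have Es := E s s0.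
set P := prim _ t - _.
have -> : `|P| = `|w t - 1| / 2.
  have -> : w t - 1 = 2 * sg * P by rewrite /P -{1}ws Et Es; ring.
  by rewrite !normrM sgE mulr1 ger0_norm // mulrAC divff ?mul1r.
rewrite ler_pM2r ?invr_gt0 // ger0_norm.
  by rewrite lerBlDr lerDl.
by rewrite subr_ge0 -expR0 ler_expR -mulrA mulr_ge0 // sgL.
Qed.

Lemma lmeas_trunc h T : lmeas h -> lmeas (fun t => if t <= T then h t else 0).
Proof.
move=> mh; apply: (@eq_lmeas _ (h \_ `[0, T])).
  move=> t t0; rewrite patchE.
  have -> // : (t \in `[0, T]%classic) = (t <= T).
  by apply/idP/idP; rewrite inE /= in_itv/= t0.
have [+ _] := @measurable_restrict _ _ (lebT R) R `[0, T]%classic `[0, +oo[%classic h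
  (measurable_leb_itv _) (measurable_leb_itv _).
apply; apply: (@measurable_funS _ _ (lebT R) R `[0, +oo[%classic) => //.
exact (measurable_leb_itv _).
Qed.

Lemma loc_integrable_trunc h T : loc_integrable h ->
  loc_integrable (fun t => if t <= T then h t else 0).
Proof.
move=> hi; apply: loc_integrable_dom.
  by apply: lmeas_trunc; exact: loc_integrable_lmeas.
move=> S S0; exists (fun t => `|h t|); first exact: loc_integrable_norm.
by move=> t _; case: ifP => // _; rewrite normr0.
Qed.

Lemma prim_trunc h s t T : s <= T -> t <= T ->
  prim (fun r => if r <= T then h r else 0) t - prim (fun r => if r <= T then h r else 0) s =
  prim h t - prim h s.
Proof.
by move=> sT tT; congr (_ - _); apply: eq_prim => r /andP[_ rt]; rewrite (le_trans rt).
Qed.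

(** The supremum M of $u/w$ satisfies $M \le a + M/2$, hence $u \le 2 a w$. The constant precedes
    [a] and [u] so that one bound serves all trajectories at once. *)
Lemma gronwall L s T : loc_integrable L -> (forall t, 0 <= t -> 0 <= L t) -> 0 <= T ->
  s = 0 \/ s = T ->
  exists2 C : R, 0 <= C & forall (a : R) u, loc_integrable (fun t => u t * L t) ->
    (exists B : R, forall t, 0 <= t <= T -> 0 <= u t <= B) ->
    (forall t, 0 <= t <= T ->
       u t <= a + `|prim (fun r => u r * L r) t - prim (fun r => u r * L r) s|) ->
    forall t, 0 <= t <= T -> u t <= C * a.
Proof.
move=> Li L0 T0 sT.
have s0T : 0 <= s <= T by case: sT => ->; rewrite lexx T0.
have [s0 sleT] := andP s0T.
(* Cutting [L] off after [T] makes [T] a possible base time. *)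
pose L1 t := if t <= T then L t else 0.
have L1i : loc_integrable L1 by exact: loc_integrable_trunc.
have [|||w [acw w1 wL]] := @weight_exists L1 s => //.
- by move=> t t0; rewrite /L1; case: ifP => // _; exact: L0.
- case: sT => ->; [by left|right; split => // r Tr].
  by rewrite /L1 leNgt Tr.
have [W W0 HW] := ac_bounded T0 (acw T T0).
exists (2 * W); first by rewrite mulr_ge0.
move=> a u uLi [B uB] uL.
have u0 : 0 <= u 0 by have := uB 0; rewrite lexx T0 => /(_ isT)/andP[].
pose S := [set u t / w t | t in [set t | 0 <= t <= T]].
have wp t : 0 <= t -> 0 < w t by move=> t0; rewrite (lt_le_trans ltr01) ?w1.
have hS : has_sup S.
  split; first by exists (u 0 / w 0); exists 0 => //=; rewrite lexx T0.
  exists B => _ [t /= t0T <-]; have /andP[u0' uB'] := uB t t0T.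
  have /andP[t0 _] := t0T.
  rewrite ler_pdivrMr ?wp // (le_trans uB') // ler_peMr ?w1 //.
  exact: le_trans uB'.
pose M := sup S.
have uM t : 0 <= t <= T -> u t <= M * w t.
  move=> t0T; have /andP[t0 _] := t0T; rewrite -ler_pdivrMr ?wp //.
  by apply: ub_le_sup; [case: hS|exists t].
have M0 : 0 <= M.
  have := uM 0; rewrite lexx T0 => /(_ isT) /(le_trans u0).
  by rewrite pmulr_lge0 // wp.
have uM2 t : 0 <= t <= T -> u t <= a + M * (w t / 2).
  move=> /[dup] t0T /andP[t0 tT]; apply: le_trans (uL t t0T) _; rewrite lerD2l.
  have wLi : loc_integrable (fun r => w r * L1 r) by exact: loc_integrableM.
  rewrite -(prim_trunc _ sleT tT).
  have E : `|prim (fun r => M * (w r * L1 r)) t - prim (fun r => M * (w r * L1 r)) s|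
     <= M * (w t / 2).
    by rewrite !primZ // -mulrBr normrM ger0_norm // ler_wpM2l // wL.
  apply: le_trans E; apply: prim_dom2 => //.
  - exact: loc_integrable_trunc.
  - exact: loc_integrableZ.
  move=> r; rewrite ge_min le_max => /andP[/orP h1 /orP h2].
  have r0 : 0 <= r by case: h1; apply: le_trans.
  have rT : r <= T by case: h2 => h2; apply: le_trans h2 _.
  have rb : 0 <= r <= T by rewrite r0.
  rewrite rT /L1 rT ger0_norm; last by rewrite mulr_ge0 ?L0 //; have /andP[] := uB r rb.
  by rewrite mulrA ler_wpM2r ?L0 // uM.
have aM : M <= a + M / 2.
  apply: ge_sup => [|_ [t /= t0T <-]]; first by case: hS.
  have /andP[t0 _] := t0T.
  have a0 : 0 <= a.
    have := uL s s0T; rewrite subrr normr0 addr0.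
    by apply: le_trans; have /andP[] := uB s s0T.
  rewrite ler_pdivrMr ?wp // (le_trans (uM2 t t0T)) // mulrDl mulrAC mulrA lerD2r.
  by rewrite ler_peMr // w1.
move=> t t0T; apply: le_trans (uM t t0T) _.
have wW : w t <= W by rewrite (le_trans (ler_norm _)) ?HW.
have /andP[t0 _] := t0T; have := wp t t0.
nra.
Qed.

End weights.

Section picard.
Context {R : realType} {p q : nat}.

(** The intervals of centre [a k] and radius $C/2^k$ are nested, and any common point is a limit
    with the required rate; the supremum of the left end points is one. *)
Lemma geometric_cauchy (a : nat -> R) (C : R) :
  (forall k, `|a k.+1 - a k| <= C / 2 ^+ k.+1) ->
  exists l : R, forall k, `|a k - l| <= C / 2 ^+ k.
Proof.
move=> H.
have D k : C / 2 ^+ k = C / 2 ^+ k.+1 + C / 2 ^+ k.+1.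
  by rewrite exprS; field; rewrite expf_neq0.
have C0 k : 0 <= C / 2 ^+ k.
  by rewrite D; apply: addr_ge0; apply: le_trans (H _); exact: normr_ge0.
pose b k := a k - C / 2 ^+ k; pose d k := a k + C / 2 ^+ k.
have bd k : b k <= d k by rewrite /b /d; have := C0 k; lra.
have bi : {homo b : i j / (i <= j)%N >-> i <= j}.
  apply: homo_leq; [exact: lexx|exact: le_trans|] => k.
  by rewrite /b (D k); have := H k; rewrite ler_norml => /andP[? ?]; lra.
have di : {homo d : i j / (i <= j)%N >-> j <= i}.
  apply: homo_leq; [exact: lexx|by move=> x y z xy /le_trans; apply|] => k.
  by rewrite /d (D k); have := H k; rewrite ler_norml => /andP[? ?]; lra.
have bdj j k : b j <= d k.
  have [jk|/ltnW kj] := leqP j k; first exact: le_trans (bi _ _ jk) (bd k).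
  exact: le_trans (bd j) (di _ _ kj).
exists (sup (range b)) => k.
have hs : has_sup (range b).
  by split; [exists (b 0%N), 0%N|exists (d 0%N) => _ [j _ <-]; exact: bdj].
have l1 : b k <= sup (range b) by apply: ub_le_sup; [case: hs|exists k].
have l2 : sup (range b) <= d k.
  by apply: ge_sup; [case: hs|move=> _ [j _ <-]; exact: bdj].
by move: l1 l2; rewrite /b /d ler_norml => l1 l2; apply/andP; split; lra.
Qed.

Lemma sub_affine (V : zmodType) (c a b d e : V) :
  c + (a - b) - (c + (d - e)) = (a - d) - (b - e).
Proof.
rewrite opprD addrACA subrr add0r !opprB [LHS]addrACA [RHS]addrACA.
by rewrite [- b - d]addrC.
Qed.

Variables (F : R -> 'M[R]_(p, q) -> 'M[R]_(p, q)) (L M : R -> R) (s : R) (c : 'M[R]_(p, q)).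
Hypotheses (Li : loc_integrable L) (L0 : forall t, 0 <= t -> 0 <= L t).
Hypothesis Mi : loc_integrable M.
Hypothesis sb : s = 0 \/ 0 <= s /\ forall r, s < r -> L r = 0 /\ M r = 0.
Hypothesis Fm : forall y, mlmeas y -> mlmeas (fun t => F t (y t)).
Hypothesis FL : forall t y z, 0 <= t -> `|F t y - F t z| <= L t * `|y - z|.
Hypothesis FM : forall t, 0 <= t -> `|F t 0| <= M t.

Let Fgrowth t y : 0 <= t -> `|F t y| <= L t * `|y| + M t.
Proof.
move=> t0; rewrite -[F t y](subrK (F t 0)) (le_trans (ler_normD _ _)) // lerD ?FM //.
by rewrite (le_trans (FL _ _ t0)) // subr0.
Qed.

Let Fmloc y : mlmeas y -> (exists2 u : R -> R, (forall T, 0 <= T -> abs_continuous T u) &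
    forall t, 0 <= t -> `|y t| <= u t) -> mloc (fun t => F t (y t)).
Proof.
move=> my [u acu yu]; apply: mloc_dom; first exact: Fm.
move=> T T0; exists (fun t => u t * L t + M t).
  by apply: loc_integrableD => //; exact: loc_integrableM.
move=> t /andP[t0 _]; apply: le_trans (Fgrowth _ t0) _; rewrite lerD2r mulrC.
by rewrite ler_wpM2r ?L0 ?yu.
Qed.

Let Phi (y : R -> 'M[R]_(p, q)) t :=
  c + (mprim (fun t => F t (y t)) t - mprim (fun t => F t (y t)) s).

Let Phi_ac y : mloc (fun t => F t (y t)) -> forall T, 0 <= T -> abs_continuous T (Phi y).
Proof.
move=> yl.
have sP := solvesD (solves_cst c) (solvesB (mprim_solves yl)
  (solves_cst (mprim (fun t => F t (y t)) s))).
by have [ac _] := sP.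
Qed.

(** In the norm weighted by [w] the integral operator contracts by 1/2, so the iterates converge on
    the whole half-line at once and no local solutions have to be glued. *)
Lemma picard : exists x, [/\ forall T, 0 <= T -> abs_continuous T x,
  mloc (fun t => F t (x t)) &
  forall t, 0 <= t ->
    x t = c + (mprim (fun t => F t (x t)) t - mprim (fun t => F t (x t)) s)].
Proof.
have s0 : 0 <= s by case: sb => [->|[]].
(* The weight must absorb both the Lipschitz bound [L] and the first increment, for which $|F(t,c)|
   \le L |c| + M$. *)
pose L' t := (1 + `|c|) * L t + M t.
have L'i : loc_integrable L' by apply: loc_integrableD => //; exact: loc_integrableZ.
have M0 t : 0 <= t -> 0 <= M t by move=> t0; apply: le_trans (FM t0).
have L'0 t : 0 <= t -> 0 <= L' t.
  by move=> t0; rewrite addr_ge0 ?M0 // mulr_ge0 ?L0 // addr_ge0.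
have [|w [acw w1 wL]] := weight_exists L'i L'0 (s := s).
  case: sb => [->|[_ H]]; [by left|right; split => // r /H[Lr Mr]].
  by rewrite /L' Lr Mr mulr0 addr0.
have w0 t : 0 <= t -> 0 <= w t by move=> t0; apply: le_trans (w1 _ t0).
have wLi : loc_integrable (fun r => w r * L' r) by exact: loc_integrableM.
pose xs := fix xs k := if k is k'.+1 then Phi (xs k') else fun=> c.
have xs_prop k : (forall T, 0 <= T -> abs_continuous T (xs k)) /\ mloc (fun t => F t (xs k t)).
  have K y : (forall T, 0 <= T -> abs_continuous T y) -> mloc (fun t => F t (y t)).
    move=> acy; apply: Fmloc; first exact: ac_mlmeas.
    by exists (fun t => `|y t|) => // T T0; apply: ac_norm; exact: acy.
  elim: k => [|k [ack lk]] /=.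
    have acc T : 0 <= T -> abs_continuous T (fun=> c) by have [ac _] := solves_cst c; exact: ac.
    by split; [|exact: K].
  have acP := Phi_ac lk; split; [exact: acP|exact: K].
have bnd (h : R -> 'M[R]_(p, q)) (e : R) t : mloc h -> 0 <= e -> 0 <= t ->
    (forall r, 0 <= r -> `|h r| <= e * (w r * L' r)) ->
    `|mprim h t - mprim h s| <= e * (w t / 2).
  move=> hl e0 t0 he.
  have E : `|prim (fun r => e * (w r * L' r)) t - prim (fun r => e * (w r * L' r)) s|
     <= e * (w t / 2).
    by rewrite !primZ // -mulrBr normrM ger0_norm // ler_wpM2l // wL.
  apply: le_trans E; apply: mprim_dom2 => //; first exact: loc_integrableZ.
  move=> r; rewrite ge_min => /andP[/orP h1 _]; apply: he.
  by case: h1; apply: le_trans.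
have LL' t : 0 <= t -> L t <= L' t.
  move=> t0; rewrite /L' mulrDl mul1r -addrA lerDl addr_ge0 ?M0 // mulr_ge0 ?L0 //.
have step k t : 0 <= t -> `|xs k.+1 t - xs k t| <= w t / 2 ^+ k.+1.
  elim: k t => [|k IH] t t0.
    rewrite /= /Phi addrC addKr -[w t / _]mul1r expr1.
    have [_ l0] := xs_prop 0%N.
    apply: bnd => // r r0; rewrite mul1r (le_trans (Fgrowth _ r0)) //.
    apply: le_trans (_ : 1 * L' r <= _); last by rewrite ler_wpM2r ?L'0 ?w1.
    rewrite mul1r /L' lerD2r mulrC ler_wpM2r ?L0 // lerDr //.
  have [_ l1] := xs_prop k; have [_ l2] := xs_prop k.+1.
  have -> : xs k.+2 t - xs k.+1 t =
      mprim (fun t => F t (xs k.+1 t) - F t (xs k t)) t -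
      mprim (fun t => F t (xs k.+1 t) - F t (xs k t)) s.
    by rewrite !mprimB //= /Phi sub_affine.
  have -> : w t / 2 ^+ k.+2 = (2 ^+ k.+1)^-1 * (w t / 2).
    by rewrite [2 ^+ k.+2]exprS; field; rewrite expf_neq0.
  apply: bnd => //; [exact: mlocB|].
  move=> r r0; apply: (le_trans (FL _ _ r0)).
  rewrite mulrA mulrC ler_pM ?L0 ?LL' // mulrC; exact: IH.
have lim t : 0 <= t -> exists l : 'M[R]_(p, q), forall k, `|xs k t - l| <= w t / 2 ^+ k.
  move=> t0.
  have /choice[l Hl] : forall ij : 'I_p * 'I_q, exists l : R,
      forall k, `|xs k t ij.1 ij.2 - l| <= w t / 2 ^+ k.
    move=> [i j]; apply: geometric_cauchy => k /=.
    apply: le_trans (step k t t0).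
    by have := mx_entry_le (xs k.+1 t - xs k t) i j; rewrite !mxE.
  exists (\matrix_(i, j) l (i, j)) => k; apply: mx_norm_le.
    by rewrite divr_ge0 ?w0 // exprn_ge0.
  by move=> i j; rewrite !mxE; exact: (Hl (i, j)).
have /choice[x Hx] : forall t, exists l : 'M[R]_(p, q), 0 <= t -> forall k, `|xs k t - l| <= w t / 2 ^+ k.
  move=> t; have [t0|tn] := leP 0 t; last by exists 0.
  by have [l Hl] := lim t t0; exists l.
have half0 (e : R) : 0 < e -> exists k, (2 ^+ k)^-1 < e.
  move=> e0; exists (Num.truncn e^-1).+1.
  rewrite -[X in _ < X]invrK ltf_pV2 ?posrE ?invr_gt0 ?exprn_gt0 //.
  apply: lt_le_trans (truncnS_gt _) _.
  by rewrite -natrX ler_nat ltnW // ltn_expl.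
have mx : mlmeas x.
  move=> i j; apply: (@measurable_fun_cvg _ (lebT R) R _ (fun k t => xs k t i j)).
    by move=> k; have [ac _] := xs_prop k; exact: ac_mlmeas ac i j.
  move=> t; rewrite /= in_itv/= andbT => t0.
  apply/cvgrPdist_lt => e e0.
  have we0 : 0 < e / w t by rewrite divr_gt0 // (lt_le_trans ltr01) ?w1.
  have [k0 Hk0] := half0 _ we0.
  exists k0 => // k /= kk0.
  rewrite distrC; apply: le_lt_trans (_ : w t / 2 ^+ k0 < _).
    have := mx_entry_le (xs k t - x t) i j; rewrite !mxE => /le_trans; apply.
    apply: le_trans (Hx t t0 k) _; rewrite ler_wpM2l ?w0 // lef_pV2 ?posrE ?exprn_gt0 //.
    by rewrite ler_eXn2l // ltr1n.
  by rewrite mulrC -ltr_pdivlMr // (lt_le_trans ltr01) ?w1.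
have xl : mloc (fun t => F t (x t)).
  apply: Fmloc => //; exists (fun t => `|c| + w t).
    have [acc _] := solves_cst `|c|.
    move=> T T0; apply: (@ac_dom _ unit _ _ T 1 (fun=> w)) => [_|u t u0 ut tT]; first exact: acw.
    by rewrite mul1r big_const card_unit /= addr0 opprD addrACA subrr add0r.
  move=> t t0; have := Hx t t0 0%N; rewrite /= expr0 divr1 => H.
  rewrite -[x t](subKr c) (le_trans (ler_normB _ _)) // lerD2l //.
(* The limit [x] is only known pointwise; its image under [Phi] is absolutely continuous by
   construction and equals it at every nonnegative time. *)
exists (Phi x).
have xE t : 0 <= t -> Phi x t = x t.
  move=> t0; apply/eqP; rewrite -subr_eq0 -normr_le0; apply/ler_addgt0Pr => e e0; rewrite add0r.
  have we0 : 0 < e / w t by rewrite divr_gt0 // (lt_le_trans ltr01) ?w1.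
  have [k Hk] := half0 _ we0.
  have [_ lk] := xs_prop k.
  have E1 : `|Phi x t - xs k.+1 t| <= (2 ^+ k)^-1 * (w t / 2).
    have -> : Phi x t - xs k.+1 t =
        mprim (fun t => F t (x t) - F t (xs k t)) t -
        mprim (fun t => F t (x t) - F t (xs k t)) s.
      by rewrite !mprimB //= /Phi sub_affine.
    apply: bnd => //; first exact: mlocB.
    move=> r r0; apply: (le_trans (FL _ _ r0)).
    by rewrite mulrA mulrC ler_pM ?L0 ?LL' // distrC mulrC; exact: Hx.
  have E2 := Hx t t0 k.+1.
  have -> : Phi x t - x t = (Phi x t - xs k.+1 t) + (xs k.+1 t - x t) by rewrite addrA subrK.
  apply: le_trans (ler_normD _ _) _; apply: le_trans (lerD E1 E2) _.
  have -> : (2 ^+ k)^-1 * (w t / 2) + w t / 2 ^+ k.+1 = (2 ^+ k)^-1 * w t.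
    by rewrite exprS; field; rewrite expf_neq0.
  by rewrite -ler_pdivlMr ?ltW // (lt_le_trans ltr01) ?w1.
have FE t : 0 <= t -> mprim (fun t => F t (Phi x t)) t = mprim (fun t => F t (x t)) t.
  by move=> t0; apply: eq_mprim => r /andP[r0 _]; rewrite xE.
split.
- exact: Phi_ac.
- by move=> i j; apply: eq_loc_integrable (xl i j) => t t0; rewrite xE.
- by move=> t t0; rewrite !FE.
Qed.

End picard.

(** * Measurability of Caratheodory compositions *)

Section caratheodory_composition.
Context {R : realType}.

Lemma continuous_borel_measurable (V : ptopologicalType) (phi : V -> R) : continuous phi ->
  measurable_fun setT (phi : g_sigma_algebraType (@open V) -> R).
Proof.
move=> cphi; apply: (measurability _ (RGenOInfty.measurableE R)) => _ [_ [c ->] <-].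
rewrite setTI; apply: sub_sigma_algebra.
by apply: open_comp; [move=> x _; exact: cphi|exact: interval_open].
Qed.

Lemma borel_fun_comp (V : normedModType R) (h : R -> V) (phi : V -> R) : continuous phi ->
  borel_fun h -> measurable_fun `[0 : R, +oo[ (phi \o h).
Proof.
by move=> cphi bh; apply: (measurableT_comp (continuous_borel_measurable cphi)).
Qed.

Section grid.
Context {p q : nat}.

(** Rounding down to a grid of mesh $1/(n+1)$ leaves countably many values; integer matrices encode
    them so that they can be enumerated. *)
Definition grid_index n (A : 'M[R]_(p, q)) : 'M[int]_(p, q) :=
  \matrix_(i, j) Num.floor (n.+1%:R * A i j).

Definition grid_point n (B : 'M[int]_(p, q)) : 'M[R]_(p, q) :=
  \matrix_(i, j) ((B i j)%:~R / n.+1%:R).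

Lemma grid_dist n A : `|A - grid_point n (grid_index n A)| <= n.+1%:R^-1.
Proof.
apply: mx_norm_le; first by rewrite invr_ge0.
move=> i j; rewrite !mxE.
have n0 : (0 : R) < n.+1%:R by rewrite ltr0n.
have -> : A i j - (Num.floor (n.+1%:R * A i j))%:~R / n.+1%:R =
    (n.+1%:R * A i j - (Num.floor (n.+1%:R * A i j))%:~R) / n.+1%:R.
  by field; rewrite gt_eqF.
rewrite normrM [X in _ * X]ger0_norm ?invr_ge0 // -[leRHS]mul1r ler_pM2r ?invr_gt0 //.
have /andP[h1 h2] := floor_itv (n.+1%:R * A i j).
rewrite ger0_norm ?subr_ge0 // lerBlDr addrC ltW //.
by move: h2; rewrite intrD.
Qed.

Lemma grid_cvg A : grid_point n (grid_index n A) @[n --> \oo] --> A.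
Proof.
apply/cvgrPdist_lt => e e0; near=> n.
apply: le_lt_trans (grid_dist n A) _.
by near: n; exact: (near_infty_natSinv_lt (PosNum e0)).
Unshelve. all: by end_near. Qed.

Lemma measurable_grid_index d (T : measurableType d) (D : set T) (X : T -> 'M[R]_(p, q)) n B :
  measurable D -> (forall i j, measurable_fun D (fun w => X w i j)) ->
  measurable (D `&` [set w | grid_index n (X w) = B]).
Proof.
move=> mD mX.
have K (s : seq ('I_p * 'I_q)) : measurable (D `&`
    [set w | all (fun ij => Num.floor (n.+1%:R * X w ij.1 ij.2) == B ij.1 ij.2) s]).
  elim: s => [|ij s IH].
    by rewrite (_ : [set w | _] = setT) ?setIT //; apply/seteqP; split.
  have -> : D `&` [set w | all (fun ij => Num.floor (n.+1%:R * X w ij.1 ij.2) == B ij.1 ij.2) (ij :: s)] =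
     (D `&` (fun w => n.+1%:R * X w ij.1 ij.2) @^-1` `[(B ij.1 ij.2)%:~R, (B ij.1 ij.2 + 1)%:~R[) `&`
     (D `&` [set w | all (fun ij => Num.floor (n.+1%:R * X w ij.1 ij.2) == B ij.1 ij.2) s]).
    apply/seteqP; split => w /=.
      move=> [Dw /andP[/eqP <- al]]; do !split => //.
      by rewrite in_itv /=; exact: floor_itv.
    move=> [[Dw +] [_ al]]; rewrite in_itv/= => fw; split => //; rewrite al andbT.
    by rewrite (floor_def fw).
  apply: measurableI => //.
  have mf : measurable_fun D (fun w => n.+1%:R * X w ij.1 ij.2).
    by apply: measurable_funM => //.
  by apply: mf.
have := K (index_enum _); congr (measurable _); congr (_ `&` _).
apply/seteqP; split => w /=.
  move=> /allP al; apply/matrixP => i j; rewrite mxE.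
  by apply/eqP; apply: (al (i, j)); rewrite mem_index_enum.
by move=> E; apply/allP => -[i j] _ /=; rewrite -E mxE.
Qed.

End grid.

(** On each set where the rounded arguments are constant only the dependence on time remains, and it
    is measurable; continuity then allows the mesh to tend to 0. The source space is arbitrary
    because it must serve both Lebesgue measurable times and Borel pairs (time, control). *)
Lemma caratheodory_comp d (T : measurableType d) (D : set T) m k
    (a : R -> 'cV[R]_m -> 'cV[R]_k -> R) (t : T -> R) (X : T -> 'cV[R]_m) (P : T -> 'cV[R]_k) :
  measurable D -> (forall x p, measurable_fun `[0 : R, +oo[ (fun t => a t x p)) ->
  measurable_fun D t ->
  (forall i j, measurable_fun D (fun w => X w i j)) ->
  (forall i j, measurable_fun D (fun w => P w i j)) ->
  (forall w, D w -> 0 <= t w) ->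
  (forall w, D w -> continuous (fun z : 'cV[R]_m * 'cV[R]_k => a (t w) z.1 z.2)) ->
  measurable_fun D (fun w => a (t w) (X w) (P w)).
Proof.
move=> mD ma mt mX mP t0 ca.
pose phi n w := a (t w) (grid_point n (grid_index n (X w))) (grid_point n (grid_index n (P w))).
apply: (@measurable_fun_cvg _ T R D phi) => [n|w Dw]; last first.
  have C := ca w Dw (X w, P w).
  apply: (@cvg_comp _ _ _ (fun n => (grid_point n (grid_index n (X w)), grid_point n (grid_index n (P w))))
    (fun z : 'cV[R]_m * 'cV[R]_k => a (t w) z.1 z.2) _ _ _ _ C).
  exact (@cvg_pair _ _ _ _ (nbhs (X w)) (nbhs (P w)) _ _ _ _ _ (@grid_cvg m 1 (X w)) (@grid_cvg k 1 (P w))).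
move=> _ Y mY.
pose E (uv : 'M[int]_(m, 1) * 'M[int]_(k, 1)) := (D `&` [set w | grid_index n (X w) = uv.1]) `&`
  (D `&` [set w | grid_index n (P w) = uv.2]) `&`
  (D `&` (fun w => a (t w) (grid_point n uv.1) (grid_point n uv.2)) @^-1` Y).
have -> : D `&` phi n @^-1` Y = \bigcup_j (if @unpickle ('M[int]_(m, 1) * 'M[int]_(k, 1))%type j is Some uv then E uv else set0).
  apply/seteqP; split => w /=.
    move=> [Dw Yw]; exists (pickle (grid_index n (X w), grid_index n (P w))) => //.
    by rewrite pickleK.
  move=> [j _]; case: unpickle => [[u v]|] //= [[[Dw Xw] [_ Pw]] [_ aw]].
  by split => //; rewrite /phi Xw Pw.
apply: bigcupT_measurable => j; case: unpickle => [[u v]|] //.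
apply: measurableI; first by apply: measurableI; exact: measurable_grid_index.
have mc : measurable_fun D (fun w => a (t w) (grid_point n u) (grid_point n v)).
  apply: (@measurable_comp _ _ _ _ _ _ `[0 : R, +oo[%classic (fun t => a t (grid_point n u) (grid_point n v)) D t) => //.
  by move=> _ [w Dw <-]; rewrite /= in_itv/= andbT; exact: t0.
exact: mc.
Qed.

(** By completeness every subset of a null set is measurable, so the times where continuity fails
    may be discarded. *)
Lemma lmeas_ae (h : R -> R) (N : set R) : (leb R).-negligible N ->
  measurable_fun ((`[0, +oo[%classic `\` N) : set (lebT R)) (h : lebT R -> R) -> lmeas h.
Proof.
move=> negN mh _ Y mY.
have mN (S : set R) : S `<=` N -> measurable (S : set (lebT R)).
  move=> SN; apply: (@completed_lebesgue_measure_is_complete R).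
  exact: negligibleS negN.
have mD : measurable ((`[0, +oo[%classic `\` N) : set (lebT R)).
  by apply: (@measurableD _ (lebT R)); [exact (measurable_leb_itv _)|exact: mN].
have -> : `[0, +oo[%classic `&` h @^-1` Y =
    ((`[0, +oo[%classic `\` N) `&` h @^-1` Y) `|` (N `&` (`[0, +oo[%classic `&` h @^-1` Y)).
  apply/seteqP; split => t /=.
    by move=> [t0 Yt]; have [Nt|Nt] := pselect (N t); [right|left].
  by move=> [[[t0 _] Yt]|[_ [t0 Yt]]].
apply: (@measurableU _ (lebT R)); first exact: mh.
by apply: mN; exact: subIsetl.
Qed.

Lemma regular_comp_lmeas m k (V : normedModType R) nrm
    (a : R -> 'cV[R]_m -> 'cV[R]_k -> V) (phi : V -> R)
    (x : R -> 'cV[R]_m) (u : R -> 'cV[R]_k) :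
  continuous phi -> regular nrm a -> mlmeas x -> mlmeas u ->
  lmeas (fun t => phi (a t (x t) (u t))).
Proof.
move=> cphi [ba ca _] mx mu.
have negN : (leb R).-negligible [set t | ~ (0 <= t -> continuous (fun z : 'cV[R]_m * 'cV[R]_k => a t z.1 z.2))].
  by case: ca => N [mN N0 NE]; exists N; split.
apply: (lmeas_ae negN).
have mD : measurable ((`[0, +oo[%classic `\` [set t | ~ (0 <= t -> continuous (fun z : 'cV[R]_m * 'cV[R]_k => a t z.1 z.2))]) : set (lebT R)).
  apply: (@measurableD _ (lebT R)); first exact (measurable_leb_itv _).
  exact: (@completed_lebesgue_measure_is_complete R).
have sub : (`[0, +oo[%classic `\` [set t | ~ (0 <= t -> continuous (fun z : 'cV[R]_m * 'cV[R]_k => a t z.1 z.2))]) `<=` `[0 : R, +oo[.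
  by move=> t [].
have restr (h : R -> R) : lmeas h -> measurable_fun ((`[0, +oo[%classic `\` [set t | ~ (0 <= t -> continuous (fun z : 'cV[R]_m * 'cV[R]_k => a t z.1 z.2))]) : set (lebT R)) (h : lebT R -> R).
  move=> mh; apply: (@measurable_funS _ _ (lebT R) R `[0, +oo[%classic).
  - exact (measurable_leb_itv _).
  - exact: sub.
  - exact: mh.
apply: (@caratheodory_comp _ (lebT R) _ m k (fun t x p => phi (a t x p)) (fun t => t) x u).
- exact: mD.
- by move=> y p; apply: borel_fun_comp => //; exact: ba.
- apply: restr; apply: measurable_fun_leb; first exact: measurable_itv.
  exact: measurable_id.
- by move=> i j; apply: restr; exact: mx.
- by move=> i j; apply: restr; exact: mu.
- by move=> t [] /=; rewrite in_itv/= andbT.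
- move=> t [/=]; rewrite in_itv/= andbT => t0 /contrapT /(_ t0) ct z.
  by apply: continuous_comp; [exact: ct|exact: cphi].
Qed.

Lemma borel_mlmeas p q (u : R -> 'M[R]_(p, q)) : borel_fun u -> mlmeas u.
Proof.
move=> bu i j.
have := borel_fun_comp (phi := fun A : 'M[R]_(p, q) => A i j) (@coord_continuous R p q i j) bu.
exact: measurable_fun_leb.
Qed.

End caratheodory_composition.

(** * Bounds on compact boxes *)

Section local_bounds.
Context {R : realType}.

Lemma trmx_continuous p q : continuous (@trmx R p q).
Proof.
move=> A.
apply/(@cvgrPdist_lt R 'M[R]_(q, p) _ (nbhs A) (nbhs_filter A)) => e e0; apply/nbhs_ballP; exists e => // B.
rewrite -ball_normE /= => AB; apply: le_lt_trans AB.
apply: mx_norm_le => // i j; have := mx_entry_le (A - B) j i.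
by rewrite !mxE.
Qed.

Lemma cV_ball_compact m (r : R) : compact [set x : 'cV[R]_m | `|x| <= r].
Proof.
have [r0|rn] := leP 0 r; last first.
  rewrite (_ : [set x | _] = set0); first exact: compact0.
  by apply/seteqP; split => // x /= /(le_trans (normr_ge0 x)); rewrite leNgt rn.
have K := @rV_compact R m (fun=> `[- r, r]%classic) (fun=> @segment_compact R _ _).
have := @continuous_compact _ _ (@trmx R 1 m) _ _ K; move=> /(_ _).
rewrite (_ : _ @` _ = [set x : 'cV[R]_m | `|x| <= r]).
  by apply; apply: continuous_subspaceT; exact: trmx_continuous.
apply/seteqP; split => x /=.
  move=> [v vr <-]; apply: mx_norm_le => // i j; rewrite mxE ord1.
  by have := vr i; rewrite /= in_itv/= ler_norml.
move=> xr; exists x^T; last by rewrite trmxK.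
by move=> i; rewrite /= in_itv/= -ler_norml mxE (le_trans (mx_entry_le _ _ _)).
Qed.

(** The factor [m] in the Lipschitz bound comes from replacing the Euclidean norm of [x - y] by its
    largest entry. *)
Lemma regular_box m k (V : normedModType R) (nrm : V -> R)
    (a : R -> 'cV[R]_m -> 'cV[R]_k -> V) (r rho : R) :
  (forall v, `|v| <= nrm v) -> regular nrm a ->
  exists L M : R -> R, [/\ loc_integrable L /\ loc_integrable M,
    forall t, 0 <= t -> 0 <= L t /\ 0 <= M t,
    forall (t : R) x y p, 0 <= t -> `|x| <= r -> `|y| <= r -> `|p| <= rho ->
       `|a t x p - a t y p| <= L t * `|x - y| &
    forall (t : R) x p, 0 <= t -> `|x| <= r -> `|p| <= rho -> `|a t x p| <= M t].
Proof.
move=> nle [_ _ reg].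
have [L [M [[Li Mi] LM0 HL HM]]] := reg _ (compact_setX (@cV_ball_compact m r) (@cV_ball_compact k rho)).
exists (fun t => m%:R * L t), M; split.
- by split => //; exact: loc_integrableZ.
- by move=> t t0; have [? ?] := LM0 t t0; split => //; exact: mulr_ge0.
- move=> t x y p t0 xr yr pr; apply: le_trans (nle _) _.
  apply: le_trans (HL t x y p t0 _ _) _ => //.
  have -> : m%:R * L t * `|x - y| = L t * (m%:R * `|x - y|) by ring.
  rewrite ler_wpM2l //; first by have [] := LM0 t t0.
  by apply: le_trans (enorm_le_norm _) _; rewrite muln1.
- by move=> t x p t0 xr pr; apply: le_trans (nle _) _; exact: HM.
Qed.

Lemma growth_box m k (f : R -> 'cV[R]_m -> 'cV[R]_k -> 'cV[R]_m) (rho : R) :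
  sublinear_growth f ->
  exists l : R -> R, [/\ loc_integrable l, forall t, 0 <= t -> 0 <= l t &
    forall (t : R) x p, 0 <= t -> `|p| <= rho -> `|f t x p| <= l t * (1 + `|x|)].
Proof.
move=> H; have [l li hl] := H _ (@cV_ball_compact k rho).
exists (fun t => (1 + m%:R) * `|l t|); split.
- by apply: loc_integrableZ; exact: loc_integrable_norm.
- by move=> t t0; rewrite mulr_ge0 // addr_ge0.
- move=> t x p t0 pr; apply: le_trans (norm_le_enorm _) _.
  apply: le_trans (hl t x p t0 pr) _.
  have e0 := enorm_ge0 x.
  apply: (@le_trans _ _ (`|l t| * (1 + enorm x))).
    by rewrite ler_wpM2r ?ler_norm // addr_ge0.
  rewrite -mulrA mulrCA ler_wpM2l //.
  have := enorm_le_norm x; rewrite muln1 => ex.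
  have : 0 <= m%:R :> R by [].
  have := normr_ge0 x; nra.
Qed.

(** Again the constant is fixed before the functions. The source [b] enters through its whole
    integral over [0, T], which bounds its contribution in either direction of time. *)
Lemma mx_gronwall (L : R -> R) (s T : R) : loc_integrable L ->
  (forall t, 0 <= t -> 0 <= L t) -> 0 <= T -> s = 0 \/ s = T ->
  exists2 C : R, 0 <= C & forall p q (z v : R -> 'M[R]_(p, q)) (b : R -> R),
    (forall T, 0 <= T -> abs_continuous T z) -> mloc v -> loc_integrable b ->
    (forall t, 0 <= t <= T -> 0 <= b t) ->
    (forall t, 0 <= t <= T -> z t = z s + (mprim v t - mprim v s)) ->
    (forall t, 0 <= t <= T -> `|v t| <= L t * `|z t| + b t) ->
    forall t, 0 <= t <= T -> `|z t| <= C * (`|z s| + prim b T).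
Proof.
move=> Li L0 T0 sT; have [C C0 HC] := gronwall Li L0 T0 sT.
have s0T : 0 <= s <= T by case: sT => ->; rewrite lexx T0.
exists C => // p q z v b acz vl bi b0 zE vb.
have zLi : loc_integrable (fun t => `|z t| * L t).
  by apply: loc_integrableM => // T' T'0; apply: ac_norm; exact: acz.
apply: HC => //.
  have [B B0 HB] := ac_bounded T0 (acz T T0).
  by exists B => t t0T; rewrite normr_ge0 HB.
move=> t /[dup] t0T /andP[t0 tT]; rewrite {1}zE // (le_trans (ler_normD _ _)) // -addrA lerD2l.
have [s0 sleT] := andP s0T.
have bnd : `|mprim v t - mprim v s| <=
    `|prim (fun r => `|z r| * L r + b r) t - prim (fun r => `|z r| * L r + b r) s|.
  apply: mprim_dom2 => //; first exact: loc_integrableD.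
  move=> r; rewrite ge_min le_max => /andP[/orP h1 /orP h2].
  rewrite [`|z r| * _]mulrC; apply: vb; apply/andP; split.
    by case: h1; apply: le_trans.
  by case: h2 => h2; apply: le_trans h2 _.
apply: le_trans bnd _; rewrite !primD // opprD addrACA (le_trans (ler_normD _ _)) // [leLHS]addrC lerD2r.
have pb u w : 0 <= u -> u <= w -> w <= T -> `|prim b w - prim b u| <= prim b T.
  move=> u0 uw wT; rewrite ger0_norm; last first.
    rewrite subr_ge0; apply: prim_mono; rewrite ?u0 // => r /andP[ur rw].
    by rewrite b0 // (le_trans u0) // (le_trans rw).
  rewrite lerBlDr -[leLHS]addr0 lerD //.
    apply: prim_mono; rewrite ?(le_trans u0) // => r /andP[wr rT].
    by rewrite b0 // rT (le_trans u0) // (le_trans uw).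
  by apply: prim_ge0 => // r /andP[r0 ru]; rewrite b0 // r0 (le_trans ru) // (le_trans uw).
by have [st|/ltW ts] := leP s t; [exact: pb|rewrite distrC; exact: pb].
Qed.

End local_bounds.

(** * Second-order remainders and truncation of the state *)

Section taylor.
Context {R : realType} {m : nat}.

Lemma is_derive_line (V W : normedModType R) (h : V -> W) (x w : V) (s : R) d :
  is_derive (x + s *: w) w h d -> is_derive s (1 : R) (fun s => h (x + s *: w)) d.
Proof.
move=> [dh dhE].
have E : (fun r : R => r^-1 *: (((fun s => h (x + s *: w)) \o shift s) (r *: (1 : R)) - h (x + s *: w)))
   = (fun r => r^-1 *: ((h \o shift (x + s *: w)) (r *: w) - h (x + s *: w))).
  apply/funext => r /=; congr (_ *: (h _ - _)).
  by rewrite [r *: 1]mulr1 scalerDl addrCA.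
by apply: DeriveDef; rewrite /derivable /derive E.
Qed.

(** The mean value theorem on the segment from [x] to [y], which stays in the convex ball, leaves a
    difference of two gradients; the factor [m] comes from the product of a row and a column. *)
Lemma taylor_remainder (h : 'cV[R]_m -> R) (G : 'cV[R]_m -> 'rV[R]_m) (r l : R) x y :
  (forall z w, is_derive z w h ((G z *m w) 0 0)) ->
  (forall z w, `|z| <= r -> `|w| <= r -> `|G z - G w| <= l * `|z - w|) ->
  0 <= l -> `|x| <= r -> `|y| <= r ->
  `|h y - h x - (G x *m (y - x)) 0 0| <= m%:R * l * `|y - x| ^+ 2.
Proof.
move=> dh Gl l0 xr yr; pose w := y - x.
pose phi s := h (x + s *: w).
have dphi s : is_derive s (1 : R) phi ((G (x + s *: w) *m w) 0 0) by exact: is_derive_line.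
have [|c] := @MVT_segment R phi (fun s => (G (x + s *: w) *m w) 0 0) 0 1 ler01 (fun s _ => dphi s).
  apply: continuous_subspaceT => s.
  apply: differentiable_continuous; apply/derivable1_diffP.
  by have [] := dphi s.
rewrite in_itv/= => /andP[c0 c1]; rewrite /phi scale1r scale0r addr0 subr0 mulr1.
have -> : x + w = y by rewrite /w addrC subrK.
move=> ->.
have -> : (G (x + c *: w) *m w) 0 0 - (G x *m w) 0 0 = ((G (x + c *: w) - G x) *m w) 0 0.
  by rewrite mulmxBl !mxE.
apply: le_trans (mx_entry_le _ _ _) _; apply: le_trans (mx_norm_mul _ _) _.
rewrite expr2 mulrA -/w ler_wpM2r // -!mulrA ler_wpM2l //.
have xcw : `|x + c *: w| <= r.
  have -> : x + c *: w = (1 - c) *: x + c *: y.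
    by rewrite /w scalerBr scalerBl scale1r addrAC addrA addrAC.
  apply: le_trans (ler_normD _ _) _; rewrite !normrZ !ger0_norm ?subr_ge0 //.
  have := normr_ge0 x; have := normr_ge0 y; nra.
apply: le_trans (Gl _ _ xcw xr) _; rewrite ler_wpM2l //.
by rewrite addrAC subrr add0r normrZ ger0_norm // ler_piMl.
Qed.

Lemma derive_sum_delta (W : normedModType R) (h : 'cV[R]_m -> W) x w : differentiable h x ->
  'D_w h x = \sum_j w j 0 *: 'D_(delta_mx j 0) h x.
Proof.
move=> dh; rewrite deriveE // [X in 'd h x X](matrix_sum_delta w) linear_sum.
apply: eq_bigr => j _; rewrite big_ord1 linearZ deriveE //.
Qed.

Lemma is_derive_gradient (h : 'cV[R]_m -> R) x w : differentiable h x ->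
  is_derive x w h ((gradient h x *m w) 0 0).
Proof.
move=> dh; apply: DeriveDef; first exact: diff_derivable.
rewrite derive_sum_delta // !mxE; apply: eq_bigr => j _.
by rewrite !mxE mulrC.
Qed.

Lemma is_derive_entry p q (V : normedModType R) (h : V -> 'M[R]_(p, q)) x w d i j :
  is_derive x w h d -> is_derive x w (fun y => h y i j) (d i j).
Proof.
move=> [dh dhE].
have C : r^-1 *: (((fun y => h y i j) \o shift x) (r *: w) - h x i j) @[r --> 0^'] --> d i j.
  have -> : (fun r : R => r^-1 *: (((fun y => h y i j) \o shift x) (r *: w) - h x i j)) =
     (fun A : 'M[R]_(p, q) => A i j) \o (fun r : R => r^-1 *: ((h \o shift x) (r *: w) - h x)).
    by apply/funext => r; rewrite /= !mxE.
  apply: cvg_comp; last exact: coord_continuous.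
  rewrite -dhE; exact: dh.
apply: DeriveDef; first by apply/cvg_ex; exists (d i j).
exact: (@cvg_lim _ (@norm_hausdorff _ _)).
Qed.

Lemma is_derive_jacobian p (h : 'cV[R]_m -> 'cV[R]_p) x w : differentiable h x ->
  is_derive x w h (jacobian_mx h x *m w).
Proof.
move=> dh; apply: DeriveDef; first exact: diff_derivable.
rewrite derive_sum_delta //; apply/matrixP => i j; rewrite ord1 summxE !mxE.
by apply: eq_bigr => l _; rewrite !mxE mulrC.
Qed.

Lemma jacobian_remainder p (h : 'cV[R]_m -> 'cV[R]_p) (r l : R) x y :
  (forall z, differentiable h z) ->
  (forall z w, `|z| <= r -> `|w| <= r -> `|jacobian_mx h z - jacobian_mx h w| <= l * `|z - w|) ->
  0 <= l -> `|x| <= r -> `|y| <= r ->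
  `|h y - h x - jacobian_mx h x *m (y - x)| <= m%:R * l * `|y - x| ^+ 2.
Proof.
move=> dh Jl l0 xr yr; apply: mx_norm_le; first by rewrite mulr_ge0 ?mulr_ge0 // exprn_ge0.
move=> i j; rewrite ord1.
have := @taylor_remainder (fun y => h y i 0) (fun z => row i (jacobian_mx h z)) r l x y.
have -> : (row i (jacobian_mx h x) *m (y - x)) 0 0 = (jacobian_mx h x *m (y - x)) i 0.
  by rewrite -row_mul mxE.
rewrite !mxE; apply => //.
  move=> z w; have := is_derive_entry i 0 (is_derive_jacobian w (dh z)).
  by rewrite -row_mul [row _ _ 0 0]mxE.
move=> z w zr wr; apply: le_trans (Jl z w zr wr); apply: mx_norm_le => // i' j'.
by rewrite -raddfB /= mxE; exact: mx_entry_le.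
Qed.

End taylor.

Section clamp.
Context {R : realType}.

(** The projection on the cube of radius [r]. It is 1-Lipschitz, so composing with it makes a
    locally Lipschitz field globally Lipschitz and changes nothing on the cube. *)
Definition clamp m (r : R) (x : 'cV[R]_m) : 'cV[R]_m :=
  \col_i Num.max (- r) (Num.min r (x i 0)).

Lemma clamp_norm m (r : R) (x : 'cV[R]_m) : 0 <= r -> `|clamp r x| <= r.
Proof.
move=> r0; apply: mx_norm_le => // i j; rewrite mxE ler_norml le_max lexx /=.
by rewrite ge_max ge_min lexx /= (le_trans _ r0) // oppr_le0.
Qed.

Lemma clamp_lip m (r : R) (x y : 'cV[R]_m) : 0 <= r -> `|clamp r x - clamp r y| <= `|x - y|.
Proof.
move=> r0; apply: mx_norm_le => // i j; rewrite !mxE.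
apply: le_trans (_ : `|x i 0 - y i 0| <= _); last first.
  by have := mx_entry_le (x - y) i 0; rewrite !mxE.
move: (x i 0) (y i 0) => a b.
have h1 := ler_norm (a - b); have h2 := ler_norm (b - a); rewrite (distrC b) in h2.
have h3 := normr_ge0 (a - b).
have H (c : R) : [\/ (Num.max (- r) (Num.min r c) = - r /\ c <= - r),
    (Num.max (- r) (Num.min r c) = c /\ - r <= c <= r) |
    (Num.max (- r) (Num.min r c) = r /\ r <= c)].
  have [rc|/ltW cr] := leP r c.
    by constructor 3; rewrite max_r //; lra.
  have [rc|/ltW cr'] := leP (- r) c; first by constructor 2.
  by constructor 1.
rewrite ler_norml; case: (H a) => -[-> a1]; case: (H b) => -[-> b1];
  try move/andP: a1 => [? ?]; try move/andP: b1 => [? ?]; apply/andP; split; lra.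
Qed.

Lemma clamp_id m (r : R) (x : 'cV[R]_m) : `|x| <= r -> clamp r x = x.
Proof.
move=> xr; apply/matrixP => i j; rewrite mxE ord1.
have := le_trans (mx_entry_le x i 0) xr; rewrite ler_norml => /andP[a b].
by rewrite min_r // max_r.
Qed.

Lemma mlmeas_clamp m (r : R) (y : R -> 'cV[R]_m) : mlmeas y -> mlmeas (fun t => clamp r (y t)).
Proof.
move=> my i j; apply: (@eq_lmeas _ (fun t => Num.max (- r) (Num.min r (y t i 0)))).
  by move=> t _; rewrite mxE.
apply: measurable_maxr; first exact: measurable_cst.
by apply: measurable_minr; [exact: measurable_cst|exact: my].
Qed.

End clamp.

Section zmod.

Lemma sub_affine2 (V : zmodType) (c c' a b d e : V) :
  c + (a - b) - (c' + (d - e)) = (c - c') + ((a - d) - (b - e)).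
Proof.
by rewrite opprD addrACA; congr (_ + _); have := sub_affine 0 a b d e; rewrite !add0r.
Qed.

Lemma acB {R : realType} (V : normedModType R) (T : R) (x y : R -> V) :
  abs_continuous T x -> abs_continuous T y -> abs_continuous T (fun t => x t - y t).
Proof.
move=> acx acy; apply: (@ac_dom _ bool _ _ T 1 (fun b => if b then x else y)).
  by case.
move=> s t s0 st tT; rewrite mul1r big_bool /=.
have -> : x t - y t - (x s - y s) = (x t - x s) - (y t - y s).
  by rewrite !opprB addrACA [RHS]addrACA [- y t + _]addrC.
exact: ler_normB.
Qed.

End zmod.

(** * Trajectories and their dependence on the initial state *)

Section control_system.
Context {R : realType} {m k : nat}.
Variables (f : R -> 'cV[R]_m -> 'cV[R]_k -> 'cV[R]_m) (g : R -> 'cV[R]_m -> 'cV[R]_k -> R).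
Hypothesis reg : regularity_conditions f g.
Implicit Types (x y : R -> 'cV[R]_m) (u : R -> 'cV[R]_k) (s t T : R).

(** Free of the constraint [U], so that the same estimates serve the optimal control and its needle
    variations before these are shown admissible. *)
Definition control u := borel_fun u /\
  forall T, 0 <= T -> exists rho : R, forall t, 0 <= t <= T -> `|u t| <= rho.

Lemma admissible_control (U : R -> set 'cV[R]_k) u : admissible U u -> control u.
Proof.
move=> [bu lu _]; split => // T T0; have [M HM] := lu T T0.
by exists M => t tT; rewrite (le_trans (norm_le_enorm _)) ?HM.
Qed.

Let ac_all x := forall T, 0 <= T -> abs_continuous T x.

Lemma regular_mloc p q nrm (a : R -> 'cV[R]_m -> 'cV[R]_k -> 'M[R]_(p, q)) x u :
  (forall v, `|v| <= nrm v) -> regular nrm a -> ac_all x -> control u ->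
  mloc (fun t => a t (x t) (u t)).
Proof.
move=> nle ra acx [bu lu]; apply: mloc_dom.
  move=> i j; apply: (regular_comp_lmeas (phi := fun A : 'M[R]_(p, q) => A i j)).
  - exact: coord_continuous.
  - exact: ra.
  - exact: ac_mlmeas.
  - exact: borel_mlmeas.
move=> T T0; have [r r0 xr] := ac_bounded T0 (acx T T0); have [rho ur] := lu T T0.
have [L [M [[Li Mi] _ _ HM]]] := regular_box r rho nle ra.
by exists M => // t /[dup] tT /andP[t0 _]; rewrite HM // ?xr ?ur.
Qed.

Lemma f_mloc x u : ac_all x -> control u -> mloc (fun t => f t (x t) (u t)).
Proof.
by case: reg => _ [rf _] _ _; exact: (regular_mloc (@norm_le_enorm R _ _) rf).
Qed.

Lemma dfdx_mloc x u : ac_all x -> control u -> mloc (fun t => dfdx f t (x t) (u t)).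
Proof.
by case: reg => _ _ [rf _] _; exact: (regular_mloc (@norm_le_enorm R _ _) rf).
Qed.

Lemma dgdx_mloc x u : ac_all x -> control u -> mloc (fun t => dgdx g t (x t) (u t)).
Proof.
by case: reg => _ _ [_ rg] _; exact: (regular_mloc (@norm_le_enorm R _ _) rg).
Qed.

Lemma g_loc x u : ac_all x -> control u -> loc_integrable (fun t => g t (x t) (u t)).
Proof.
case: reg => _ [_ rg] _ _ acx [bu lu]; apply: loc_integrable_dom.
  apply: (regular_comp_lmeas (phi := id) _ rg).
  - by move=> z; exact: cvg_id.
  - exact: ac_mlmeas.
  - exact: borel_mlmeas.
move=> T T0; have [r r0 xr] := ac_bounded T0 (acx T T0); have [rho ur] := lu T T0.
have [L [M [[Li Mi] _ _ HM]]] := regular_box r rho (fun v => lexx _) rg.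
by exists M => // t /[dup] tT /andP[t0 _]; rewrite HM // ?xr ?ur.
Qed.

Lemma trajectory_ac (c : 'cV[R]_m) u x : trajectory f c u x -> ac_all x.
Proof. by case=> -[]. Qed.

Lemma trajectory_prim (c : 'cV[R]_m) u x : control u -> trajectory f c u x ->
  forall t, 0 <= t -> x t = c + mprim (fun t => f t (x t) (u t)) t.
Proof.
move=> cu [sx <-] t t0; apply: mx_solves_prim => //; apply: f_mloc => //.
by case: sx.
Qed.

(** The integral form with a base time, so that the equation can be solved backward from [T] as well
    as forward from 0. *)
Definition arc_on u s T x := ac_all x /\ forall t, 0 <= t <= T ->
  x t = x s + (mprim (fun t => f t (x t) (u t)) t - mprim (fun t => f t (x t) (u t)) s).

Lemma trajectory_arc (c : 'cV[R]_m) u x s T : control u -> trajectory f c u x -> 0 <= s -> arc_on u s T x.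
Proof.
move=> cu tx s0; split; first exact: trajectory_ac tx.
move=> t /andP[t0 _]; rewrite (trajectory_prim cu tx t0) (trajectory_prim cu tx s0).
by rewrite -addrA [mprim _ s + _]addrC subrK.
Qed.

(** Sublinear growth feeds Gronwall with [l] both as rate and as source; the radius depends on the
    control and the state at [s] only through their bounds. *)
Lemma arc_bound T rho r0 s : 0 <= T -> s = 0 \/ s = T ->
  exists2 r : R, 0 <= r & forall u x, control u -> (forall t, 0 <= t <= T -> `|u t| <= rho) ->
    arc_on u s T x -> `|x s| <= r0 -> forall t, 0 <= t <= T -> `|x t| <= r.
Proof.
move=> T0 sT; case: reg => _ _ _ gr.
have [l [li l0 lH]] := growth_box rho gr.
have [C C0 HC] := mx_gronwall li l0 T0 sT.
exists (Num.max 0 (C * (r0 + prim l T))); first by rewrite le_max lexx.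
move=> u x cu ur [acx xE] xr t tT; rewrite le_max; apply/orP; right.
apply: le_trans (HC _ _ x (fun t => f t (x t) (u t)) l _ _ _ _ xE _ t tT) _ => //.
- exact: f_mloc.
- by move=> t' /andP[t'0 _]; exact: l0.
- move=> t' /[dup] t'T /andP[t'0 _]; apply: le_trans (lH _ _ _ t'0 (ur _ t'T)) _.
  by rewrite mulrDr mulr1 addrC.
- by rewrite ler_wpM2l // lerD2r.
Qed.

Lemma arc_lipschitz T rho r s : 0 <= T -> s = 0 \/ s = T ->
  exists2 C : R, 0 <= C & forall u x y, control u -> (forall t, 0 <= t <= T -> `|u t| <= rho) ->
    arc_on u s T x -> arc_on u s T y ->
    (forall t, 0 <= t <= T -> `|x t| <= r) -> (forall t, 0 <= t <= T -> `|y t| <= r) ->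
    forall t, 0 <= t <= T -> `|x t - y t| <= C * `|x s - y s|.
Proof.
move=> T0 sT; case: reg => _ [rf _] _ _.
have [L [M [[Li Mi] LM0 HL HM]]] := regular_box r rho (@norm_le_enorm R _ _) rf.
have L0 t : 0 <= t -> 0 <= L t by move=> /LM0[].
have s0 : 0 <= s by case: sT => ->.
have [C C0 HC] := mx_gronwall Li L0 T0 sT.
exists C => // u x y cu ur [acx xE] [acy yE] xr yr t tT.
have fx := f_mloc acx cu; have fy := f_mloc acy cu.
have := HC _ _ (fun t => x t - y t) (fun t => f t (x t) (u t) - f t (y t) (u t)) (fun=> 0) _ _ _ _ _ _ t tT.
rewrite (prim_cst _ T0) mul0r addr0; apply.
- by move=> T' T'0; apply: acB; [exact: acx|exact: acy].
- exact: mlocB.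
- exact: loc_integrable_cst.
- by [].
- move=> t' /[dup] t'T /andP[t'0 _]; rewrite !mprimB // {1}xE // {1}yE //.
  exact: sub_affine2.
- move=> t' /[dup] t'T /andP[t'0 _]; rewrite addr0; apply: HL => //; [exact: xr|exact: yr|exact: ur].
Qed.

End control_system.

Section inverse.
Context {R : realType} {m : nat}.

Lemma mloc_norm p q (h : R -> 'M[R]_(p, q)) : mloc h -> loc_integrable (fun t => `|h t|).
Proof.
move=> hl; apply: loc_integrable_dom; first exact: mlmeas_norm (mloc_lmeas hl).
move=> T T0; exists (fun t => \sum_(ij : 'I_p * 'I_q) `|h t ij.1 ij.2|).
  by apply: loc_integrable_sum => ij _; apply: loc_integrable_norm; exact: hl.
move=> t _; rewrite ger0_norm //; apply: mx_norm_le; first exact: sumr_ge0.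
by move=> i j; rewrite (bigD1 (i, j)) //= lerDl sumr_ge0.
Qed.

Lemma solves0_cst p q (X : R -> 'M[R]_(p, q)) : solves X (fun=> 0) ->
  forall t, 0 <= t -> X t = X 0.
Proof.
move=> sX t t0; have l0 : mloc (fun _ : R => 0 : 'M[R]_(p, q)).
  by move=> i j; apply: eq_loc_integrable (loc_integrable_cst 0) => r _; rewrite mxE.
rewrite (mx_solves_prim sX l0 t0) -[RHS]addr0; congr (_ + _).
apply/matrixP => i j; rewrite mxE [RHS]mxE -[RHS](mul0r t) -(prim_cst _ t0).
by apply: eq_prim => r _; rewrite mxE.
Qed.

(** The solution of $B' = -B D$ from the identity makes $B A$ constant. The inverse is thus itself a
    solution of a known equation, which differentiating the costate requires. *)
Lemma fundamental_inverse (D A : R -> 'M[R]_m) : mloc D ->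
  solves A (fun t => D t *m A t) -> A 0 = 1%:M ->
  exists B : R -> 'M[R]_m, solves B (fun t => - (B t *m D t)) /\
    forall t, 0 <= t -> A t \in unitmx /\ invmx (A t) = B t.
Proof.
move=> Dl sA A0.
pose L t := m%:R * `|D t|.
have Li : loc_integrable L by apply: loc_integrableZ; exact: mloc_norm.
have [|||||B [acB BDl BE]] := @picard R m m (fun t Y => - (Y *m D t)) L (fun=> 0) 0 1%:M Li _ (loc_integrable_cst 0).
- by move=> t _; rewrite /L mulr_ge0.
- by left.
- move=> y my i j; apply: eq_lmeas (lmeasN (mlmeas_mul my (mloc_lmeas Dl) i j)) => t _.
  by rewrite [RHS]mxE.
- move=> t y z _; rewrite opprK addrC -mulmxBl.
  apply: le_trans (mx_norm_mul _ _) _; rewrite (distrC z) /L.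
  by rewrite le_eqVlt; apply/orP; left; apply/eqP; ring.
- by move=> t _; rewrite mul0mx oppr0 normr0.
have B0 : B 0 = 1%:M by rewrite BE // subrr addr0.
have sB : solves B (fun t => - (B t *m D t)).
  apply: mx_solves_of_prim => // t t0; rewrite BE // B0; congr (_ + _).
  by rewrite (mprim0 BDl) subr0.
exists B; split => // t t0.
have BA : B t *m A t = 1%:M.
  have sBA := solves_mulmx sB sA.
  have : solves (fun t => B t *m A t) (fun=> 0).
    apply: solves_ext sBA => //; apply: aeW => r _.
    by rewrite mulNmx mulmxA addNr.
  by move=> /solves0_cst/(_ t t0) ->; rewrite B0 A0 mulmx1.
have [Bu Au] := mulmx1_unit BA; split => //.
by rewrite -[invmx _]mul1mx -BA -mulmxA mulmxV // mulmx1.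
Qed.

End inverse.

Section existence.
Context {R : realType} {m k : nat}.
Variables (f : R -> 'cV[R]_m -> 'cV[R]_k -> 'cV[R]_m) (g : R -> 'cV[R]_m -> 'cV[R]_k -> R).
Hypothesis reg : regularity_conditions f g.

Lemma arc_exists (u : R -> 'cV[R]_k) (T s : R) (c : 'cV[R]_m) :
  control u -> 0 <= T -> s = 0 \/ s = T -> exists x, arc_on f u s T x /\ x s = c.
Proof.
move=> cu T0 sT; have [bu lu] := cu; have [rho ur] := lu T T0.
case: reg => _ [rf _] _ gr.
have [l [li l0 lH]] := growth_box rho gr.
have [C C0 HC] := mx_gronwall li l0 T0 sT.
pose r := Num.max 0 (C * (`|c| + prim l T)).
have r0 : 0 <= r by rewrite le_max lexx.
have [L [M [[Li Mi] LM0 HL HM]]] := regular_box r rho (@norm_le_enorm R _ _) rf.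
(* The field is also switched off after [T], so that [T] may be the base time. *)
pose F t (y : 'cV[R]_m) := if t <= T then f t (clamp r y) (u t) else 0.
pose L1 t := if t <= T then L t else 0; pose M1 t := if t <= T then M t else 0.
have s0T : 0 <= s <= T by case: sT => ->; rewrite lexx T0.
have /andP[s0 sleT] := s0T.
have clamp0 : clamp r (0 : 'cV[R]_m) = 0 by rewrite clamp_id // normr0.
have [|||||x [acx Fl xE]] := @picard R m 1 F L1 M1 s c (loc_integrable_trunc T Li) _ (loc_integrable_trunc T Mi).
- by move=> t t0; rewrite /L1; case: ifP => // _; have [] := LM0 t t0.
- case: sT => sE; [by left|right; split => // t st].
  by rewrite /L1 /M1 -sE leNgt st.
- move=> y my i j.
  have := lmeas_trunc T (regular_comp_lmeas (@coord_continuous R m 1 i j) rf (mlmeas_clamp r my) (borel_mlmeas bu)).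
  by apply: eq_lmeas => t _; rewrite /F; case: ifP => // _; rewrite mxE.
- move=> t y z t0; rewrite /F /L1; case: ifP => tT; last by rewrite subrr normr0 mul0r.
  apply: le_trans (HL _ _ _ _ t0 _ _ _) _; rewrite ?clamp_norm ?ur ?t0 //.
  by rewrite ler_wpM2l ?clamp_lip //; have [] := LM0 t t0.
- move=> t t0; rewrite /F /M1; case: ifP => tT; last by rewrite normr0.
  by apply: HM => //; [rewrite clamp_norm|rewrite ur // t0].
have xs : x s = c by rewrite xE // subrr addr0.
have xr t : 0 <= t <= T -> `|x t| <= r.
  move=> tT; rewrite le_max; apply/orP; right; rewrite -xs.
  apply: (HC _ _ x (fun t => F t (x t)) l acx Fl li) => //.
  - by move=> t' /andP[t'0 _]; exact: l0.
  - by move=> t' /andP[t'0 _]; rewrite {1}xE // xs.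
  - move=> t' /[dup] t'T /andP[t'0 t'leT]; rewrite /F t'leT.
    apply: le_trans (lH _ _ _ t'0 (ur _ t'T)) _.
    rewrite mulrDr mulr1 addrC lerD2r ler_wpM2l ?l0 //.
    by have := clamp_lip (x t') 0 r0; rewrite clamp0 !subr0.
exists x; split => //; split => // t /andP[t0 tT].
have E t' : 0 <= t' <= T -> mprim (fun t => f t (x t) (u t)) t' = mprim (fun t => F t (x t)) t'.
  move=> /andP[t'0 t'T]; apply: eq_mprim => q /andP[q0 qt].
  have qT : q <= T by exact: le_trans t'T.
  by rewrite /F qT clamp_id // xr // q0.
by rewrite !E // ?t0 // xs; exact: xE.
Qed.

End existence.

Section flow.
Context {R : realType} {m k : nat}.
Variables (f : R -> 'cV[R]_m -> 'cV[R]_k -> 'cV[R]_m) (g : R -> 'cV[R]_m -> 'cV[R]_k -> R).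
Hypothesis reg : regularity_conditions f g.
Variables (u0 : R -> 'cV[R]_k) (x_init : 'cV[R]_m).
Variables (x_ : 'cV[R]_m -> R -> 'cV[R]_m) (A_ : 'cV[R]_m -> R -> 'M[R]_m).
Hypothesis cu0 : control u0.
Hypothesis x_sol : forall xi : 'cV[R]_m, trajectory f (x_init + xi) u0 (x_ xi).
Hypothesis A_sol : forall xi, fundamental_matrix f u0 (x_ xi) (A_ xi).

Let acx xi : forall T, 0 <= T -> abs_continuous T (x_ xi).
Proof. by have [[ac _] _] := x_sol xi. Qed.

Let acA xi : forall T, 0 <= T -> abs_continuous T (A_ xi).
Proof. by have [[ac _] _] := A_sol xi. Qed.

Let x_0 xi : x_ xi 0 = x_init + xi. Proof. by have [_] := x_sol xi. Qed.

Lemma flow_unique c x t : trajectory f (x_init + c) u0 x -> 0 <= t -> x t = x_ c t.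
Proof.
move=> tx t0; have [_ lu] := cu0; have [rho ur] := lu t t0.
have acx' := trajectory_ac tx.
have [r r0 xr] := ac_bounded t0 (acx' t t0).
have [r' r'0 xr'] := ac_bounded t0 (acx c t0).
have [C C0 HC] := arc_lipschitz reg rho (Num.max r r') t0 (or_introl (erefl (0:R))).
have := HC u0 x (x_ c) cu0 ur (trajectory_arc reg t cu0 tx (lexx _))
  (trajectory_arc reg t cu0 (x_sol c) (lexx _)) _ _ t.
have [_ ->] := tx; rewrite x_0 subrr normr0 mulr0 t0 lexx normr_le0 subr_eq0.
move=> H; apply/eqP; apply: H => // t' t'T; rewrite le_max; first by rewrite xr.
by rewrite xr' ?orbT.
Qed.

Lemma flow_bound T : 0 <= T -> exists2 r : R, 0 <= r &
  forall xi t, `|xi| <= 1 -> 0 <= t <= T -> `|x_ xi t| <= r.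
Proof.
move=> T0; have [_ lu] := cu0; have [rho ur] := lu T T0.
have [r r0 H] := arc_bound reg rho (`|x_init| + 1) T0 (or_introl (erefl (0:R))).
exists r => // xi t xi1 tT; apply: (H u0 (x_ xi) cu0 ur) => //.
  exact: (trajectory_arc reg T cu0 (x_sol xi)).
by rewrite x_0 (le_trans (ler_normD _ _)) // lerD2l.
Qed.

Lemma flow_lipschitz T : 0 <= T -> exists2 C : R, 0 <= C &
  forall xi zeta t, `|xi| <= 1 -> `|zeta| <= 1 -> 0 <= t <= T ->
    `|x_ xi t - x_ zeta t| <= C * `|xi - zeta|.
Proof.
move=> T0; have [_ lu] := cu0; have [rho ur] := lu T T0.
have [r r0 xr] := flow_bound T0.
have [C C0 HC] := arc_lipschitz reg rho r T0 (or_introl (erefl (0:R))).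
exists C => // xi zeta t xi1 ze1 tT.
have := HC u0 (x_ xi) (x_ zeta) cu0 ur (trajectory_arc reg T cu0 (x_sol _) (lexx _))
  (trajectory_arc reg T cu0 (x_sol _) (lexx _)) _ _ t tT.
rewrite !x_0 opprD addrACA subrr add0r; apply => t' t'T; exact: xr.
Qed.

(** The remainder solves the linearized equation with initial value 0 and a source quadratic in [h],
    so Gronwall bounds it. The constant depends on [T] but not on [xi]. *)
Lemma flow_taylor T : 0 <= T -> exists2 C : R, 0 <= C &
  forall xi h t, `|xi| <= 1 -> `|xi + h| <= 1 -> 0 <= t <= T ->
    `|x_ (xi + h) t - x_ xi t - A_ xi t *m h| <= C * `|h| ^+ 2.
Proof.
move=> T0; have [_ lu] := cu0; have [rho ur] := lu T T0.
have [r r0 xr] := flow_bound T0; have [C C0 xC] := flow_lipschitz T0.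
case: (reg) => df [rf _] [rdf _] _.
have [L [M [[Li Mi] LM0 HL HM]]] := regular_box r rho (@norm_le_enorm R _ _) rdf.
have mMi : loc_integrable (fun t => m%:R * M t) by exact: loc_integrableZ.
have mM0 t : 0 <= t -> 0 <= m%:R * M t by move=> /LM0[_ ?]; exact: mulr_ge0.
have [D D0 HD] := mx_gronwall mMi mM0 T0 (or_introl (erefl (0:R))).
exists (D * (m%:R * C ^+ 2 * prim L T)).
  rewrite mulr_ge0 // mulr_ge0 ?mulr_ge0 ?exprn_ge0 //.
  by apply: prim_ge0 => // t /andP[/LM0[]].
move=> xi h t xi1 xih1 tT.
have hx t' : 0 <= t' <= T -> `|x_ (xi + h) t' - x_ xi t'| <= C * `|h|.
  by move=> t'T; have := xC (xi + h) xi t' xih1 xi1 t'T; rewrite addrAC subrr add0r.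
pose z t := x_ (xi + h) t - x_ xi t - A_ xi t *m h.
pose v t := f t (x_ (xi + h) t) (u0 t) - f t (x_ xi t) (u0 t) - dfdx f t (x_ xi t) (u0 t) *m A_ xi t *m h.
have sz : solves z v.
  apply: solvesB; first by apply: solvesB; [case: (x_sol (xi + h))|case: (x_sol xi)].
  have [sA _] := A_sol xi; apply: solves_ext (solves_mulmx sA (solves_cst h)) => //.
  by apply: aeW => s _; rewrite mulmx0 addr0.
have ach : forall T, 0 <= T -> abs_continuous T (fun _ : R => h) by have [ac _] := solves_cst h; exact: ac.
have vl : mloc v.
  apply: mlocB; first by apply: mlocB; apply: (f_mloc reg) => //; exact: acx.
  apply: mloc_mulr => //; apply: mloc_mulr; last exact: acA.
  by apply: (dfdx_mloc reg) => //; exact: acx.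
have z0 : z 0 = 0.
  have [_ A0] := A_sol xi.
  by rewrite /z !x_0 A0 mul1mx [x_init + (xi + h)]addrA [x_init + xi + h]addrC addrK subrr.
pose b t := m%:R * (C * `|h|) ^+ 2 * L t.
have bi : loc_integrable b by exact: loc_integrableZ.
have := HD _ _ z v b _ vl bi _ _ _ t tT; rewrite z0 normr0 add0r primZ // => H.
have -> : D * (m%:R * C ^+ 2 * prim L T) * `|h| ^+ 2 = D * (m%:R * (C * `|h|) ^+ 2 * prim L T).
  by ring.
apply: H.
- by case: sz.
- move=> t' /andP[/LM0[L0 _] _]; by rewrite /b !mulr_ge0 // exprn_ge0 // mulr_ge0.
- move=> t' /andP[t'0 _]; rewrite add0r (mx_solves_prim sz vl t'0) z0 add0r.
  by rewrite (mprim0 vl) subr0.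
- move=> t' /[dup] t'T /andP[t'0 _]; have [L0 M0] := LM0 t' t'0.
  (* Inserting the linearization along the true difference of the trajectories separates the Taylor
     remainder of [f] from a term linear in [z]. *)
  have -> : v t' = (f t' (x_ (xi + h) t') (u0 t') - f t' (x_ xi t') (u0 t')
      - dfdx f t' (x_ xi t') (u0 t') *m (x_ (xi + h) t' - x_ xi t'))
      + dfdx f t' (x_ xi t') (u0 t') *m z t'.
    by rewrite /z [X in _ = _ + X]mulmxBr mulmxA addrA subrK.
  rewrite addrC; apply: le_trans (ler_normD _ _) _; apply: lerD.
    apply: le_trans (mx_norm_mul _ _) _; rewrite ler_wpM2r // ler_wpM2l //.
    by apply: HM => //; [exact: xr|exact: ur].
  have := @jacobian_remainder R m m (fun y => f t' y (u0 t')) r (L t') (x_ xi t') (x_ (xi + h) t').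
  move=> /(_ _ _ L0 (xr _ _ xi1 t'T) (xr _ _ xih1 t'T)) H'.
  apply: le_trans (H' _ _) _.
  + by move=> y; have [] := df t' y (u0 t') t'0.
  + by move=> y w yr wr; apply: HL => //; exact: ur.
  + rewrite /b mulrAC ler_wpM2r // ler_wpM2l // lerXn2r ?nnegrE ?mulr_ge0 //.
    exact: hx.
Qed.

Lemma dg_along_mloc xi : mloc (dg_along g u0 (x_ xi) (A_ xi)).
Proof.
by apply: mloc_mulr; [apply: (dgdx_mloc reg) => //; exact: acx|exact: acA].
Qed.

Lemma int_vec_mprim n (h : R -> 'rV[R]_n) T : int_vec h 0 T = mprim h T.
Proof. by apply/matrixP => i j; rewrite !mxE ord1. Qed.

Definition cost xi T := prim (fun t => g t (x_ xi t) (u0 t)) T.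

(** This identifies $I_\xi(T)$ as the derivative of the cost in $\xi$. The constant depends on [T],
    so the estimate is used at one horizon at a time; uniformity at large times has to come from the
    joint limit. *)
Lemma cost_taylor T : 0 <= T -> exists2 C : R, 0 <= C &
  forall xi h, `|xi| <= 1 -> `|xi + h| <= 1 ->
    `|cost (xi + h) T - cost xi T - (mprim (dg_along g u0 (x_ xi) (A_ xi)) T *m h) 0 0|
      <= C * `|h| ^+ 2.
Proof.
move=> T0; have [_ lu] := cu0; have [rho ur] := lu T T0.
have [r r0 xr] := flow_bound T0; have [C C0 xC] := flow_lipschitz T0.
have [D D0 xD] := flow_taylor T0.
case: (reg) => df [_ rg] [_ rdg] _.
have [L [M [[Li Mi] LM0 HL HM]]] := regular_box r rho (@norm_le_enorm R _ _) rdg.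
pose B t := m%:R * C ^+ 2 * L t + m%:R * D * M t.
have Bi : loc_integrable B by apply: loc_integrableD; exact: loc_integrableZ.
exists (prim B T).
  apply: prim_ge0 => // t /andP[/LM0[L0 M0] _].
  by rewrite addr_ge0 // !mulr_ge0 // exprn_ge0.
move=> xi h xi1 xih1.
pose G t := dg_along g u0 (x_ xi) (A_ xi) t.
have Gl : mloc G by exact: dg_along_mloc.
have Ghl : loc_integrable (fun t => (G t *m h) 0 0).
  have ach : forall T, 0 <= T -> abs_continuous T (fun _ : R => h) by have [ac _] := solves_cst h; exact: ac.
  exact: mloc_mulr Gl ach 0 0.
have gl xi' : loc_integrable (fun t => g t (x_ xi' t) (u0 t)).
  by apply: (g_loc reg) => //; exact: acx.
have -> : (mprim G T *m h) 0 0 = prim (fun t => (G t *m h) 0 0) T.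
  rewrite !mxE [RHS](_ : _ = prim (fun t => \sum_j h j 0 * G t 0 j) T); last first.
    by apply: eq_prim => t _; rewrite !mxE; apply: eq_bigr => j _; rewrite mulrC.
  rewrite prim_sum //; last by move=> j _; apply: loc_integrableZ; exact: Gl.
  by apply: eq_bigr => j _; rewrite primZ // mxE mulrC.
rewrite /cost -!primB_fun //; last exact: loc_integrableB.
rewrite mulrC -primZ //.
have l1 := loc_integrableB (loc_integrableB (gl (xi + h)) (gl xi)) Ghl.
have l2 := loc_integrableZ (`|h| ^+ 2) Bi.
have := @prim_dom _ _ _ 0 T l1 l2; rewrite lexx T0 => /(_ isT).
rewrite (prim0 l1) (prim0 l2) !subr0; apply => t tT.
have /andP[t0 _] := tT; have [L0 M0] := LM0 t t0.
set x1 := x_ (xi + h) t; set x0 := x_ xi t.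
have -> : g t x1 (u0 t) - g t x0 (u0 t) - (G t *m h) 0 0 =
  (g t x1 (u0 t) - g t x0 (u0 t) - (dgdx g t x0 (u0 t) *m (x1 - x0)) 0 0) +
  (dgdx g t x0 (u0 t) *m (x1 - x0 - A_ xi t *m h)) 0 0.
  have -> : (dgdx g t x0 (u0 t) *m (x1 - x0 - A_ xi t *m h)) 0 0 =
      (dgdx g t x0 (u0 t) *m (x1 - x0)) 0 0 - (G t *m h) 0 0.
    by rewrite mulmxBr /G /dg_along -mulmxA [LHS]mxE [X in _ + X]mxE.
  ring.
apply: le_trans (ler_normD _ _) _.
have x1r : `|x1| <= r by exact: xr.
have x0r : `|x0| <= r by exact: xr.
have urt : `|u0 t| <= rho by exact: ur.
have H1 : `|g t x1 (u0 t) - g t x0 (u0 t) - (dgdx g t x0 (u0 t) *m (x1 - x0)) 0 0|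
    <= m%:R * L t * `|x1 - x0| ^+ 2.
  apply: (@taylor_remainder _ _ (fun y => g t y (u0 t)) (fun y => dgdx g t y (u0 t)) r) => //.
    by move=> z w; apply: is_derive_gradient; have [] := df t z (u0 t) t0.
  by move=> z w zr wr; apply: HL.
have H2 : `|x1 - x0| <= C * `|h|.
  by have := xC (xi + h) xi t xih1 xi1 tT; rewrite addrAC subrr add0r.
have H3 : `|(dgdx g t x0 (u0 t) *m (x1 - x0 - A_ xi t *m h)) 0 0| <= m%:R * M t * (D * `|h| ^+ 2).
  apply: le_trans (mx_entry_le _ _ _) _; apply: le_trans (mx_norm_mul _ _) _.
  apply: ler_pM; rewrite ?mulr_ge0 //; last exact: xD.
  by rewrite ler_wpM2l // HM.
apply: le_trans (lerD H1 H3) _.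
have -> : `|h| ^+ 2 * B t = m%:R * L t * (C * `|h|) ^+ 2 + m%:R * M t * (D * `|h| ^+ 2).
  by rewrite /B; ring.
rewrite lerD2r ler_wpM2l ?mulr_ge0 // lerXn2r ?nnegrE ?mulr_ge0 //.
Qed.

End flow.

(** * Perturbed initial states at large times *)

Section cost_limit.
Context {R : realType} {m k : nat}.
Variables (f : R -> 'cV[R]_m -> 'cV[R]_k -> 'cV[R]_m) (g : R -> 'cV[R]_m -> 'cV[R]_k -> R).
Hypothesis reg : regularity_conditions f g.
Variables (u0 : R -> 'cV[R]_k) (x_init : 'cV[R]_m).
Variables (x_ : 'cV[R]_m -> R -> 'cV[R]_m) (A_ : 'cV[R]_m -> R -> 'M[R]_m).
Hypothesis cu0 : control u0.
Hypothesis x_sol : forall xi : 'cV[R]_m, trajectory f (x_init + xi) u0 (x_ xi).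
Hypothesis A_sol : forall xi, fundamental_matrix f u0 (x_ xi) (A_ xi).

Notation J := (cost g u0 x_).
Notation I_ xi T := (mprim (dg_along g u0 (x_ xi) (A_ xi)) T).

(** An exact formula, free of constants that depend on [T]. The radius 1/2 keeps $s\xi$ in the unit
    ball for $|s| \le 2$, which gives two-sided derivatives at both ends of [0, 1]. *)
Lemma cost_mvt T (xi : 'cV[R]_m) : 0 <= T -> `|xi| <= 2^-1 ->
  exists2 c : R, 0 <= c <= 1 & J xi T - J 0 T = (I_ (c *: xi) T *m xi) 0 0.
Proof.
move=> T0 xi2; have [C C0 HC] := cost_taylor reg cu0 x_sol A_sol T0.
pose phi s := J (s *: xi) T.
have sm (s : R) : `|s| <= 2 -> `|s *: xi| <= 1.
  by move=> s2; rewrite normrZ; have := normr_ge0 xi; have := normr_ge0 s; nra.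
have dphi (s : R) : 0 <= s <= 1 -> is_derive s (1 : R) phi ((I_ (s *: xi) T *m xi) 0 0).
  move=> /andP[s0 s1]; apply: (@bound_is_derive R R) => e e0.
  exists (Num.min 1 (e / (C + 1))); first by rewrite lt_min ltr01 divr_gt0 // ltr_wpDl.
  move=> r; rewrite lt_min => /andP[rs1 rse].
  have := HC (s *: xi) ((r - s) *: xi); rewrite -scalerDl addrC subrK => H.
  have {}H : `|phi r - phi s - (r - s) *: (I_ (s *: xi) T *m xi) 0 0| <= C * `|(r - s) *: xi| ^+ 2.
    have E : (I_ (s *: xi) T *m ((r - s) *: xi)) 0 0 = (r - s) *: (I_ (s *: xi) T *m xi) 0 0.
      by rewrite -scalemxAr mxE.
    rewrite -E; apply: H; apply: sm; first by rewrite ger0_norm //; lra.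
    by move: rs1; rewrite ltr_norml ler_norml => /andP[? ?]; apply/andP; split; lra.
  apply: le_trans H _; rewrite normrZ exprMn.
  have h1 : `|r - s| * (C + 1) <= e by rewrite -ler_pdivlMr ?ltW // ltr_wpDl.
  have h2 : `|xi| ^+ 2 <= 1 by rewrite expr_le1 // (le_trans xi2) // invf_le1 // ler1n.
  have := normr_ge0 (r - s); have := sqr_ge0 `|xi|.
  move: h1 h2; set a := `|r - s|; set b := `|xi| ^+ 2 => h1 h2 b0 a0.
  apply: le_trans (_ : a * (a * (C + 1)) <= _).
    have aa := mulr_ge0 a0 a0; have b1 : 0 <= 1 - b by lra.
    have := mulr_ge0 b1 (mulr_ge0 C0 aa); rewrite expr2; lra.
  by rewrite [e * _]mulrC ler_wpM2l.
have [||c] := @MVT_segment R phi (fun s => (I_ (s *: xi) T *m xi) 0 0) 0 1 ler01.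
- by move=> s; rewrite in_itv/= => /andP[s0 s1]; apply: dphi; rewrite !ltW.
- apply: derivable_within_continuous => s; rewrite in_itv/= => sI.
  by have [] := dphi s sI.
rewrite in_itv/= => cI E; exists c => //.
by move: E; rewrite /phi scale1r scale0r subr0 mulr1.
Qed.

(** The intermediate point $c\,\xi$ of the mean value formula varies with [T] in an uncontrolled
    way; the joint limit is insensitive to this and yields a bound uniform in large [T]. *)
Lemma cost_limit (l : 'rV[R]_m) :
  (fun z : 'cV[R]_m * R => int_vec (dg_along g u0 (x_ z.1) (A_ z.1)) 0 z.2)
    @ (nbhs (0 : 'cV[R]_m), +oo) --> l ->
  forall e : R, 0 < e -> exists d S : R, [/\ 0 < d, 0 <= S &
    (forall (xi : 'cV[R]_m) T, `|xi| < d -> S < T -> `|I_ xi T - l| <= e) /\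
    forall (xi : 'cV[R]_m) T, `|xi| < d -> S < T ->
      `|J xi T - J 0 T - (l *m xi) 0 0| <= e * `|xi|].
Proof.
move=> L e e0.
(* The denominator compensates the factor [m] of [mx_norm_mul]; the added unit covers [m = 0]. *)
have e1 : 0 < e / (m%:R + 1) by rewrite divr_gt0 // ltr_wpDl.
have me : m%:R * (e / (m%:R + 1)) <= e.
  rewrite mulrCA -[leRHS]mulr1 ler_pM2l // ler_pdivrMr ?ltr_wpDl // mul1r.
  by rewrite lerDl.
have e1e : e / (m%:R + 1) <= e.
  by rewrite ler_pdivrMr ?ltr_wpDl // ler_peMr ?lerDr //; exact: ltW.
have [[P Q] /= [P0 [S [_ QS]]] PQ] := (@cvgrPdist_le _ _ _ _ _ _ _).1 L _ e1.
have [d /= d0 Pd] := (nbhs_ballP _ _).1 P0.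
have H xi T : `|xi| < d -> S < T -> `|I_ xi T - l| <= e / (m%:R + 1).
  move=> xid ST; rewrite distrC -int_vec_mprim; apply: (PQ (xi, T)); split => /=.
    by apply: Pd; rewrite -ball_normE /= sub0r normrN.
  exact: QS.
exists (Num.min d 2^-1), `|S|; split => //.
  by rewrite lt_min d0 invr_gt0 ltr0n.
have SS T : `|S| < T -> S < T by apply: le_lt_trans; exact: ler_norm.
split=> xi T; rewrite lt_min => /andP[xid xi2] /[dup] ST /SS ST'.
  by apply: le_trans e1e; exact: H.
have T0 : 0 <= T by apply: ltW; apply: le_lt_trans ST.
have [c /andP[c0 c1] ->] := cost_mvt T0 (ltW xi2).
have -> : (I_ (c *: xi) T *m xi) 0 0 - (l *m xi) 0 0 = ((I_ (c *: xi) T - l) *m xi) 0 0.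
  by rewrite mulmxBl !mxE.
apply: le_trans (mx_entry_le _ _ _) _; apply: le_trans (mx_norm_mul _ _) _.
rewrite ler_wpM2r //; apply: le_trans me; rewrite ler_wpM2l //; apply: H => //.
by apply: le_lt_trans xid; rewrite normrZ ger0_norm // ler_piMl.
Qed.

End cost_limit.

(** * Analytic sets and measurable selection *)

Section analytic_sets.
Context {X : topologicalType}.
Implicit Types (B : set X) (C : nat -> (nat -> nat) -> set X).

(* Souslin operation: [sieve C] is the union over [sigma] of the closed sets
   [\bigcap_n C n sigma], each [C n] being locally constant in [sigma]. *)
Definition sieve C : set X := [set x | exists sigma, forall n, C n sigma x].

Definition agree h (s t : nat -> nat) := forall i, (i < h)%N -> t i = s i.

(** Asking for local constancy, instead of dependence on the first [n] terms, lets sequences be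
    recoded in unions and intersections without realigning the levels. *)
Definition analytic B := exists C, [/\ forall n s, closed (C n s),
  forall n s, exists h, forall t, agree h s t -> C n t = C n s & B = sieve C].

Lemma analytic_closed B : closed B -> analytic B.
Proof.
move=> cB; exists (fun _ _ => B); split => //; first by move=> n s; exists 0%N.
by apply/seteqP; split => x; [move=> Bx; exists (fun=> 0%N)|move=> [s /(_ 0%N)]].
Qed.

(** The first term of the sequence selects a member of the union, the later ones code the point in
    it. *)
Lemma analytic_bigcup (B : nat -> set X) : (forall i, analytic (B i)) -> analytic (\bigcup_i B i).
Proof.
move=> /choice[C HC].
exists (fun n s => C (s 0%N) n (fun j => s j.+1)); split.
- by move=> n s; have [cl _ _] := HC (s 0%N).
- move=> n s; have [_ /(_ n (fun j => s j.+1))[h Hh] _] := HC (s 0%N).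
  exists h.+1 => t st; rewrite (st 0%N) //; apply: Hh => i ih; exact: st.
- apply/seteqP; split => x.
    move=> [i _]; have [_ _ ->] := HC i; move=> [s Hs].
    by exists (fun j => if j is j'.+1 then s j' else i).
  move=> [s Hs]; exists (s 0%N) => //; have [_ _ ->] := HC (s 0%N).
  by exists (fun j => s j.+1).
Qed.

(** Through a pairing of the integers one sequence stores a code for every member of the
    intersection, and the same pairing lists the conditions. *)
Lemma analytic_bigcap (B : nat -> set X) : (forall i, analytic (B i)) -> analytic (\bigcap_i B i).
Proof.
move=> /choice[C HC].
pose dec c : nat * nat := odflt (0, 0)%N (unpickle c).
have decK i j : dec (pickle (i, j)) = (i, j) by rewrite /dec pickleK.
exists (fun c s => C (dec c).1 (dec c).2 (fun j => s (pickle ((dec c).1, j)))); split.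
- by move=> c s; have [cl _ _] := HC (dec c).1.
- move=> c s; have [_ /(_ (dec c).2 (fun j => s (pickle ((dec c).1, j))))[h Hh] _] := HC (dec c).1.
  (* The terms read at level [c] sit at paired positions, so the prefix must extend beyond the
     largest of these. *)
  exists (\max_(j < h) (pickle ((dec c).1, val j)).+1) => t st; apply: Hh => i ih.
  apply: st; apply: (leq_trans _ (leq_bigmax (Ordinal ih))) => //.
- apply/seteqP; split => x.
    move=> Bx; have /choice[s Hs] : forall i, exists s, forall n, C i n s x.
      by move=> i; have := Bx i I; have [_ _ ->] := HC i.
    exists (fun c => s (dec c).1 (dec c).2) => c.
    by have := Hs (dec c).1 (dec c).2; congr (C _ _ _ x); apply/funext => j; rewrite decK.
  move=> [s Hs] i _; have [_ _ ->] := HC i.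
  exists (fun j => s (pickle (i, j))) => n; have := Hs (pickle (i, n)).
  by rewrite !decK.
Qed.

End analytic_sets.

(** The points not within $1/(n+1)$ of the complement form a closed set, and these sets exhaust an
    open set. *)
Lemma open_Fsigma {R : realType} (V : normedModType R) (B : set V) : open B ->
  exists2 F : nat -> set V, (forall n, closed (F n)) & B = \bigcup_n F n.
Proof.
move=> oB; exists (fun n => ~` \bigcup_(y in ~` B) ball y n.+1%:R^-1).
  move=> n; apply: open_closedC; apply: bigcup_open => y _.
  by apply: ball_open; rewrite invr_gt0.
apply/seteqP; split => x.
  move=> Bx; have /nbhs_ballP[e /= e0 xe] : nbhs x B by exact: open_nbhs_nbhs.
  have [n _ /(_ n (leqnn n)) Hn] := near_infty_natSinv_lt (PosNum e0).
  exists n => // -[y nBy /= yx]; apply: nBy; apply: xe; apply: ball_sym.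
  by apply: le_ball yx; rewrite ltW.
move=> [n _ nx]; apply: contrapT => nBx; apply: nx; exists x => //.
by apply: ballxx; rewrite invr_gt0.
Qed.

(** The sets that are analytic together with their complement form a sigma-algebra containing the
    open sets. The complement is carried along because analytic sets alone are not stable under
    it. *)
Lemma borel_analytic {R : realType} (V : normedModType R) (B : set V) :
  <<s (@open V) >> B -> analytic B.
Proof.
suff H : <<s (@open V) >> B -> analytic B /\ analytic (~` B) by move=> /H[].
move: B; apply: smallest_sub.
  split => /=.
  - by split; apply: analytic_closed; rewrite ?setC0; [exact: closed0|exact: closedT].
  - by move=> A [aA aCA]; rewrite setTD setCK.
  - move=> A HA; split; first by apply: analytic_bigcup => i; have [] := HA i.
    by rewrite setC_bigcup; apply: analytic_bigcap => i; have [] := HA i.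
move=> B oB; split; last by apply: analytic_closed; exact: open_closedC.
have [F cF ->] := open_Fsigma oB.
by apply: analytic_bigcup => n; exact: analytic_closed.
Qed.

Section capacitability.
Context {R : realType}.
Notation mu := (@lebesgue_measure R).
Notation mue := (@wlength R idfun)^*%mu.

(** Measurable hulls [G n] of the sets need not increase, but the intersections [H n] of their tails
    do; they still contain [E n] and are no larger in measure than the hulls. *)
Lemma outer_measure_increasing (E : nat -> set R) (c : \bar R) :
  {homo E : i j / (i <= j)%N >-> i `<=` j} -> (c < mue (\bigcup_n E n))%E ->
  exists n, (c < mue (E n))%E.
Proof.
move=> Ei cE; apply: contrapT => nE.
have Ec n : (mue (E n) <= c)%E.
  by rewrite leNgt; apply/negP => h; apply: nE; exists n.
have /choice[G HG] : forall n, exists G : set R, [/\ measurable G, E n `<=` G & (mu G <= mue (E n))%E].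
  move=> n; have [G [GG EG Gmu]] := outer_measure_Gdelta (E n).
  exists (\bigcap_i G i); split => //.
    by apply: bigcapT_measurable => i; exact: open_measurable.
  by move: Gmu => /= ->.
pose H n := \bigcap_(j in [set j | (n <= j)%N]) G j.
have mH n : measurable (H n) by apply: bigcap_measurable => [|j _]; [exists n => /=|have [] := HG j].
have EH n : E n `<=` H n.
  by move=> x Ex j /= nj; have [_ EG _] := HG j; apply: EG; exact: Ei Ex.
have Hi : nondecreasing_seq H.
  by move=> i j ij; apply/subsetPset => x Hx l /= jl; apply: Hx => /=; exact: leq_trans jl.
have Hc n : (mu (H n) <= c)%E.
  apply: le_trans (Ec n); have [mG _ le] := HG n; apply: le_trans le.
  apply: le_measure; rewrite ?inE; [exact: mH|exact: mG|].
  by move=> x Hx; apply: Hx => /=; exact: leqnn.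
have mUH : measurable (\bigcup_n H n) by exact: bigcupT_measurable.
have cvH := nondecreasing_cvg_mu (mu := mu) mH mUH Hi.
have UHc : (mu (\bigcup_n H n) <= c)%E.
  have <- := cvg_lim (@ereal_hausdorff R) cvH.
  by apply: lime_le; [apply/cvg_ex; eexists; exact: cvH|apply: nearW => n; exact: Hc].
have : (mue (\bigcup_n E n) <= mu (\bigcup_n H n))%E.
  by apply: le_outer_measure => x [n _ /EH Hx]; exists n.
by move=> /le_trans/(_ UHc); rewrite leNgt cE.
Qed.

Lemma agree_nbhs (h : nat) (s : nat -> nat) :
  nbhs (s : prod_topology (fun _ : nat => nat)) (agree h s).
Proof.
elim: h => [|h IH]; first by apply: filterS (@filterT _ _ (nbhs_filter _)) => t _ i.
have ds : nbhs (s h) [set s h] by exact: discrete_set1.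
have := @filterI _ _ (nbhs_filter (s : prod_topology (fun _ : nat => nat))) _ _ IH
  (@proj_continuous _ (fun=> nat) h s [set s h] ds).
apply: filterS => t [st /= sh] i.
by rewrite ltnS leq_eqVlt => /predU1P[->|]; [exact: sh|exact: st].
Qed.

Lemma compact_bounded_sequences (b : nat -> nat) :
  compact [set s : prod_topology (fun _ : nat => nat) | forall i, (s i <= b i)%N].
Proof.
apply: (@tychonoff _ (fun=> nat) (fun i => [set j | (j <= b i)%N])) => i.
apply: finite_compact; apply: sub_finite_set (finite_II (b i).+1) => j /=.
by rewrite ltnS.
Qed.

Variable V : normedModType R.
Implicit Types B Q K : set (R * V)%type.

(** Choquet's argument. Continuity of the outer measure along increasing sets allows the terms of
    the codes to be bounded one after another while the projection keeps outer measure above [c].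
    The points with a code below the resulting sequence form a compact set. *)
Lemma analytic_capacity B Q (c : R) : compact Q -> B `<=` Q -> analytic B ->
  (c%:E < mue (fst @` B))%E ->
  exists K, [/\ compact K, K `<=` B & (c%:E <= mu (fst @` K))%E].
Proof.
move=> cQ BQ [C [clC locC BC]] cB.
(* Bounding only a prefix of the code leaves the next bound free to be chosen. *)
pose D n (b : nat -> nat) := fst @` [set x | exists s, (forall i, (i < n)%N -> (s i <= b i)%N) /\
   forall j, C j s x].
have D_ext n b b' : (forall i, (i < n)%N -> b i = b' i) -> D n b `<=` D n b'.
  move=> bb' _ [x [s [sb Cs]] <-]; exists x => //; exists s; split => // i ni.
  by rewrite -bb' // sb.
have step n b : (c%:E < mue (D n b))%E ->
    exists j, (c%:E < mue (D n.+1 (fun i => if i == n then j else b i)))%E.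
  move=> cD; apply: outer_measure_increasing.
    move=> i j ij _ [x [s [sb Cs]] <-]; exists x => //; exists s; split => // l ln.
    have := sb l ln; case: eqP => // _ /leq_trans; exact.
  apply: lt_le_trans cD _; apply: le_outer_measure => _ [x [s [sb Cs]] <-].
  exists (s n) => //; exists x => //; exists s; split => // l ln.
  case: eqP => [->//|/eqP lnn]; apply: sb.
  by rewrite ltn_neqAle lnn -ltnS.
(* Each stage of the recursion alters only the newest bound, so the diagonal sequence agrees with
   stage [n] on its first [n] terms. *)
have [S [S0 HS]] : exists S : nat -> nat -> nat,
    (forall n, (c%:E < mue (D n (S n)))%E) /\
    forall n i, (i < n)%N -> S n.+1 i = S n i.
  have D0 : (c%:E < mue (D 0%N (fun=> 0%N)))%E.
    apply: lt_le_trans cB _; apply: le_outer_measure => _ [x Bx <-]; exists x => //.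
    by move: Bx; rewrite BC => -[s Hs]; exists s.
  pose T n := {b : nat -> nat | (c%:E < mue (D n b))%E : Prop}.
  have /choice[nx Hnx] : forall p : {n : nat & T n}, exists j,
      (c%:E < mue (D (projT1 p).+1 (fun i => if i == projT1 p then j else sval (projT2 p) i)))%E.
    by move=> [n [b /= H]]; exact: step.
  pose W0 : T 0%N := exist (fun b => (c%:E < mue (D 0%N b))%E : Prop) (fun=> 0%N) D0.
  pose Wn (p : {n : nat & T n}) : T (projT1 p).+1 :=
    exist (fun b => (c%:E < mue (D (projT1 p).+1 b))%E : Prop)
      (fun i => if i == projT1 p then nx p else sval (projT2 p) i) (Hnx p).
  pose W := fix W n : T n := if n is n'.+1 then
      Wn (existT _ n' (W n')) else W0.
  exists (fun n => sval (W n)); split; first by move=> n; exact: (svalP (W n)).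
  by move=> n i ni /=; case: eqP => // iE; rewrite iE ltnn in ni.
pose b i := S i.+1 i.
have Sb n i : (i < n)%N -> S n i = b i.
  elim: n => // n IH; rewrite ltnS leq_eqVlt => /predU1P[->//|ni].
  by rewrite HS // IH.
have Db n : (c%:E < mue (D n b))%E.
  apply: lt_le_trans (S0 n) _; apply: le_outer_measure.
  by apply: D_ext => i /Sb.
pose X := (R * V)%type.
pose Sq := prod_topology (fun _ : nat => nat).
pose cQS := compact_setX cQ (@compact_bounded_sequences b).
pose K' : set (X * Sq) := [set z | Q z.1 /\ (forall i, (z.2 i <= b i)%N) /\ forall j, C j z.2 z.1].
(* If [C j] failed at the cluster point, it would fail on an open set of points and for all codes
   sharing a long enough prefix with that of [z]. *)
have clus (F : set_system (X * Sq)) (z : X * Sq) : ProperFilter F -> cluster F z ->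
    (forall j h, F [set w | exists2 s, agree h w.2 s & C j s w.1]) -> forall j, C j z.2 z.1.
  move=> PF cz H j; apply: contrapT => nC.
  have [h Hh] := locC j z.2.
  have N1 : nbhs z.1 (~` C j z.2) by apply: open_nbhs_nbhs; split => //; exact: closed_openC.
  have N2 := agree_nbhs h z.2.
  have [w [[s ws Cs] [/= w1 w2]]] := cz _ _ (H j h) (ex_intro2 _ _ (_, _) (conj N1 N2) (fun _ => id)).
  apply: w1; rewrite -(Hh s) // => i ih.
  by rewrite (ws i ih) (w2 i ih).
have cK' : compact K'.
  move=> F PF FK.
  have [z [[Qz zb] cz]] := cQS F PF (filterS (fun w => fun Hw : K' w => conj Hw.1 Hw.2.1) FK).
  exists z; split => //; split => //; split => //.
  by apply: (clus F) => // j h; apply: filterS FK => w [_ [_ Cw]]; exists w.2.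
exists (fst @` K'); split.
- apply: continuous_compact => //; apply: continuous_subspaceT => z; exact: cvg_fst.
- by move=> _ [z [_ [_ Cz]] <-]; rewrite BC; exists z.2.
have cK : compact (fst @` (fst @` K')).
  apply: continuous_compact; first by apply: continuous_subspaceT => z; exact: cvg_fst.
  by apply: continuous_compact => //; apply: continuous_subspaceT => z; exact: cvg_fst.
have mK : measurable (fst @` (fst @` K') : set R) by exact: compact_measurable.
apply/lee_addgt0Pr => e e0.
have [ W [oO KO Oe]] := lebesgue_regularity_outer mK (compact_finite_measure cK) e0.
have mO : measurable W by exact: open_measurable.
have mOK : (mu W <= mu (fst @` (fst @` K')) + e%:E)%E.
  rewrite -(setDUK KO); apply: le_trans (measureU2 _ _ _) _ => //; first exact: measurableD.
  by rewrite leeD2l // ltW.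
apply: le_trans mOK.
(* Outer measure need not be continuous along the decreasing sets [D n b]; instead, an open set
   around the compact projection swallows one of them. *)
suff [n DO] : exists n, D n b `<=` W.
  by apply: ltW; apply: lt_le_trans (Db n) _; by apply: le_outer_measure.
apply: contrapT => nDO.
have /choice[w Hw] : forall n, exists z : X * Sq, [/\ B z.1, (forall i, (i < n)%N -> (z.2 i <= b i)%N),
    forall j, C j z.2 z.1 & ~ W z.1.1].
  move=> n; apply: contrapT => nz; apply: nDO; exists n => _ [x [s [sb Cs]] <-].
  apply: contrapT => nO; apply: nz; exists (x, s); split => //=.
  by rewrite BC; exists s.
(* The codes are cut off after [n] terms to enter the compact product. A cluster point lies in [K'],
   yet is approached by points whose time stays outside the open set [W]. *)
pose w' n : X * Sq := ((w n).1, fun i => if (i < n)%N then (w n).2 i else 0%N).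
have [|z [[Qz zb] cz]] := cQS (w' n @[n --> \oo]) _.
  exists 0%N => // n _; have [Bw wb _ _] := Hw n; split; first exact: BQ.
  by move=> i /=; case: ifP => // /wb.
have Cz : forall j, C j z.2 z.1.
  apply: (clus (w' n @[n --> \oo])) => // j h.
  exists h => // n /= hn; have [_ _ Cw _] := Hw n; exists (w n).2 => //= i ih.
  by rewrite (leq_trans ih hn).
have Oz : W z.1.1 by apply: KO; exists z.1 => //; exists z.
have N1 : nbhs z.1 (fst @^-1` W).
  by apply: (@cvg_fst _ _ (nbhs z.1.1) (nbhs z.1.2)); exact: open_nbhs_nbhs.
have [] := cz (~` [set y : X * Sq | W y.1.1]) [set y : X * Sq | W y.1.1].
- by exists 0%N => // n _ /=; have [] := Hw n.
- exists (fst @^-1` W, setT); first by split; [exact: N1|exact: filterT].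
  by move=> y [].
- by move=> y [].
Qed.

End capacitability.

Section selection.
Context {R : realType} {k : nat}.
Implicit Types (S : R -> set 'cV[R]_k) (C : set 'cV[R]_k).

Definition hit S C : set R := [set t | exists2 p, S t p & C p].

(** The measurability of a multifunction tested on closed sets, a form that survives the successive
    minimizations below. *)
Definition measurable_compacts S := (forall t, compact (S t)) /\
  forall C, closed C -> measurable (hit S C).

Lemma coord_le_closed (j : 'I_k) (c : R) : closed [set p : 'cV[R]_k | p j 0 <= c].
Proof.
rewrite (_ : [set p | _] = (fun p : 'cV[R]_k => p j 0) @^-1` [set r | r <= c]) //.
by apply: closed_comp; [move=> p _; exact: coord_continuous|exact: closed_le].
Qed.

Lemma coord_min S C t (j : 'I_k) : (forall t, compact (S t)) -> closed C -> hit S C t ->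
  exists p, [/\ S t p, C p & forall q, S t q -> C q -> p j 0 <= q j 0].
Proof.
move=> cS cC [p0 Sp0 Cp0].
have cSC : compact (S t `&` C) by apply: compact_closedI.
have [||p] := @compact_EVT_min _ R (fun p : 'cV[R]_k => p j 0) (S t `&` C) _ cSC.
- by exists p0.
- by apply: continuous_subspaceT => p; exact: coord_continuous.
rewrite inE => -[Sp Cp] pmin; exists p; split => // q Sq Cq.
by apply: pmin; rewrite inE.
Qed.

(** Some minimizer lies in [C] exactly when [S t] meets [C] and, for each rational [c], if [S t] has
    a point of coordinate at most [c] then so has its part in [C]. Compactness provides the
    minimizers. *)
Lemma minimize_coord S (j : 'I_k) : measurable_compacts S ->
  measurable_compacts (fun t => [set p | S t p /\ forall q, S t q -> p j 0 <= q j 0]).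
Proof.
move=> [cS mS]; split.
  move=> t; rewrite (_ : [set p | _] = S t `&` \bigcap_(q in S t) [set p : 'cV[R]_k | p j 0 <= q j 0]).
    by apply: compact_closedI => //; apply: closed_bigI => q _; exact: coord_le_closed.
  by apply/seteqP; split => p.
move=> C cC.
pose F (c : rat) := ~` hit S [set q | q j 0 <= ratr c] `|` hit S (C `&` [set p | p j 0 <= ratr c]).
rewrite (_ : hit _ C = hit S C `&` ~` \bigcup_(c : rat) ~` F c); last first.
  apply/seteqP; split => t.
    move=> [p [Sp pmin] Cp]; split; first by exists p.
    move=> [c _]; apply; have [[q Sq qc]|h] := pselect (hit S [set q | q j 0 <= ratr c] t); last by left.
    by right; exists p => //; split => //=; exact: le_trans (pmin q Sq) qc.
  move=> [hC nF]; have [p [Sp Cp pmin]] := coord_min j cS cC hC.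
  exists p => //; split => // q Sq; rewrite leNgt; apply/negP => qp.
  have [c] := rat_in_itvoo qp; rewrite in_itv/= => /andP[qc cp].
  apply: nF; exists c => // -[nh|[p' Sp' [Cp' p'c]]].
    by apply: nh; exists q => //=; exact: ltW.
  by have := le_lt_trans (le_trans (pmin p' Sp' Cp') p'c) cp; rewrite ltxx.
apply: measurableI; first exact: mS.
apply: measurableC; apply: bigcupT_measurable_rat => c; apply: measurableC.
apply: measurableU; first by apply: measurableC; apply: mS; exact: coord_le_closed.
by apply: mS; apply: closedI => //; exact: coord_le_closed.
Qed.

(** Minimizing all coordinates in turn leaves one point in each nonempty fibre, and uniqueness turns
    measurability of the multifunction into measurability of the selection. *)
Lemma compact_selection (K : set (R * 'cV[R]_k)%type) : compact K ->
  exists v : R -> 'cV[R]_k,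
    measurable_fun (fst @` K : set R) (v : R -> g_sigma_algebraType (@open 'cV[R]_k)) /\
    forall t, (fst @` K) t -> K (t, v t).
Proof.
move=> cK; pose S0 t := [set p | K (t, p)].
have clf (t : R) : closed (fst @^-1` [set t] : set (R * 'cV[R]_k)%type).
  by apply: closed_comp; [move=> z _; exact: cvg_fst|exact: closed_eq].
have clsnd C : closed C -> closed (snd @^-1` C : set (R * 'cV[R]_k)%type).
  by move=> cC; apply: closed_comp => // z _; exact: cvg_snd.
have S0good : measurable_compacts S0.
  split=> [t|C cC].
    rewrite (_ : S0 t = snd @` (K `&` fst @^-1` [set t])).
      apply: continuous_compact; last by apply: compact_closedI.
      by apply: continuous_subspaceT => z; exact: cvg_snd.
    apply/seteqP; split => p; first by move=> Kp; exists (t, p).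
    by move=> [[t' p'] [Ktp /= t't] /= <-]; rewrite /S0 /= -t't.
  rewrite (_ : hit S0 C = fst @` (K `&` snd @^-1` C)).
    apply: compact_measurable; apply: continuous_compact.
      by apply: continuous_subspaceT => z; exact: cvg_fst.
    by apply: compact_closedI => //; exact: clsnd.
  apply/seteqP; split => t; first by move=> [p Kp Cp]; exists (t, p).
  by move=> [[t' p] [Kp Cp] /= <-]; exists p.
have [S [Sgood SS0 Sne Suniq]] : exists S, [/\ measurable_compacts S,
    forall t, S t `<=` S0 t, forall t, S0 t !=set0 -> S t !=set0 &
    forall j, j \in enum 'I_k -> forall t p q, S t p -> S t q -> p j 0 = q j 0].
  elim: (enum 'I_k) => [|j js [S [Sgood SS0 Sne Suniq]]]; first by exists S0; split => // t.
  exists (fun t => [set p | S t p /\ forall q, S t q -> p j 0 <= q j 0]); split.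
  - exact: minimize_coord.
  - by move=> t p [Sp _]; exact: SS0.
  - move=> t /Sne[p Sp]; have [|p' [Sp' _ H]] := @coord_min S setT t j Sgood.1 closedT.
      by exists p.
    by exists p'; split => // q Sq; exact: H.
  - move=> i; rewrite inE => /predU1P[->|ijs] t p q [Sp pm] [Sq qm].
      by apply/eqP; rewrite eq_le pm ?qm.
    exact: Suniq Sp Sq.
pose v t := xget 0 (S t).
have Sv t : (fst @` K) t -> S t (v t).
  move=> [[t' p] Kp /= t't]; have [q Sq] : S t !=set0 by apply: Sne; exists p; rewrite /S0 /= -t't.
  exact: xgetPex (ex_intro _ q Sq).
exists v; split; last by move=> t /Sv /SS0.
have mD : measurable (fst @` K : set R).
  apply: compact_measurable; apply: continuous_compact => //.
  by apply: continuous_subspaceT => z; exact: cvg_fst.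
apply: (@measurability _ _ R (g_sigma_algebraType (@open 'cV[R]_k)) (fst @` K) v (@open 'cV[R]_k)).
  by [].
move=> _ [W oW <-].
(* Since the fibre is a single point, it lies in the open set exactly when it misses the closed
   complement. *)
rewrite (_ : _ `&` _ = (fst @` K) `\` hit S (~` W)).
  by apply: measurableD => //; apply: Sgood.2; exact: open_closedC.
apply/seteqP; split => t.
  move=> [Kt Wv]; split => // -[p Sp nWp]; apply: nWp.
  suff -> : p = v t by [].
  apply/matrixP => i j; rewrite ord1; apply: (Suniq i _ t) => //; first by rewrite mem_enum.
  exact: Sv.
move=> [Kt nh]; split => //; apply: contrapT => nW; apply: nh.
by exists (v t) => //; exact: Sv.
Qed.

(** The projection may fail to be Borel, hence the outer measure in the hypothesis; a compact part
    of [B] supplies both a Borel domain and a Borel selection. *)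
Lemma measurable_selection (B Q : set (R * 'cV[R]_k)%type) :
  <<s (@open (R * 'cV[R]_k)%type) >> B -> compact Q -> B `<=` Q ->
  ((@wlength R idfun)^*%mu (fst @` B) != 0)%E ->
  exists (D : set R) (v : R -> 'cV[R]_k), [/\ measurable D, (0 < @lebesgue_measure R D)%E,
    measurable_fun D (v : R -> g_sigma_algebraType (@open 'cV[R]_k)) &
    forall t, D t -> B (t, v t)].
Proof.
move=> bB cQ BQ B0.
have : (0 < (@wlength R idfun)^*%mu (fst @` B))%E by rewrite lt0e B0 outer_measure_ge0.
move=> Bpos; have [c c0 cB] : exists2 c : R, 0 < c & (c%:E < (@wlength R idfun)^*%mu (fst @` B))%E.
  move: Bpos; case: (_ (fst @` B)) => [r| |] //.
    by rewrite lte_fin => r0; exists (r / 2); rewrite ?lte_fin ?divr_gt0 // ltr_pdivrMr // ltr_pMr // ltr1n.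
  by move=> _; exists 1 => //; rewrite ltry.
have [K [cK KB Kc]] := analytic_capacity cQ BQ (borel_analytic bB) cB.
have [v [mv vK]] := compact_selection cK.
have cfK : compact (fst @` K : set R).
  by apply: continuous_compact => //; apply: continuous_subspaceT => z; exact: cvg_fst.
exists (fst @` K), v; split => //.
- exact: compact_measurable.
- by apply: lt_le_trans Kc; rewrite lte_fin.
- by move=> t /vK/KB.
Qed.

End selection.

(** * Needle variations *)

Section splice.
Context {R : realType} {m k : nat}.
Variables (f : R -> 'cV[R]_m -> 'cV[R]_k -> 'cV[R]_m) (g : R -> 'cV[R]_m -> 'cV[R]_k -> R).
Hypothesis reg : regularity_conditions f g.
Variables (u0 : R -> 'cV[R]_k) (x_init : 'cV[R]_m).
Variables (x_ : 'cV[R]_m -> R -> 'cV[R]_m).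
Hypothesis cu0 : control u0.
Hypothesis x_sol : forall xi : 'cV[R]_m, trajectory f (x_init + xi) u0 (x_ xi).

Lemma arc_rebase u s T (x : R -> 'cV[R]_m) : control u -> 0 <= T -> 0 <= s <= T ->
  arc_on f u s T x -> arc_on f u 0 T x.
Proof.
move=> cu T0 sT [acx xE]; split; first exact: acx.
move=> t tT.
have fl := f_mloc reg acx cu.
have z0 : 0 <= (0 : R) <= T by rewrite lexx.
rewrite (xE t tT) (xE 0 z0) (mprim0 fl) subr0 sub0r -addrA.
by rewrite [- _ + _]addrC.
Qed.

Lemma mprim_splice p q (h1 h2 : R -> 'M[R]_(p, q)) T t : mloc h1 -> mloc h2 -> 0 <= T -> T <= t ->
  mprim (fun s => if s <= T then h1 s else h2 s) t =
  mprim h1 T + (mprim h2 t - mprim h2 T).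
Proof.
move=> l1 l2 T0 Tt; have t0 := le_trans T0 Tt.
apply/matrixP => i j; rewrite !mxE.
have li1 := l1 i j; have li2 := l2 i j.
pose a s := if s <= T then h1 s i j - h2 s i j else 0.
have ai : loc_integrable a by apply: loc_integrable_trunc; exact: loc_integrableB.
rewrite (_ : prim (fun s => (if s <= T then h1 s else h2 s) i j) t = prim (fun s => a s + h2 s i j) t).
  rewrite primD // (@prim_stationary _ a T t) //; last 2 first.
  - by rewrite T0.
  - by move=> r Tr; rewrite /a leNgt Tr.
  rewrite (_ : prim a T = prim (fun s => h1 s i j - h2 s i j) T); last first.
    by apply: eq_prim => r /andP[_ rT]; rewrite /a rT.
  by rewrite primB_fun //; ring.
by apply: eq_prim => r _; rewrite /a; case: ifP => _; ring.
Qed.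

Lemma mloc_splice p q (h1 h2 : R -> 'M[R]_(p, q)) T : mloc h1 -> mloc h2 ->
  mloc (fun s => if s <= T then h1 s else h2 s).
Proof.
move=> l1 l2 i j; have li1 := l1 i j; have li2 := l2 i j.
apply: (@eq_loc_integrable _ (fun s => (if s <= T then h1 s i j - h2 s i j else 0) + h2 s i j)).
  by move=> s _; case: ifP => _; ring.
by apply: loc_integrableD => //; apply: loc_integrable_trunc; exact: loc_integrableB.
Qed.

(** After [T] the control is [u0] again, so the trajectory belongs there to the flow of [u0]. Its
    label [xi] is found by running [u0] backward from the state at [T], and the backward Lipschitz
    estimate bounds it. *)
Lemma splice T rho : 0 <= T -> (forall t, 0 <= t <= T -> `|u0 t| <= rho) ->
  exists2 C : R, 0 <= C & forall w, control w ->
    (forall t, 0 <= t <= T -> `|w t| <= rho) -> (forall t, T < t -> w t = u0 t) ->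
    exists Y xi, [/\ trajectory f x_init w Y, forall t, T <= t -> Y t = x_ xi t &
      `|xi| <= C * `|Y T - x_ 0 T|].
Proof.
move=> T0 ur.
have [r r0 Hr] := arc_bound reg rho `|x_init| T0 (or_introl (erefl (0:R))).
have [r' r'0 Hr'] := arc_bound reg rho r T0 (or_intror (erefl T)).
have [C C0 HC] := arc_lipschitz reg rho r' T0 (or_intror (erefl T)).
exists C => // w cw wr wu.
have TT : 0 <= T <= T by rewrite T0 lexx.
have z0 : 0 <= (0 : R) <= T by rewrite lexx.
have [y [ay y0]] := arc_exists reg x_init cw T0 (or_introl (erefl (0:R))).
have [x' [ax' x'T]] := arc_exists reg (y T) cu0 T0 (or_intror (erefl T)).
pose xi := x' 0 - x_init.
have x_0 zeta : x_ zeta 0 = x_init + zeta by have [_] := x_sol zeta.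
have yr : `|y T| <= r by apply: (Hr w y cw wr ay _ T TT); rewrite y0.
have x'0 : arc_on f u0 0 T x' by exact: arc_rebase ax'.
have axi := trajectory_arc reg T cu0 (x_sol xi) (lexx 0).
(* The backward arc solves the equation on [0, T] only; uniqueness from time 0 identifies it with
   the given flow, which continues past [T]. *)
have x'xi t : 0 <= t <= T -> x' t = x_ xi t.
  move=> tT.
  have [B1 _ HB1] := ac_bounded T0 (x'0.1 T T0).
  have [B2 _ HB2] := ac_bounded T0 (axi.1 T T0).
  have [D D0 HD] := arc_lipschitz reg rho (Num.max B1 B2) T0 (or_introl (erefl (0:R))).
  have := HD u0 x' (x_ xi) cu0 ur x'0 axi _ _ t tT.
  rewrite x_0 /xi [x_init + _]addrC subrK subrr normr0 mulr0 normr_le0 subr_eq0.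
  move=> H; apply/eqP; apply: H => t' t'T; rewrite le_max; first by rewrite HB1.
  by rewrite HB2 ?orbT.
pose Y t := if t <= T then y t else x_ xi t.
have YT : Y T = y T by rewrite /Y lexx.
have YxiT : x_ xi T = y T by rewrite -x'xi.
pose h1 t := f t (y t) (w t); pose h2 t := f t (x_ xi t) (u0 t).
have acxi := axi.1.
have l1 : mloc h1 by apply: (f_mloc reg) => //; exact: ay.1.
have l2 : mloc h2 by exact: (f_mloc reg).
exists Y, xi; split.
- have YE t : 0 <= t -> Y t = Y 0 + mprim (fun s => if s <= T then h1 s else h2 s) t.
    move=> t0; have Y0 : Y 0 = x_init by rewrite /Y T0 y0.
    have [tT|Tt] := leP t T.
      rewrite Y0 {1}/Y tT (ay.2 t) ?t0 // y0 (mprim0 l1) subr0; congr (_ + _).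
      by apply: eq_mprim => r'' /andP[_ rt]; rewrite (le_trans rt tT).
    rewrite (mprim_splice l1 l2 T0 (ltW Tt)) {1}/Y leNgt Tt /= Y0 addrA.
    have -> : x_init + mprim h1 T = x_ xi T.
      by rewrite YxiT (ay.2 T TT) y0 (mprim0 l1) subr0.
    rewrite (trajectory_prim reg cu0 (x_sol xi) t0) (trajectory_prim reg cu0 (x_sol xi) T0).
    by rewrite -[RHS]addrA [X in _ = _ + X]addrC subrK.
  split; last by rewrite /Y T0.
  have := mx_solves_of_prim (mloc_splice T l1 l2) YE.
  apply: solves_ext => //; apply: aeW => t _; rewrite /Y.
  by case: leP => // Tt; rewrite /h2 wu.
- by move=> t; rewrite le_eqVlt => /predU1P[<-|Tt]; rewrite ?YT ?YxiT // /Y leNgt Tt.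
have xT (zeta : 'cV[R]_m) : `|x_ zeta T| <= r -> forall t, 0 <= t <= T -> `|x_ zeta t| <= r'.
  by move=> zr; exact: (Hr' u0 (x_ zeta) cu0 ur (trajectory_arc reg T cu0 (x_sol zeta) T0) zr).
have := HC u0 (x_ xi) (x_ 0) cu0 ur (trajectory_arc reg T cu0 (x_sol xi) T0)
  (trajectory_arc reg T cu0 (x_sol 0) T0) _ _ 0 z0.
rewrite !x_0 addr0 [x_init + xi]addrC addrK YT -YxiT; apply; apply: xT; first by rewrite YxiT.
apply: (Hr u0 (x_ 0) cu0 ur (trajectory_arc reg T cu0 (x_sol 0) (lexx 0)) _ T TT).
by rewrite x_0 addr0.
Qed.

End splice.

(** * The adjoint equation *)

Section adjoint.
Context {R : realType} {m k : nat}.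
Variables (f : R -> 'cV[R]_m -> 'cV[R]_k -> 'cV[R]_m) (g : R -> 'cV[R]_m -> 'cV[R]_k -> R).
Hypothesis reg : regularity_conditions f g.

Lemma dHdxE y t p lambda (psi : 'rV[R]_m) : 0 <= t ->
  dHdx f g y t p lambda psi = psi *m dfdx f t y p + lambda *: dgdx g t y p.
Proof.
case: reg => df _ _ _ t0; have [dfy dgy] := df t y p t0.
apply/rowP => j; rewrite !mxE.
have df_ i : is_derive y (delta_mx j 0 : 'cV[R]_m) (fun z => f t z p i 0) (dfdx f t y p i j).
  have := is_derive_entry i 0 (is_derive_jacobian (delta_mx j 0) dfy).
  by rewrite -colE !mxE.
have dg_ : is_derive y (delta_mx j 0 : 'cV[R]_m) (fun z => g t z p) ('D_(delta_mx j 0) (fun z => g t z p) y).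
  by apply: DeriveDef => //; exact: diff_derivable.
have D1 := @is_derive_sum _ _ _ m (fun i z => psi 0 i *: f t z p i 0) y (delta_mx j 0)
  (fun i => psi 0 i *: dfdx f t y p i j) (fun i => is_deriveZ (psi 0 i) (df_ i)).
have D2 := is_deriveZ lambda dg_.
have := is_deriveD D1 D2.
rewrite (_ : (_ + _)%R = (fun z => hamiltonian f g z t p lambda psi)).
  by move=> [_ ->].
apply/funext => z /=; rewrite /hamiltonian !mxE; congr (_ + _).
rewrite fct_sumE; apply: eq_bigr => i _; by [].
Qed.

Variables (u0 : R -> 'cV[R]_k) (x_init : 'cV[R]_m).
Variables (x_ : 'cV[R]_m -> R -> 'cV[R]_m) (A_ : 'cV[R]_m -> R -> 'M[R]_m).
Hypothesis cu0 : control u0.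
Hypothesis x_sol : forall xi : 'cV[R]_m, trajectory f (x_init + xi) u0 (x_ xi).
Hypothesis A_sol : forall xi, fundamental_matrix f u0 (x_ xi) (A_ xi).

Notation I_ xi T := (mprim (dg_along g u0 (x_ xi) (A_ xi)) T).

(** In the derivative of $\psi A_\xi$ the terms in $\partial f/\partial x$ cancel, which leaves
    $-\lambda$ times the integrand of $I_\xi$. General [xi] and [lambda] are needed for the
    approximating sequences of a vanishing multiplier. *)
Lemma adjoint_variation xi lambda (psi : R -> 'rV[R]_m) :
  solves psi (fun t => - dHdx f g (x_ xi t) t (u0 t) lambda (psi t)) ->
  forall t, 0 <= t -> psi t *m A_ xi t = psi 0 - lambda *: I_ xi t.
Proof.
move=> sp t t0; have [sA A0] := A_sol xi.
have Gl := dg_along_mloc reg cu0 x_sol A_sol xi.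
have lG : mloc (fun t => - (lambda *: dg_along g u0 (x_ xi) (A_ xi) t)).
  move=> i j; apply: eq_loc_integrable (loc_integrableZ (- lambda) (Gl i j)) => s _.
  by rewrite !mxE mulNr.
have : solves (fun t => psi t *m A_ xi t) (fun t => - (lambda *: dg_along g u0 (x_ xi) (A_ xi) t)).
  apply: solves_ext (solves_mulmx sp sA) => //; apply: aeW => s s0.
  by rewrite dHdxE // mulNmx mulmxDl -scalemxAl mulmxA opprD addrAC addNr add0r.
move=> /mx_solves_prim/(_ lG t t0) ->; rewrite A0 mulmx1; congr (_ + _).
apply/matrixP => i j; rewrite !mxE -primZ // -primN //; last exact: loc_integrableZ.
by apply: eq_prim => s _; rewrite !mxE.
Qed.

Lemma flow_invertible xi t : 0 <= t -> A_ xi t \in unitmx.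
Proof.
move=> t0; have [sA A0] := A_sol xi.
have acx := trajectory_ac (x_sol xi).
by have [B [_ /(_ t t0)[]]] := fundamental_inverse (dfdx_mloc reg acx cu0) sA A0.
Qed.

(** The formula prescribes $\psi A_\xi$; the equation of the inverse matrix from
    [fundamental_inverse] then produces the adjoint equation with $\lambda = 1$. *)
Lemma costate_solves xi (l : 'rV[R]_m) :
  solves (fun t => (l - I_ xi t) *m invmx (A_ xi t))
    (fun t => - dHdx f g (x_ xi t) t (u0 t) 1 ((l - I_ xi t) *m invmx (A_ xi t))).
Proof.
have [sA A0] := A_sol xi; have acx := trajectory_ac (x_sol xi).
have [B [sB HB]] := fundamental_inverse (dfdx_mloc reg acx cu0) sA A0.
have sI := solvesB (solves_cst l) (mprim_solves (dg_along_mloc reg cu0 x_sol A_sol xi)).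
apply: solves_ext (solves_mulmx sI sB).
  by move=> t t0; have [_ ->] := HB t t0.
apply: aeW => t t0; have [Au BE] := HB t t0.
rewrite dHdxE // scale1r BE opprD addrC sub0r mulNmx mulmxN mulmxA; congr (_ - _).
by rewrite /dg_along -mulmxA -BE mulmxV // mulmx1.
Qed.

Lemma improper_tail xi (l : 'rV[R]_m) T : 0 <= T ->
  int_vec (dg_along g u0 (x_ xi) (A_ xi)) 0 S @[S --> +oo] --> l ->
  improper (dg_along g u0 (x_ xi) (A_ xi)) T = l - I_ xi T.
Proof.
move=> T0 L; have Gl := dg_along_mloc reg cu0 x_sol A_sol xi.
apply: (@cvg_lim _ (@norm_hausdorff _ _)).
have L' : int_vec (dg_along g u0 (x_ xi) (A_ xi)) 0 S - I_ xi T @[S --> +oo] --> l - I_ xi T.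
  apply: cvgB; [exact: L|exact: cvg_cst].
apply: cvg_trans L'; apply: near_eq_cvg; near=> S.
have TS : T <= S by near: S; apply: nbhs_pinfty_ge; exact: num_real.
apply/matrixP => i j; rewrite int_vec_mprim !mxE !ord1 primBcc // T0 //.
Unshelve. all: by end_near. Qed.

End adjoint.

(** * Pieces of positive measure *)

Section pieces.
Context {R : realType}.
Notation mu := (@lebesgue_measure R).

Lemma positive_piece (E : set R) (F : nat -> set R) : measurable E -> (0 < mu E)%E ->
  (forall n, measurable (F n)) -> E `<=` \bigcup_n F n -> exists n, (0 < mu (E `&` F n))%E.
Proof.
move=> mE E0 mF EF; apply: contrapT => H.
have H0 n : mu (E `&` F n) = 0%E.
  apply/eqP; rewrite eq_le measure_ge0 andbT leNgt; apply/negP => h; apply: H; by exists n.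
have : mu.-negligible (\bigcup_n (E `&` F n)).
  apply: negligible_bigcup => n; apply/(negligibleP mu (measurableI _ _ mE (mF n))).
  exact: H0.
rewrite -setI_bigcupr setIidl // => /(negligibleP mu mE) E00.
by rewrite E00 ltxx in E0.
Qed.

(** Cells of length [d] cover the half-line, so one of them meets [E] in positive measure. *)
Lemma small_piece (E : set R) (d : R) : measurable E -> (0 < mu E)%E ->
  E `<=` `[0, +oo[ -> 0 < d ->
  exists E' : set R, [/\ measurable E', E' `<=` E, (0 < mu E')%E & (mu E' <= d%:E)%E].
Proof.
move=> mE E0 Ep d0.
pose F (n : nat) : set R := `[n%:R * d, n.+1%:R * d[%classic.
have [n En] : exists n, (0 < mu (E `&` F n))%E.
  apply: positive_piece => // [n|t Et]; first exact: measurable_itv.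
  have := Ep t Et; rewrite /= in_itv /= andbT => t0.
  have q0 : 0 <= t / d by rewrite divr_ge0 // ltW.
  exists (Num.truncn (t / d)) => //; rewrite /F /= in_itv /=.
  by have /andP[h1 h2] := truncn_itv q0; rewrite -ler_pdivlMr // h1 -ltr_pdivrMr.
exists (E `&` F n); split => //; first by apply: measurableI => //; exact: measurable_itv.
have mF : measurable (F n) by exact: measurable_itv.
apply: (@le_trans _ _ (mu (F n))).
  by apply: le_measure; rewrite ?inE; [exact: measurableI|exact: mF|exact: subIsetr].
rewrite /F lebesgue_measure_itv /= lte_fin ltr_pM2r // ltr_nat ltnSn -EFinB lee_fin.
by rewrite -mulrBl -natrB // subSnn mul1r.
Qed.

(** A real-valued function is bounded on some piece of positive measure. On needles inside such a
    piece the coefficients integrate to O(d) in the measure d of the needle, and not merely to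
    o(1). *)
Lemma bounded_piece (E : set R) (T : R) (h : R -> R) : measurable E -> (0 < mu E)%E ->
  E `<=` `[0, T] -> loc_integrable h ->
  exists (E' : set R) (N : R), [/\ measurable E', E' `<=` E, (0 < mu E')%E, 0 <= N &
    forall t, E' t -> h t <= N].
Proof.
move=> mE E0 ET hl.
have hm := @lmeasS R h 0 T (lexx 0) (loc_integrable_lmeas hl).
pose h1 t := if t \in `[0, T]%classic then h t else 0.
have mh1 : measurable_fun [set: lebT R] (h1 : lebT R -> R).
  have := (measurable_restrictT (h : lebT R -> R) (measurable_leb_itv `[0, T])).1 hm.
  by [].
(* The sublevel sets must be Borel, hence a Borel representative; the null set where it differs from
   [h1] is removed from [E]. *)
have [h' mh' /leb_negligible[N [mN N0 HN]]] := borel_rep mh1.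
have mE' : measurable (E `\` N) by exact: measurableD.
have E'0 : (0 < mu (E `\` N))%E.
  rewrite lt0e measure_ge0 andbT; apply/eqP => EN.
  have : mu.-negligible E.
    have nN : mu.-negligible N by apply: (negligibleP mu mN).2; exact: etrans (esym (leb_lebesgue N)) N0.
    have nE : mu.-negligible (E `\` N) by apply: (negligibleP mu mE').2.
    apply: negligibleS (negligibleU nE nN).
    by move=> t Et; have [?|?] := pselect (N t); [right|left].
  by move=> /(negligibleP mu mE) E00; rewrite E00 ltxx in E0.
have mF n : measurable (h' @^-1` `]-oo, n%:R]).
  by rewrite -[X in measurable X]setTI; apply: mh' => //; exact: measurable_itv.
have [|n En] := positive_piece mE' E'0 mF.
  move=> t _; exists (Num.truncn `|h' t|).+1 => //=; rewrite in_itv /=.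
  apply: le_trans (ler_norm _) _.
  by have /andP[_ /ltW] := truncn_itv (normr_ge0 (h' t)).
exists ((E `\` N) `&` h' @^-1` `]-oo, n%:R]), n%:R; split => //.
- by apply: measurableI => //; exact: mF.
- by move=> t [[]].
move=> t [[Et Nt] /=]; rewrite in_itv /=.
suff -> : h' t = h t by [].
have {1}-> : h t = h1 t by rewrite /h1 mem_set //; exact: ET.
by apply: contrapT => hh; apply: Nt; apply: HN => /= e; apply: hh.
Qed.

Lemma indic_loc (E : set R) : measurable E -> loc_integrable (\1_E : R -> R).
Proof.
move=> mE; apply: loc_integrable_dom.
  apply: (@measurable_funTS _ _ _ _ _ (\1_E : lebT R -> R)).
  by apply: measurable_fun_leb => //; exact: measurable_indic.
move=> T T0; exists (fun=> 1); first exact: loc_integrable_cst.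
by move=> t _; rewrite indicE; case: (_ \in _); rewrite ?normr1 ?normr0 ?ler01.
Qed.

Lemma prim_indic (E : set R) T : measurable E -> E `<=` `[0, T] ->
  prim (\1_E) T = fine (mu E).
Proof.
move=> mE ET; rewrite /prim /Rintegral integral_indic.
- by rewrite setIidl // leb_lebesgue.
- exact: (measurable_leb_itv _).
- exact: leb_measurable.
Qed.

Lemma prim_eq_after (h1 h2 : R -> R) s t : loc_integrable h1 -> loc_integrable h2 -> 0 <= s <= t ->
  (forall r, s < r -> h1 r = h2 r) -> prim h1 t - prim h1 s = prim h2 t - prim h2 s.
Proof.
move=> l1 l2 st E; rewrite !primB //; apply: eq_Rintegral => r; rewrite inE /= in_itv /=.
by move=> /andP[sr _]; exact: E.
Qed.

Lemma borel_fun_patch k (E : set R) (u v : R -> 'cV[R]_k) : measurable E ->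
  E `<=` `[0, +oo[ -> borel_fun u ->
  measurable_fun E (v : R -> g_sigma_algebraType (@open 'cV[R]_k)) ->
  borel_fun (fun t => if t \in E then v t else u t).
Proof.
move=> mE E0 bu bv _ Y mY.
rewrite (_ : _ `&` _ = (E `&` v @^-1` Y) `|` ((`[0, +oo[ `&` u @^-1` Y) `\` E)); last first.
  apply/seteqP; split => t /=.
    move=> [t0]; case: ifPn; rewrite ?inE ?notin_setE => Et Yt; [left|right]; by [].
  move=> [[Et Yt]|[[t0 Yt] Et]].
    by rewrite mem_set //; split => //; exact: E0.
  by rewrite memNset.
apply: measurableU; first exact: bv.
by apply: measurableD => //; exact: bu.
Qed.

End pieces.

Section control_box.
Context {R : realType} {m k : nat}.
Variables (f : R -> 'cV[R]_m -> 'cV[R]_k -> 'cV[R]_m) (g : R -> 'cV[R]_m -> 'cV[R]_k -> R).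

(** One function serves both as Lipschitz modulus and as bound, so bounding it on a piece controls
    all coefficients there. *)
Definition box_bound (r rho : R) (h : R -> R) (V : normedModType R)
  (a : R -> 'cV[R]_m -> 'cV[R]_k -> V) := forall t x y p, 0 <= t ->
  `|x| <= r -> `|y| <= r -> `|p| <= rho ->
  `|a t x p - a t y p| <= h t * `|x - y| /\ `|a t x p| <= h t.

Lemma box_bound_le r rho h h' (V : normedModType R) (a : R -> 'cV[R]_m -> 'cV[R]_k -> V) :
  (forall t, 0 <= t -> h t <= h' t) -> box_bound r rho h a -> box_bound r rho h' a.
Proof.
move=> hh Ha t x y p t0 xr yr pr; have [H1 H2] := Ha t x y p t0 xr yr pr; split.
  by apply: le_trans H1 _; rewrite ler_wpM2r // hh.
by apply: le_trans H2 _; exact: hh.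
Qed.

Lemma regular_box_bound r rho (V : normedModType R) nrm (a : R -> 'cV[R]_m -> 'cV[R]_k -> V) :
  (forall v, `|v| <= nrm v) -> regular nrm a ->
  exists h, [/\ loc_integrable h, forall t, 0 <= t -> 0 <= h t & box_bound r rho h a].
Proof.
move=> nle ra; have [L [M [[Li Mi] LM0 HL HM]]] := regular_box r rho nle ra.
exists (fun t => L t + M t); split.
- exact: loc_integrableD.
- by move=> t /LM0[? ?]; exact: addr_ge0.
move=> t x y p t0 xr yr pr; have [L0 M0] := LM0 t t0; split.
  by apply: le_trans (HL _ _ _ _ t0 xr yr pr) _; rewrite ler_wpM2r // lerDl.
by apply: le_trans (HM _ _ _ t0 xr pr) _; rewrite lerDr.
Qed.

Lemma system_box_bound r rho : regularity_conditions f g -> exists h,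
  [/\ loc_integrable h, forall t, 0 <= t -> 0 <= h t &
   [/\ box_bound r rho h f, box_bound r rho h g, box_bound r rho h (dfdx f) & box_bound r rho h (dgdx g)]].
Proof.
case=> _ [rf rg] [rdf rdg] _.
have [h1 [i1 p1 b1]] := regular_box_bound r rho (@norm_le_enorm R _ _) rf.
have [h2 [i2 p2 b2]] := regular_box_bound r rho (fun v : R => lexx _) rg.
have [h3 [i3 p3 b3]] := regular_box_bound r rho (@norm_le_enorm R _ _) rdf.
have [h4 [i4 p4 b4]] := regular_box_bound r rho (@norm_le_enorm R _ _) rdg.
exists (fun t => h1 t + h2 t + (h3 t + h4 t)); split.
- by do 2! apply: loc_integrableD.
- by move=> t t0; rewrite !addr_ge0 ?p1 ?p2 ?p3 ?p4.
by split; [move: b1|move: b2|move: b3|move: b4]; apply: box_bound_le => t t0;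
  have := p1 t t0; have := p2 t t0; have := p3 t t0; have := p4 t t0; lra.
Qed.

End control_box.

Section needle.
Context {R : realType} {m k : nat}.
Variables (f : R -> 'cV[R]_m -> 'cV[R]_k -> 'cV[R]_m) (g : R -> 'cV[R]_m -> 'cV[R]_k -> R).
Hypothesis reg : regularity_conditions f g.
Variables (u0 : R -> 'cV[R]_k) (x_init : 'cV[R]_m).
Variables (x_ : 'cV[R]_m -> R -> 'cV[R]_m).
Hypothesis cu0 : control u0.
Hypothesis x_sol : forall xi : 'cV[R]_m, trajectory f (x_init + xi) u0 (x_ xi).

Definition needle (E : set R) (v : R -> 'cV[R]_k) t := if t \in E then v t else u0 t.

(** A single constant large enough for both estimates below, off the needle and on it. *)
Let slope (P : R) : R := 1 + m%:R * P + m%:R + m%:R * (m%:R * P).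

Lemma entryD p q (A B : 'M[R]_(p, q)) i j : (A + B) i j = A i j + B i j.
Proof. by rewrite mxE. Qed.

Lemma entryB p q (A B : 'M[R]_(p, q)) i j : (A - B) i j = A i j - B i j.
Proof. by rewrite !mxE. Qed.

Lemma row_mul_le n (a : 'rV[R]_n) (b : 'cV[R]_n) (A B : R) : `|a| <= A -> `|b| <= B ->
  `|(a *m b) 0 0| <= n%:R * A * B.
Proof.
move=> aA bB; apply: le_trans (mx_entry_le _ _ _) _; apply: le_trans (mx_norm_mul _ _) _.
by apply: ler_pM; rewrite ?mulr_ge0 // ler_wpM2l.
Qed.

(** Off the needle the costate cancels the first-order effect of the displaced state, and only
    Taylor remainders are left. *)
Lemma needle_off r rho (h : R -> R) t x y p (psi : 'rV[R]_m) P : 0 <= t -> 0 <= h t ->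
  box_bound r rho h (dfdx f) -> box_bound r rho h (dgdx g) ->
  `|x| <= r -> `|y| <= r -> `|p| <= rho -> `|psi| <= P ->
  `|g t y p - g t x p + ((psi *m (f t y p - f t x p)) 0 0
     - ((psi *m dfdx f t x p + dgdx g t x p) *m (y - x)) 0 0)| <= slope P * h t * `|y - x| ^+ 2.
Proof.
case: (reg) => df _ _ _ t0 h0 bdf bdg xr yr pr psiP.
have P0 : 0 <= P := le_trans (normr_ge0 _) psiP.
have Hg : `|g t y p - g t x p - (dgdx g t x p *m (y - x)) 0 0| <= m%:R * h t * `|y - x| ^+ 2.
  apply: (@taylor_remainder _ _ (fun y => g t y p) (fun y => dgdx g t y p) r) => //.
    by move=> z w; apply: is_derive_gradient; have [] := df t z p t0.
  by move=> z w zr wr; have [] := bdg t z w p t0 zr wr pr.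
have Hf : `|f t y p - f t x p - dfdx f t x p *m (y - x)| <= m%:R * h t * `|y - x| ^+ 2.
  apply: (@jacobian_remainder _ _ _ (fun y => f t y p) r) => //.
    by move=> z; have [] := df t z p t0.
  by move=> z w zr wr; have [] := bdf t z w p t0 zr wr pr.
have -> : g t y p - g t x p + ((psi *m (f t y p - f t x p)) 0 0
     - ((psi *m dfdx f t x p + dgdx g t x p) *m (y - x)) 0 0) =
   (g t y p - g t x p - (dgdx g t x p *m (y - x)) 0 0) +
   (psi *m (f t y p - f t x p - dfdx f t x p *m (y - x))) 0 0.
  by rewrite (mulmxBr psi (_ - _)) mulmxDl -mulmxA entryD entryB; ring.
apply: le_trans (ler_normD _ _) _; have := row_mul_le psiP Hf; move: Hg.
have q0 : 0 <= h t * `|y - x| ^+ 2 by rewrite mulr_ge0 // exprn_ge0.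
have mP : 0 <= m%:R * P by rewrite mulr_ge0.
have := mulr_ge0 (addr_ge0 ler01 mP) q0; rewrite /slope.
set D := `|y - x| ^+ 2; set a := `|_|; set b := `|_|; move=> h1 h2 h3.
have -> : (1 + m%:R * P + m%:R + m%:R * (m%:R * P)) * h t * D =
  (1 + m%:R * P) * (h t * D) + (m%:R * h t * D + m%:R * P * (m%:R * h t * D)) by ring.
by move: h1 h2 h3; lra.
Qed.

(** On the needle the gradients are taken at another control and nothing cancels. A bound linear in
    the displacement is enough, since the needle itself has small measure. *)
Lemma needle_on r rho (h : R -> R) t x y p q (psi : 'rV[R]_m) P : 0 <= t -> 0 <= h t ->
  box_bound r rho h f -> box_bound r rho h g -> 
  box_bound r rho h (dfdx f) -> box_bound r rho h (dgdx g) ->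
  `|x| <= r -> `|y| <= r -> `|p| <= rho -> `|q| <= rho -> `|psi| <= P ->
  `|g t y q - g t x q + ((psi *m (f t y q - f t x q)) 0 0
     - ((psi *m dfdx f t x p + dgdx g t x p) *m (y - x)) 0 0)| <= slope P * h t * `|y - x|.
Proof.
move=> t0 h0 bf bg bdf bdg xr yr pr qr psiP.
have P0 : 0 <= P := le_trans (normr_ge0 _) psiP.
have [gl _] := bg t y x q t0 yr xr qr; have [fl _] := bf t y x q t0 yr xr qr.
have [_ dgl] := bdg t x y p t0 xr yr pr; have [_ dfl] := bdf t x y p t0 xr yr pr.
have e1 := row_mul_le psiP fl.
have e2 := row_mul_le dgl (lexx `|y - x|).
have e3 : `|psi *m dfdx f t x p| <= m%:R * P * h t.
  by apply: le_trans (mx_norm_mul _ _) _; apply: ler_pM; rewrite ?mulr_ge0 // ler_wpM2l.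
have e4 := row_mul_le e3 (lexx `|y - x|).
rewrite mulmxDl entryD.
apply: le_trans (ler_normD _ _) _.
apply: le_trans (_ : h t * `|y - x| + (m%:R * P * (h t * `|y - x|) + (m%:R * (m%:R * P * h t) * `|y - x|
  + m%:R * h t * `|y - x|)) <= _); last by rewrite /slope le_eqVlt; apply/orP; left; apply/eqP; ring.
apply: lerD => //; apply: le_trans (ler_normB _ _) _; apply: lerD => //.
by apply: le_trans (ler_normD _ _) _; exact: lerD.
Qed.

(** The end point term is absorbed as the integral of the derivative of $\psi (Y - x_0)$. Added to
    the change of [g], it gives at least [eps] minus O(d) on the needle and an error $O(d^2)$
    elsewhere. [D'] and [C] come before [E], so the constant is the same for all small needles. *)
Lemma needle_gain (psi : R -> 'rV[R]_m) T rho eps (D : set R) (v : R -> 'cV[R]_k) :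
  solves psi (fun t => - dHdx f g (x_ 0 t) t (u0 t) 1 (psi t)) ->
  0 <= T -> measurable D -> D `<=` `[0, T] -> (0 < @lebesgue_measure R D)%E ->
  measurable_fun D (v : R -> g_sigma_algebraType (@open 'cV[R]_k)) ->
  (forall t, D t -> `|v t| <= rho /\
    hamiltonian f g (x_ 0 t) t (u0 t) 1 (psi t) + eps <= hamiltonian f g (x_ 0 t) t (v t) 1 (psi t)) ->
  exists (D' : set R) (C : R), [/\ measurable D', D' `<=` D, (0 < @lebesgue_measure R D')%E, 0 <= C &
    forall E, measurable E -> E `<=` D' -> let d := fine (@lebesgue_measure R E) in
    exists Y xi, [/\ trajectory f x_init (needle E v) Y, (forall t, T <= t -> Y t = x_ xi t),
      `|xi| <= C * d, control (needle E v) &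
      eps * d - C * d ^+ 2 <= prim (fun t => g t (Y t) (needle E v t)) T
         - prim (fun t => g t (x_ 0 t) (u0 t)) T + (psi T *m (Y T - x_ 0 T)) 0 0]].
Proof.
move=> spsi T0 mD DT D0 mv vD.
have [bu0 lu0] := cu0; have [rho0 u0r] := lu0 T T0.
pose rho1 := Num.max rho0 rho.
have u0r1 t : 0 <= t <= T -> `|u0 t| <= rho1 by move=> tT; rewrite le_max u0r.
have [r r0 Hr] := arc_bound reg rho1 `|x_init| T0 (or_introl (erefl (0:R))).
have [h [hl h0 [bf bg bdf bdg]]] := system_box_bound r rho1 reg.
have [D' [N [mD' D'D D'0 N0 hN]]] := bounded_piece mD D0 DT hl.
have [C1 C10 HC1] := mx_gronwall hl h0 T0 (or_introl (erefl (0:R))).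
have [C2 C20 HC2] := splice reg cu0 x_sol T0 u0r1.
have [P P0 psiP] := ac_bounded T0 (spsi.1 T T0).
(* On the needle the switch of control changes the velocity by at most [2 * N]; Gronwall turns this
   into a displacement of at most [c2 * d]. *)
pose c2 := C1 * (2 * N); pose c := slope P.
have c20 : 0 <= c2 by rewrite !mulr_ge0.
have H0 : 0 <= prim h T by apply: prim_ge0 => // t /andP[t0 _]; exact: h0.
have c0 : 0 <= c by rewrite /c /slope; rewrite !addr_ge0 ?mulr_ge0.
(* The first term bounds [xi]; the second collects the errors of the gain, made on the needle and
   off it. *)
pose C := C2 * c2 + (c * N * c2 + c * c2 ^+ 2 * prim h T).
have CC : 0 <= c * N * c2 + c * c2 ^+ 2 * prim h T by rewrite addr_ge0 // !mulr_ge0 // exprn_ge0.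
exists D', C; split => //; first by rewrite addr_ge0 // mulr_ge0.
move=> E mE ED' d.
have ED t : E t -> D t by move=> /ED' /D'D.
have ET : E `<=` `[0, T] by move=> t /ED /DT.
have E0 : E `<=` `[0, +oo[ by move=> t /ET; rewrite /= !in_itv /= => /andP[->].
have dE : prim (\1_E) T = d by exact: prim_indic.
have d0 : 0 <= d by exact: fine_ge0.
have il := indic_loc mE.
pose w := needle E v.
have bw : borel_fun w by apply: borel_fun_patch => //; apply: measurable_funS mv.
have wr t : 0 <= t <= T -> `|w t| <= rho1.
  move=> tT; rewrite /w /needle; case: ifPn => [|_]; last exact: u0r1.
  by rewrite inE => /ED/vD[vr _]; rewrite le_max vr orbT.
have wu t : ~ E t -> w t = u0 t by move=> Et; rewrite /w /needle memNset.
have wv t : E t -> w t = v t by move=> Et; rewrite /w /needle mem_set.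
have wT t : T < t -> w t = u0 t.
  by move=> Tt; apply: wu => /ET; rewrite /= in_itv /= [t <= T]leNgt Tt andbF.
have cw : control w.
  split=> // S S0; have [rho2 Hrho2] := lu0 S S0.
  exists (Num.max rho1 rho2) => t tS; rewrite le_max.
  have [tT|Tt] := leP t T; first by rewrite wr //; move: tS => /andP[-> _].
  by rewrite wT // Hrho2 // orbT.
have [Y [xi [tY Yxi xiY]]] := HC2 w cw wr wT.
have acY := trajectory_ac tY; have ac0 := trajectory_ac (x_sol 0).
have z00 : 0 <= (0 : R) <= T by rewrite lexx.
have TT : 0 <= T <= T by rewrite T0 lexx.
have Yr : forall t, 0 <= t <= T -> `|Y t| <= r.
  apply: (Hr w Y cw wr (trajectory_arc reg T cw tY (lexx 0))).
  by case: tY => _ ->.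
have xr : forall t, 0 <= t <= T -> `|x_ 0 t| <= r.
  apply: (Hr u0 (x_ 0) cu0 u0r1 (trajectory_arc reg T cu0 (x_sol 0) (lexx 0))).
  by case: (x_sol 0) => _ ->; rewrite addr0.
pose z t := Y t - x_ 0 t.
pose vz t := f t (Y t) (w t) - f t (x_ 0 t) (u0 t).
have sz : solves z vz by apply: solvesB; [case: tY|case: (x_sol 0)].
have vl : mloc vz by apply: mlocB; exact: (f_mloc reg).
have z0 : z 0 = 0.
  by rewrite /z; have [_ ->] := tY; have [_ ->] := x_sol 0; rewrite addr0 subrr.
have Zb : forall t, 0 <= t <= T -> `|z t| <= c2 * d.
  pose b t := 2 * N * \1_E t.
  have bl : loc_integrable b by exact: loc_integrableZ.
  move=> t tT; have := HC1 _ _ z vz b _ vl bl _ _ _ t tT.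
  rewrite z0 normr0 add0r /b primZ // dE mulrA; apply.
  - by case: sz.
  - by move=> t' _; rewrite mulr_ge0 ?mulr_ge0 // indicE; case: (_ \in _).
  - move=> t' /andP[t'0 _]; rewrite add0r (mx_solves_prim sz vl t'0) z0 add0r.
    by rewrite (mprim0 vl) subr0.
  - move=> t' /[dup] t'T /andP[t'0 _].
    have [fY _] := bf t' _ _ _ t'0 (Yr t' t'T) (xr t' t'T) (wr t' t'T).
    have [Et|Et] := pselect (E t'); last first.
      by rewrite indicE memNset // mulr0 addr0 /vz wu // in fY *.
    rewrite indicE mem_set // mulr1.
    have [_ f1] := bf t' _ _ _ t'0 (xr t' t'T) (xr t' t'T) (wr t' t'T).
    have [_ f2] := bf t' _ _ _ t'0 (xr t' t'T) (xr t' t'T) (u0r1 t' t'T).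
    have hNt := hN t' (ED' t' Et).
    rewrite /vz -(subrK (f t' (x_ 0 t') (w t')) (f t' (Y t') (w t'))) -addrA.
    apply: le_trans (ler_normD _ _) _; apply: lerD => //.
    apply: le_trans (ler_normB _ _) _; move: f1 f2 hNt; lra.
exists Y, xi; split => //.
  apply: le_trans xiY _; apply: le_trans (ler_wpM2l C20 (Zb T TT)) _.
  by rewrite /C mulrA ler_wpM2r // lerDl.
pose K t := psi t *m dfdx f t (x_ 0 t) (u0 t) + dgdx g t (x_ 0 t) (u0 t).
pose V t := - K t *m z t + psi t *m vz t.
have acpsi := spsi.1; have acz : forall T, 0 <= T -> abs_continuous T z by case: sz.
have Kl : mloc K.
  apply: mlocD; last exact: (dgdx_mloc reg).
  by apply: mloc_mull => //; exact: (dfdx_mloc reg).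
have Vl : mloc V.
  apply: mlocD; first by apply: mloc_mulr => //; exact: mlocN.
  exact: mloc_mull.
have spz : solves (fun t => psi t *m z t) V.
  apply: solves_ext (solves_mulmx spsi sz) => //; apply: aeW => t t0.
  by rewrite dHdxE // scale1r.
have := mx_solves_prim spz Vl T0; rewrite z0 mulmx0 add0r => ->.
rewrite [mprim V T 0 0]mxE.
have g1 := g_loc reg acY cw; have g2 := g_loc reg ac0 cu0.
have V00 := Vl 0 0.
rewrite -primB_fun // -primD //; last exact: loc_integrableB.
(* A pointwise lower bound for the integrand: on the needle the gain reduced by a multiple of the
   displacement, elsewhere a square of the displacement. *)
pose b t := (eps - c * N * (c2 * d)) * \1_E t - c * (c2 * d) ^+ 2 * h t.
have b1 := loc_integrableZ (eps - c * N * (c2 * d)) il.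
have b2 := loc_integrableZ (c * (c2 * d) ^+ 2) hl.
have bl : loc_integrable b := loc_integrableB b1 b2.
have ql := loc_integrableD (loc_integrableB g1 g2) V00.
have := @prim_le _ _ _ 0 T bl ql; rewrite lexx T0 => /(_ isT).
rewrite (prim0 bl) (prim0 ql) !subr0 /b primB_fun // !primZ // dE => H.
apply: le_trans (H _) => {H}.
  rewrite /C; set e := C2 * c2; have -> : forall p, (e + p) * d ^+ 2 = e * d ^+ 2 + p * d ^+ 2.
    by move=> p; ring.
  have : 0 <= e * d ^+ 2 by rewrite !mulr_ge0.
  have -> : (eps - c * N * (c2 * d)) * d - c * (c2 * d) ^+ 2 * prim h T =
    eps * d - (c * N * c2 + c * c2 ^+ 2 * prim h T) * d ^+ 2 by ring.
  lra.
move=> t tT; have /andP[t0 _] := tT; have ht0 := h0 t t0.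
have VE : V t 0 0 = (psi t *m vz t) 0 0 - (K t *m z t) 0 0.
  by rewrite /V mulNmx addrC entryB.
have Zt := Zb t tT.
rewrite VE /K /vz /z.
have [Et|Et] := pselect (E t); last first.
  rewrite indicE memNset // mulr0 sub0r wu //.
  have := needle_off t0 ht0 bdf bdg (xr t tT) (Yr t tT) (u0r1 t tT) (psiP t tT).
  rewrite ler_norml => /andP[H _]; apply: le_trans H; rewrite lerN2 -/c.
  rewrite [leRHS]mulrAC; apply: ler_wpM2l; first exact: mulr_ge0.
  by rewrite lerXn2r ?nnegrE ?mulr_ge0.
rewrite indicE mem_set // mulr1 wv //.
have [vr Hv] := vD t (ED t Et).
have vr1 : `|v t| <= rho1 by rewrite le_max vr orbT.
have := needle_on t0 ht0 bf bg bdf bdg (xr t tT) (Yr t tT) (u0r1 t tT) vr1 (psiP t tT).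
rewrite ler_norml -/c => /andP[+ _].
have hNt := hN t (ED' t Et).
have le1 : c * h t * `|Y t - x_ 0 t| <= c * N * (c2 * d).
  by apply: ler_pM => //; rewrite ?mulr_ge0 // ler_wpM2l.
have p2 : 0 <= c * (c2 * d) ^+ 2 * h t by rewrite !mulr_ge0.
move: Hv; rewrite /hamiltonian !mul1r !mulmxBr.
rewrite !entryB; move: le1 p2; lra.
Qed.

End needle.

Section improvement.
Context {R : realType} {m k : nat}.
Variables (f : R -> 'cV[R]_m -> 'cV[R]_k -> 'cV[R]_m) (g : R -> 'cV[R]_m -> 'cV[R]_k -> R).
Hypothesis reg : regularity_conditions f g.
Variables (U : R -> set 'cV[R]_k) (u0 : R -> 'cV[R]_k) (x_init : 'cV[R]_m).
Variables (x_ : 'cV[R]_m -> R -> 'cV[R]_m) (A_ : 'cV[R]_m -> R -> 'M[R]_m).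
Hypothesis au0 : admissible U u0.
Hypothesis x_sol : forall xi : 'cV[R]_m, trajectory f (x_init + xi) u0 (x_ xi).
Hypothesis A_sol : forall xi, fundamental_matrix f u0 (x_ xi) (A_ xi).

Notation I_ xi T := (mprim (dg_along g u0 (x_ xi) (A_ xi)) T).

Lemma control_admissible w : control w -> (forall t, 0 <= t -> U t (w t)) -> admissible U w.
Proof.
move=> [bw lw] Uw; split => // T T0; have [rho Hrho] := lw T T0.
exists ((k * 1)%:R * rho) => t tT; apply: le_trans (enorm_le_norm _) _.
by rewrite ler_wpM2l // Hrho.
Qed.

(** To first order the cost after [T] changes by $l\xi - I_0(T)\xi$, the difference of the changes
    over [0, t] and over [0, T]. This is exactly the end point term $\psi(T) A_0(T)\xi$, so the gain
    of [needle_gain] is the gain at every large time up to errors. *)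
Lemma needle_improves (l : 'rV[R]_m) T rho eps (D : set R) (v : R -> 'cV[R]_k) :
  (fun z : 'cV[R]_m * R => int_vec (dg_along g u0 (x_ z.1) (A_ z.1)) 0 z.2)
    @ (nbhs (0 : 'cV[R]_m), +oo) --> l ->
  let psi t := (l - I_ 0 t) *m invmx (A_ 0 t) in
  0 <= T -> 0 < eps -> measurable D -> D `<=` `[0, T] -> (0 < @lebesgue_measure R D)%E ->
  measurable_fun D (v : R -> g_sigma_algebraType (@open 'cV[R]_k)) ->
  (forall t, D t -> [/\ U t (v t), `|v t| <= rho &
    hamiltonian f g (x_ 0 t) t (u0 t) 1 (psi t) + eps <= hamiltonian f g (x_ 0 t) t (v t) 1 (psi t)]) ->
  exists (w : R -> 'cV[R]_k) (Y : R -> 'cV[R]_m) (e S : R),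
    [/\ admissible U w, trajectory f x_init w Y, 0 < e &
     forall t, S < t -> prim (fun t => g t (x_ 0 t) (u0 t)) t + e <= prim (fun t => g t (Y t) (w t)) t].
Proof.
move=> L psi T0 eps0 mD DT D0 mv vD.
have cu0 := admissible_control au0.
have spsi := costate_solves reg cu0 x_sol A_sol 0 l.
have vD' t : D t -> `|v t| <= rho /\
    hamiltonian f g (x_ 0 t) t (u0 t) 1 (psi t) + eps <= hamiltonian f g (x_ 0 t) t (v t) 1 (psi t).
  by move=> /vD[].
have [D' [C [mD' D'D D'0 C0 HC]]] := needle_gain reg cu0 x_sol spsi T0 mD DT D0 mv vD'.
have [C1 C10 HC1] := cost_taylor reg cu0 x_sol A_sol T0.
have [C2 C20 HC2] := flow_taylor reg cu0 x_sol A_sol T0.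
pose P := m%:R * `|psi T| * C2.
have P0 : 0 <= P by rewrite !mulr_ge0.
(* A quarter of the gain is allotted to the error $e|\xi| \le e C d$ and a quarter to the quadratic
   errors, which leaves half of it. *)
pose e := eps / 4 / (C + 1).
have C10' : 0 < C + 1 by rewrite ltr_wpDl.
have e0 : 0 < e by rewrite !divr_gt0.
have [delta [S [delta0 S0 [_ HJ]]]] := cost_limit reg cu0 x_sol A_sol L e0.
pose K := C + (C1 + P) * C ^+ 2.
have K0 : 0 <= K by rewrite addr_ge0 // mulr_ge0 ?addr_ge0 // exprn_ge0.
have K1 : 0 < K + 1 by rewrite ltr_wpDl.
(* The first bound puts $|\xi|$ within 1 and below [delta]; the second makes the quadratic errors at
   most [eps * d / 4]. *)
pose d0 := Num.min (Num.min 1 (delta / 2) / (C + 1)) (eps / 4 / (K + 1)).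
have d00 : 0 < d0 by rewrite lt_min !divr_gt0 // lt_min ltr01 divr_gt0.
have D'p : D' `<=` `[0, +oo[ by move=> t /D'D /DT; rewrite /= !in_itv /= => /andP[->].
have [E [mE ED' E0 Ed0]] := small_piece mD' D'0 D'p d00.
have [Y [xi [tY Yxi xiC cw G]]] := HC E mE ED'.
set d := fine _ in xiC G.
have muE : @lebesgue_measure R E = d%:E.
  by rewrite /d fineK // ge0_fin_numE // (le_lt_trans Ed0) // ltry.
have dp : 0 < d by rewrite -lte_fin -muE.
have : d <= d0 by rewrite -lee_fin -muE.
rewrite le_min !ler_pdivlMr // le_min => /andP[/andP[d1 d2] d3].
have Cd : C * d <= d * (C + 1) by rewrite mulrDr mulr1 mulrC lerDl ltW.
have xi1 : `|xi| <= 1 by apply: le_trans xiC _; exact: le_trans d1.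
have xid : `|xi| < delta.
  apply: le_lt_trans xiC _; apply: le_lt_trans Cd _; apply: le_lt_trans d2 _.
  by rewrite ltr_pdivrMr // ltr_pMr // ltr1n.
have ET t : E t -> t <= T.
  by move=> /ED' /D'D /DT; rewrite /= in_itv /= => /andP[].
exists (needle u0 E v), Y, (eps * d / 2), (Num.max S T); split => //.
- apply: control_admissible => // t t0; rewrite /needle; case: ifPn => [|_]; last first.
    by case: au0 => _ _; exact.
  by rewrite inE => /ED' /D'D /vD[].
- by rewrite divr_gt0 ?mulr_gt0.
move=> t; rewrite gt_max => /andP[St Tt].
have t0 : 0 <= t by apply: le_trans T0 _; exact: ltW.
have gw := g_loc reg (trajectory_ac tY) cw.
have gx := g_loc reg (trajectory_ac (x_sol xi)) cu0.
have Tt0 : 0 <= T <= t by rewrite T0 ltW.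
have H1 : prim (fun t => g t (Y t) (needle u0 E v t)) t - prim (fun t => g t (Y t) (needle u0 E v t)) T
    = cost g u0 x_ xi t - cost g u0 x_ xi T.
  apply: prim_eq_after => // s Ts; rewrite Yxi ?ltW // /needle memNset //.
  by move=> /ET; rewrite leNgt Ts.
have z1 : `|0 : 'cV[R]_m| <= 1 by rewrite normr0.
have := HC1 0 xi; rewrite add0r => /(_ z1 xi1) B2.
have := HC2 0 xi T; rewrite add0r => /(_ z1 xi1); rewrite T0 lexx => /(_ isT) B3.
have B1 := HJ xi t xid St.
have YT : Y T = x_ xi T by apply: Yxi.
have := row_mul_le (lexx `|psi T|) B3.
(* Multiplication by $A_0(T)$ cancels the inverse in $\psi(T)$ and leaves $l - I_0(T)$. *)
rewrite mulmxBr mulmxA -YT entryB {2}/psi mulmxKV; last exact: (flow_invertible reg cu0 x_sol A_sol).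
rewrite mulmxBl entryB mulrA -/P => B4.
have X0 := normr_ge0 xi.
have B5 : e * `|xi| <= eps / 4 * d.
  apply: (@le_trans _ _ (e * (d * (C + 1)))); last by rewrite /e [d * _]mulrC mulrA divfK ?gt_eqF.
  by rewrite ler_pM2l // (le_trans xiC).
have B6 : (C1 + P) * `|xi| ^+ 2 <= (C1 + P) * (C * d) ^+ 2.
  by rewrite ler_wpM2l ?addr_ge0 // lerXn2r ?nnegrE // mulr_ge0 // ltW.
have B7 : K * d ^+ 2 <= eps / 4 * d.
  apply: (@le_trans _ _ (d * (K + 1) * d)); last first.
    by rewrite ler_pM2r // ler_pdivlMr.
  have -> : d * (K + 1) * d = K * d ^+ 2 + d ^+ 2 by ring.
  by rewrite lerDl sqr_ge0.
have B8 : K * d ^+ 2 = C * d ^+ 2 + (C1 + P) * (C * d) ^+ 2 by rewrite /K; ring.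
have B9 : (C1 + P) * `|xi| ^+ 2 = C1 * `|xi| ^+ 2 + P * `|xi| ^+ 2 by ring.
have B10 : eps / 4 * d = eps * d / 4 by ring.
move: G H1 B1 B2 B4; rewrite /cost !ler_norml => G H1 /andP[B1 _] /andP[_ B2] /andP[_ B4].
move: G H1 B1 B2 B4 B5 B6 B7 B8 B9 B10; lra.
Qed.

End improvement.

(** * The maximum condition *)

Section maximum.
Context {R : realType} {m k : nat}.
Variables (f : R -> 'cV[R]_m -> 'cV[R]_k -> 'cV[R]_m) (g : R -> 'cV[R]_m -> 'cV[R]_k -> R).
Hypothesis reg : regularity_conditions f g.
Variables (U : R -> set 'cV[R]_k) (x_init : 'cV[R]_m) (tau : nat -> R).
Variables (u0 : R -> 'cV[R]_k) (x0 : R -> 'cV[R]_m).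

(** From some index on, every supremum in the definition of optimality would be at least [e], and so
    would their upper limit, which is 0. *)
Lemma optimal_no_improvement (w : R -> 'cV[R]_k) Y (e S : R) : times_to_infinity tau ->
  tau_optimal f g U x_init tau u0 x0 -> admissible U w -> trajectory f x_init w Y -> 0 < e ->
  ~ (forall t, S < t -> payoff g u0 x0 t + e <= payoff g w Y t).
Proof.
move=> [_ _ tauoo] [_ opt] aw tY e0 H.
have [N _ HN] := (@cvgryPgt R nat \oo _ tau).1 tauoo S.
have : (e%:E <= 0%E :> \bar R)%E; last by rewrite lee_fin leNgt e0.
rewrite -opt limn_esup_lim; apply: lime_ge; first exact: is_cvg_esups.
near=> n.
have nN : (N <= n)%N by near: n; exact: nbhs_infty_ge.
apply: le_trans (_ : ((payoff g w Y (tau n) - payoff g u0 x0 (tau n))%:E <= _)%E).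
  by rewrite lee_fin lerBrDl; apply: H; exact: HN.
apply: le_trans (_ : (_ <= ereal_sup
    [set (payoff g z.1 z.2 (tau n) - payoff g u0 x0 (tau n))%:E | z in processes f U x_init])%E) _.
  by apply: ereal_sup_ubound; exists (w, Y).
by apply: ereal_sup_ubound; exists n => /=.
Unshelve. all: by end_near. Qed.

Lemma continuous_graph_measurable (phi : R * 'cV[R]_k -> R) : continuous phi ->
  measurable_fun setT (phi : g_sigma_algebraType (@open (R * 'cV[R]_k)%type) -> R).
Proof.
move=> cphi; apply: (measurability _ (RGenOInfty.measurableE R)) => _ [_ [c ->] <-].
rewrite setTI; apply: sub_sigma_algebra.
by apply: open_comp; [move=> z _; exact: cphi|exact: interval_open].
Qed.

(** Times at which continuity in (state, control) fails are confined to [B0]. Measurability must be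
    Borel here, because the bad set enters capacitability as a Borel set of pairs. The function [u]
    stands for either the free control or [u0] at the given time. *)
Lemma measurable_graph_fun (B0 : set R) (x : R -> 'cV[R]_m) (psi : R -> 'rV[R]_m) :
  measurable B0 ->
  (forall t, 0 <= t -> ~ B0 t -> continuous (fun z : 'cV[R]_m * 'cV[R]_k => f t z.1 z.2) /\
     continuous (fun z : 'cV[R]_m * 'cV[R]_k => g t z.1 z.2)) ->
  (forall T, 0 <= T -> abs_continuous T x) -> (forall T, 0 <= T -> abs_continuous T psi) ->
  forall u : R * 'cV[R]_k -> 'cV[R]_k,
  let W := g_sigma_algebraType (@open (R * 'cV[R]_k)%type) in
  let D := [set z : R * 'cV[R]_k | 0 <= z.1 /\ ~ B0 z.1] in
  (forall i, measurable_fun (D : set W) (fun z : W => u z i 0)) ->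
  measurable (D : set W) /\
  measurable_fun (D : set W) (fun z : W => hamiltonian f g (x z.1) z.1 (u z) 1 (psi z.1)).
Proof.
move=> mB cB acx acpsi u W D mu.
case: (reg) => _ [[bf _ _] [bg _ _]] _ _.
have m1 : measurable_fun setT (fst : W -> R).
  by apply: (@continuous_graph_measurable fst) => z; exact: cvg_fst.
have mD : measurable (D : set W).
  rewrite (_ : D = (fst : W -> R) @^-1` (`[0, +oo[ `\` B0)).
    rewrite -[X in measurable X]setTI; apply: m1 => //.
    by apply: measurableD => //; exact: measurable_itv.
  by apply/seteqP; split => z; rewrite /D /= in_itv /= andbT.
have mDf (h : R -> R) : measurable_fun (`[0, +oo[%classic : set R) h ->
    measurable_fun (D : set W) (fun z : W => h z.1).
  move=> mh; apply: (@measurable_comp _ _ _ W R R `[0, +oo[%classic).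
  - exact: measurable_itv.
  - by move=> _ [z [z0 _] <-]; rewrite /= in_itv /= z0.
  - exact: mh.
  - exact: measurable_funTS.
split=> //; rewrite /hamiltonian.
have mx i j : measurable_fun (D : set W) (fun z : W => x z.1 i j).
  by apply: (mDf (fun t => x t i j)); apply: ac_borel => T T0; exact: ((ac_mxP T x).1 (acx T T0)).
have mp i j : measurable_fun (D : set W) (fun z : W => psi z.1 i j).
  by apply: (mDf (fun t => psi t i j)); apply: ac_borel => T T0; exact: ((ac_mxP T psi).1 (acpsi T T0)).
have muu i j : measurable_fun (D : set W) (fun z : W => u z i j) by rewrite ord1.
apply: measurable_funD.
  under eq_fun do rewrite mxE.
  apply: measurable_sum => i; apply: measurable_funM; first exact: mp.
  apply: (@caratheodory_comp R _ W D m k (fun t x p => f t x p i 0) (fun z => z.1) (fun z => x z.1) u) => //.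
  - by move=> y p; apply: (borel_fun_comp (phi := fun v : 'cV[R]_m => v i 0)) => //; exact: coord_continuous.
  - exact: measurable_funTS.
  - by move=> w [].
  - move=> w [w0 wB] z; have [cf _] := cB _ w0 wB.
    by apply: (@continuous_comp _ _ _ (fun z : 'cV[R]_m * 'cV[R]_k => f w.1 z.1 z.2)
      (fun v : 'cV[R]_m => v i 0)); [exact: cf|exact: coord_continuous].
apply: measurable_funM; first exact: measurable_cst.
apply: (@caratheodory_comp R _ W D m k g (fun z => z.1) (fun z => x z.1) u) => //.
- move=> y p; apply: (borel_fun_comp (phi := id) (h := fun t => g t y p) _ (bg y p)).
  by move=> z; exact: cvg_id.
- exact: measurable_funTS.
- by move=> w [].
- by move=> w [w0 wB]; have [_ cg] := cB _ w0 wB.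
Qed.

End maximum.

Section maximum_condition.
Context {R : realType} {m k : nat}.
Variables (f : R -> 'cV[R]_m -> 'cV[R]_k -> 'cV[R]_m) (g : R -> 'cV[R]_m -> 'cV[R]_k -> R).
Hypothesis reg : regularity_conditions f g.
Variables (U : R -> set 'cV[R]_k) (x_init : 'cV[R]_m) (tau : nat -> R).
Variables (u0 : R -> 'cV[R]_k) (x0 : R -> 'cV[R]_m).
Variables (x_ : 'cV[R]_m -> R -> 'cV[R]_m) (A_ : 'cV[R]_m -> R -> 'M[R]_m).
Hypothesis borelU : borel_graph U.
Hypothesis tau_infty : times_to_infinity tau.
Hypothesis opt : tau_optimal f g U x_init tau u0 x0.
Hypothesis x_sol : forall xi : 'cV[R]_m, trajectory f (x_init + xi) u0 (x_ xi).
Hypothesis A_sol : forall xi, fundamental_matrix f u0 (x_ xi) (A_ xi).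
Variable l : 'rV[R]_m.
Hypothesis I_lim : (fun z : 'cV[R]_m * R => int_vec (dg_along g u0 (x_ z.1) (A_ z.1)) 0 z.2)
    @ (nbhs (0 : 'cV[R]_m), +oo) --> l.

Notation I_ xi T := (mprim (dg_along g u0 (x_ xi) (A_ xi)) T).
Notation mu := (@lebesgue_measure R).

Let psi t : 'rV[R]_m := (l - I_ 0 t) *m invmx (A_ 0 t).
Let H t p := hamiltonian f g (x_ 0 t) t p 1 (psi t).

Let au0 : admissible U u0. Proof. by case: opt => -[]. Qed.
Let cu0 := admissible_control au0.

Lemma optimal_trajectory t : 0 <= t -> x0 t = x_ 0 t.
Proof.
case: opt => -[_ tx0] _; apply: (flow_unique reg cu0 x_sol).
by rewrite addr0.
Qed.

Lemma no_selection (j : nat) (D : set R) (v : R -> 'cV[R]_k) : measurable D ->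
  (0 < mu D)%E -> measurable_fun D (v : R -> g_sigma_algebraType (@open 'cV[R]_k)) ->
  ~ (forall t, D t -> [/\ 0 <= t <= j%:R, `|v t| <= j%:R, U t (v t) & H t (u0 t) + j.+1%:R^-1 <= H t (v t)]).
Proof.
move=> mD D0 mv HD.
have [|||||||w [Y [e [S [aw tY e0 HS]]]]] := @needle_improves R m k f g reg U u0 x_init x_ A_ au0 x_sol A_sol l
  j%:R j%:R j.+1%:R^-1 D v I_lim.
- exact: ler0n.
- by rewrite invr_gt0 ltr0Sn.
- exact: mD.
- by move=> t /HD[+ _ _ _]; rewrite /= in_itv.
- exact: D0.
- exact: mv.
- by move=> t /HD[].
apply: (optimal_no_improvement (S := Num.max S 0) tau_infty opt aw tY e0).
move=> t; rewrite gt_max => /andP[St /ltW t0]; apply: le_trans (HS t St).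
rewrite lerD2r le_eqVlt; apply/orP; left; apply/eqP; apply: eq_prim => s /andP[s0 _].
by rewrite optimal_trajectory.
Qed.

(** A single index bounds the time, the control and the gap: each set lies in a compact one, and
    countably many of them exhaust the failures outside [B0]. *)
Let bad (B0 : set R) (j : nat) := [set z : R * 'cV[R]_k | [/\ 0 <= z.1 <= j%:R, `|z.2| <= j%:R, ~ B0 z.1,
  U z.1 z.2 & H z.1 (u0 z.1) + j.+1%:R^-1 <= H z.1 z.2]].

Lemma psi_ac : forall T, 0 <= T -> abs_continuous T psi.
Proof. by have [] := costate_solves reg cu0 x_sol A_sol 0 l. Qed.

Lemma bad_borel (B0 : set R) j : measurable B0 ->
  (forall t : R, 0 <= t -> ~ B0 t -> continuous (fun z : 'cV[R]_m * 'cV[R]_k => f t z.1 z.2) /\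
     continuous (fun z : 'cV[R]_m * 'cV[R]_k => g t z.1 z.2)) ->
  exists2 Q : set (R * 'cV[R]_k), compact Q /\ bad B0 j `<=` Q &
    <<s (@open (R * 'cV[R]_k)%type) >> (bad B0 j).
Proof.
move=> mB cB; pose Q : set (R * 'cV[R]_k) := `[0, j%:R]%classic `*` [set p : 'cV[R]_k | `|p| <= j%:R].
have cQ : compact Q by apply: compact_setX; [exact: segment_compact|exact: cV_ball_compact].
exists Q.
  by split => // z [t0 zj _ _ _]; split => //=; rewrite in_itv.
pose W := g_sigma_algebraType (@open (R * 'cV[R]_k)%type).
have clQ : closed Q by apply: compact_closed => //; exact: norm_hausdorff.
have mQ : measurable (Q : set W).
  rewrite -[X in measurable X]setCK; apply: measurableC; apply: sub_sigma_algebra.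
  exact: closed_openC.
have acx := trajectory_ac (x_sol 0).
have m1 : measurable_fun setT (fst : W -> R).
  by apply: (@continuous_graph_measurable R k fst) => z; exact: cvg_fst.
pose D : set W := [set z : R * 'cV[R]_k | 0 <= z.1 /\ ~ B0 z.1].
have [|mD mH] := measurable_graph_fun reg mB cB acx psi_ac (u := snd).
  move=> i; apply: measurable_funTS.
  apply: (@continuous_graph_measurable R k (fun z => z.2 i 0)) => z.
  by apply: (@continuous_comp _ _ _ snd (fun v : 'cV[R]_k => v i 0)); [exact: cvg_snd|exact: coord_continuous].
have [|_ mH0] := measurable_graph_fun reg mB cB acx psi_ac (u := fun z => u0 z.1).
  move=> i; apply: (@measurable_comp _ _ _ W R R `[0, +oo[%classic (fun t => u0 t i 0)).
  - exact: measurable_itv.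
  - by move=> _ [z [z0 _] <-]; rewrite /= in_itv /= z0.
  - apply: (borel_fun_comp (phi := fun v : 'cV[R]_k => v i 0)); first exact: coord_continuous.
    by case: cu0.
  - exact: measurable_funTS.
have mG : measurable ([set z | 0 <= z.1 /\ U z.1 z.2] : set W) := borelU.
have mE := measurable_funB mH mH0.
have -> : bad B0 j = (Q `&` [set z | 0 <= z.1 /\ U z.1 z.2]) `&`
  (D `&` (fun z : W => H z.1 z.2 - H z.1 (u0 z.1)) @^-1` `[j.+1%:R^-1, +oo[).
  apply/seteqP; split => z; rewrite /bad /D /Q /= !in_itv /= andbT lerBrDl.
    by move=> [/[dup] zj /andP[z0 _] z2 Bz Uz Hz].
  by move=> [[[zj z2] [_ Uz]] [[_ Bz] Hz]].
change (measurable ((Q `&` [set z | 0 <= z.1 /\ U z.1 z.2]) `&`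
  (D `&` (fun z : W => H z.1 z.2 - H z.1 (u0 z.1)) @^-1` `[j.+1%:R^-1, +oo[) : set W)).
apply: measurableI; first exact: measurableI.
by apply: mE => //; exact: measurable_itv.
Qed.

(** A time of failure outside [B0] lies in the projection of some [bad B0 j]. Each projection has
    outer measure 0, since otherwise a selection from it would contradict [no_selection]. *)
Lemma hamiltonian_max : {ae leb R, forall t : R, 0 <= t ->
  ereal_sup [set (H t p)%:E | p in U t] = (H t (u0 t))%:E}.
Proof.
case: (reg) => _ [[_ cf _] [_ cg _]] _ _.
have [N [mN N0 HN]] := leb_negligible cf.
have [N' [mN' N'0 HN']] := leb_negligible cg.
pose B0 := N `|` N'.
have mB : measurable B0 by exact: measurableU.
have cB (t : R) : 0 <= t -> ~ B0 t -> continuous (fun z : 'cV[R]_m * 'cV[R]_k => f t z.1 z.2) /\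
     continuous (fun z : 'cV[R]_m * 'cV[R]_k => g t z.1 z.2).
  move=> t0 Bt; split; apply: contrapT => ct; apply: Bt; [left; apply: HN|right; apply: HN'] => /= h; exact: (ct (h t0)).
have nB : mu.-negligible B0.
  apply: negligibleU; [apply: (negligibleP mu mN).2|apply: (negligibleP mu mN').2].
    exact: etrans (esym (leb_lebesgue N)) N0.
  exact: etrans (esym (leb_lebesgue N')) N'0.
have nj j : mu.-negligible (fst @` bad B0 j).
  apply/negligible_outer_measure; apply/eqP; apply: contrapT => /negP nz.
  have [Q [cQ BQ] bB] := bad_borel j mB cB.
  have [D [v [mD D0 mv HD]]] := measurable_selection bB cQ BQ nz.
  by apply: (no_selection mD D0 mv (j := j)) => t /HD[].
apply: ae_lebesgue_leb; apply: negligibleS (negligibleU nB (negligible_bigcup nj)) => t /= Ht.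
apply: contrapT => /not_orP[Bt nbad]; apply: Ht => t0.
apply/eqP; rewrite eq_le; apply/andP; split; last first.
  by apply: ereal_sup_ubound; exists (u0 t) => //; case: au0 => _ _; exact.
apply: ge_ereal_sup => _ [p Up <-]; rewrite lee_fin leNgt; apply/negP => Hlt.
apply: nbad.
(* Large enough for the time, for the control and for the inverse of the gap at once. *)
pose j := (Num.truncn t + Num.truncn `|p| + Num.truncn (H t p - H t (u0 t))^-1).+1.
have le_j (a : R) (n : nat) : 0 <= a -> (Num.truncn a <= n)%N -> a <= n.+1%:R.
  move=> a0 an; have /andP[_ /ltW h] := truncn_itv a0; apply: le_trans h _.
  by rewrite ler_nat ltnS.
have d0 : 0 < H t p - H t (u0 t) by rewrite subr_gt0.
exists j => //; exists (t, p) => //; split => //=.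
- by rewrite t0 /=; apply: le_j => //; rewrite -addnA leq_addr.
- by apply: le_j => //; exact: leq_trans (leq_addl _ _) (leq_addr _ _).
- rewrite -lerBrDl -[leRHS]invrK lef_pV2 ?posrE ?invr_gt0 //.
  by apply: (@le_trans _ _ j%:R); [apply: le_j; [rewrite invr_ge0; exact: ltW|exact: leq_addl]|rewrite ler_nat].
Qed.

End maximum_condition.

(** * Transversality conditions *)

Section transversality.
Context {R : realType} {m k : nat}.
Variables (f : R -> 'cV[R]_m -> 'cV[R]_k -> 'cV[R]_m) (g : R -> 'cV[R]_m -> 'cV[R]_k -> R).
Hypothesis reg : regularity_conditions f g.
Variables (U : R -> set 'cV[R]_k) (x_init : 'cV[R]_m) (tau : nat -> R).
Variables (u0 : R -> 'cV[R]_k) (x0 : R -> 'cV[R]_m).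
Variables (x_ : 'cV[R]_m -> R -> 'cV[R]_m) (A_ : 'cV[R]_m -> R -> 'M[R]_m).
Hypothesis borelU : borel_graph U.
Hypothesis tau_infty : times_to_infinity tau.
Hypothesis opt : tau_optimal f g U x_init tau u0 x0.
Hypothesis x_sol : forall xi : 'cV[R]_m, trajectory f (x_init + xi) u0 (x_ xi).
Hypothesis A_sol : forall xi, fundamental_matrix f u0 (x_ xi) (A_ xi).
Variable l : 'rV[R]_m.
Hypothesis I_lim : (fun z : 'cV[R]_m * R => int_vec (dg_along g u0 (x_ z.1) (A_ z.1)) 0 z.2)
    @ (nbhs (0 : 'cV[R]_m), +oo) --> l.

Notation I_ xi T := (mprim (dg_along g u0 (x_ xi) (A_ xi)) T).

Let cu0 : control u0.
Proof. by case: opt => -[au0 _] _; exact: (admissible_control au0). Qed.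

Let x0E t : 0 <= t -> x0 t = x_ 0 t.
Proof. exact: (optimal_trajectory reg opt x_sol). Qed.

Let A0 : A_ 0 0 = 1%:M. Proof. by case: (A_sol 0). Qed.

Lemma int_vec_cvg : int_vec (dg_along g u0 (x_ 0) (A_ 0)) 0 @ +oo --> l.
Proof.
have H : ((0 : 'cV[R]_m), t) @[t --> +oo] --> (nbhs (0 : 'cV[R]_m), (+oo : set_system R)).
  by apply: cvg_pair; [exact: cvg_cst|exact: cvg_id].
exact: (@cvg_comp _ _ _ _ _ _ _ _ H I_lim).
Qed.

Lemma I_cvg : mprim (dg_along g u0 (x_ 0) (A_ 0)) @ +oo --> l.
Proof.
have <- : int_vec (dg_along g u0 (x_ 0) (A_ 0)) 0 = mprim (dg_along g u0 (x_ 0) (A_ 0)).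
  by apply/funext => t; rewrite int_vec_mprim.
exact: int_vec_cvg.
Qed.

Lemma improperE T : 0 <= T -> improper (dg_along g u0 x0 (A_ 0)) T = l - I_ 0 T.
Proof.
move=> T0.
have E : int_vec (dg_along g u0 x0 (A_ 0)) T = int_vec (dg_along g u0 (x_ 0) (A_ 0)) T.
  apply/funext => S; apply/rowP => j; rewrite [LHS]mxE [RHS]mxE.
  apply: eq_Rintegral => t.
  rewrite inE /= in_itv /= => /andP[Tt _].
  by rewrite /dg_along x0E // (le_trans T0).
apply: etrans (congr1 (fun F : R -> 'rV[R]_m => lim (F S @[S --> +oo])) E) _.
apply: (improper_tail reg cu0 x_sol A_sol (xi := 0) T0).
exact: int_vec_cvg.
Qed.

Lemma costate_multiplier : multiplier f g U x0 u0 1 (fun t => (l - I_ 0 t) *m invmx (A_ 0 t)).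
Proof.
split.
- by rewrite ler01 lexx.
- by left; apply/eqP; exact: oner_neq0.
- apply: solves_ext (costate_solves reg cu0 x_sol A_sol 0 l) => //.
  by apply: aeW => t t0; rewrite x0E.
- have := hamiltonian_max reg borelU tau_infty opt x_sol A_sol I_lim.
  apply: ae_leb_imply => t H t0.
  by rewrite x0E //; exact: H.
Qed.

Variables (lambda : R) (psi : R -> 'rV[R]_m).
Hypothesis npsi : normalized_multiplier f g U x0 u0 lambda psi.

Let psiA t : 0 <= t -> psi t *m A_ 0 t = psi 0 - lambda *: I_ 0 t.
Proof.
case: npsi => -[_ _ spsi _] _; apply: (adjoint_variation reg cu0 x_sol A_sol).
by apply: solves_ext spsi => //; apply: aeW => s s0; rewrite x0E.
Qed.

Let psiA_cvg : psi t *m A_ 0 t @[t --> +oo] --> psi 0 - lambda *: l.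
Proof.
have H : psi 0 - lambda *: I_ 0 t @[t --> +oo] --> psi 0 - lambda *: l.
  by apply: cvgB; [exact: cvg_cst|apply: cvgZr; exact: I_cvg].
apply: cvg_trans H; apply: near_eq_cvg; near=> t.
by rewrite psiA //; near: t; apply: nbhs_pinfty_ge; exact: num_real.
Unshelve. all: by end_near. Qed.

Let enorm_cvg : psi 0 = lambda *: l -> enorm (psi t *m A_ 0 t) @[t --> +oo] --> (0 : R).
Proof.
move=> E; have := psiA_cvg; rewrite E subrr => /cvgrPdist_lt H.
apply/cvgrPdist_lt => e e0.
have m0 : 0 < (1 * m)%:R + 1 :> R by rewrite ltr_wpDl.
have := H _ (divr_gt0 e0 m0); apply: filterS => t; rewrite !sub0r !normrN => ht.
rewrite ger0_norm ?enorm_ge0 //; apply: le_lt_trans (enorm_le_norm _) _.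
move: ht; rewrite ltr_pdivlMr // mulrDr mulr1 mulrC => ht.
by apply: le_lt_trans ht; rewrite lerDl.
Qed.

(** If [lambda] were 0, [psi 0] would vanish, against the normalization. Hence $\lambda = 1$, and
    the formula for $\psi A_0$ can be inverted. *)
Lemma closed_form : psi 0 = lambda *: l <-> lambda = 1 /\
  (forall T, 0 <= T -> psi T = improper (dg_along g u0 x0 (A_ 0)) T *m invmx (A_ 0 T)).
Proof.
split=> [E|[-> H]]; last first.
  rewrite H // improperE // mprim0; last exact: (dg_along_mloc reg cu0 x_sol A_sol).
  by rewrite subr0 A0 invmx1 mulmx1 scale1r.
have l1 : lambda = 1.
  case: npsi => _ [//|[l0 p0]]; move: p0; rewrite E l0 scale0r /enorm.
  rewrite big1 ?sqrtr0 => [/eqP|i _]; first by rewrite eq_sym oner_eq0.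
  by rewrite big1 // => j _; rewrite mxE expr0n.
split => // T T0; rewrite improperE //.
have := psiA T0; rewrite E l1 !scale1r => <-.
by rewrite mulmxK //; exact: (flow_invertible reg cu0 x_sol A_sol).
Qed.

Lemma lim_zero : psi 0 = lambda *: l <-> enorm (psi t *m A_ 0 t) @[t --> +oo] --> (0 : R).
Proof.
split=> [|H]; first exact: enorm_cvg.
apply/eqP; rewrite -subr_eq0; apply/eqP.
apply: (@cvg_unique _ (@norm_hausdorff _ _) _ _ _ _ psiA_cvg).
apply/cvgrPdist_lt => e e0; move/cvgrPdist_lt : H => /(_ e e0); apply: filterS => t.
rewrite !sub0r !normrN ger0_norm ?enorm_ge0 //; apply: le_lt_trans; exact: norm_le_enorm.
Qed.

(** As $\psi A_0$ converges at infinity, a lower limit 0 along [tau] already forces its limit to be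
    0. *)
Lemma liminf_zero : psi 0 = lambda *: l <->
  limn_einf (fun n => (enorm (psi (tau n) *m A_ 0 (tau n)))%:E) = 0%E.
Proof.
have tauoo : tau n @[n --> \oo] --> +oo by case: tau_infty.
split=> [/enorm_cvg H|H].
  have Hn := @cvg_comp _ _ _ _ _ _ _ _ tauoo H.
  have He : (enorm (psi (tau n) *m A_ 0 (tau n)))%:E @[n --> \oo] --> 0%E.
    by apply/fine_cvgP; split; [apply: nearW|].
  by have [-> _] := cvg_limn_einf_sup He.
apply: contrapT => c0; have {}c0 : 0 < `|psi 0 - lambda *: l|.
  by rewrite normr_gt0 subr_eq0; apply/eqP.
have Hn := @cvg_comp _ _ _ _ _ _ _ _ tauoo psiA_cvg.
have c2 : 0 < `|psi 0 - lambda *: l| / 2 by rewrite divr_gt0.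
have : ((`|psi 0 - lambda *: l| / 2)%:E <= 0%E :> \bar R)%E; last by rewrite lee_fin leNgt c2.
rewrite -H limn_einf_lim.
move/cvgrPdist_lt : Hn => /(_ _ c2) [N _ HN].
apply: lime_ge; first exact: is_cvg_einfs.
exists N => // n /= Nn; apply: le_ereal_inf_tmp => _ [i /= ni <-]; rewrite lee_fin.
apply: le_trans (norm_le_enorm _).
have := HN i (leq_trans Nn ni) => /= hi.
set c := psi 0 - _ in c0 c2 hi *; set v := psi (tau i) *m _ in hi *.
have := ler_normD (c - v) v; rewrite subrK; move: hi; lra.
Qed.

(** In one direction, the costates along $x_0$ that vanish at $\tau_n$ converge to $\psi$.
    Conversely, a vanishing sequence has $\psi_n(0) = \lambda_n I_{\xi_n}(\tau'_n)$; both arguments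
    of $I$ vary, and the joint limit is what turns this into $\lambda l$. *)
Lemma vanishing_zero : psi 0 = lambda *: l <-> tau_vanishing f g U tau x0 u0 lambda psi.
Proof.
have tauoo : tau n @[n --> \oo] --> +oo by case: tau_infty.
have tau0 n : 0 <= tau n by case: tau_infty => + _ _; exact.
split=> [E|[mpsi [sub [psi_ [y [lam [hsub ssys scvg svan]]]]]]].
  have /closed_form[l1 psiE] := E; split; first by case: npsi.
  exists id, (fun n t => (I_ 0 (tau n) - I_ 0 t) *m invmx (A_ 0 t)), (fun=> x_ 0), (fun _ _ => 1).
  split => //.
  - move=> n; split => //; [exact: (costate_solves reg cu0 x_sol A_sol)|by case: (x_sol 0)|exact: solves_cst].
  - move=> t t0; split; [|by rewrite x0E //; exact: cvg_cst|by rewrite l1; exact: cvg_cst].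
    have In := @cvg_comp _ _ _ _ _ _ _ _ tauoo I_cvg.
    rewrite (psiE _ t0) (improperE t0); apply/cvgrPdist_lt => e e0.
    pose B := invmx (A_ 0 t).
    have m0 : 0 < m%:R * `|B| + 1 :> R by rewrite ltr_wpDl // mulr_ge0.
    move/cvgrPdist_lt : In => /(_ _ (divr_gt0 e0 m0)); apply: filterS => n /= hn.
    rewrite -mulmxBl opprB addrA subrK.
    apply: le_lt_trans (mx_norm_mul _ _) _.
    move: hn; rewrite ltr_pdivlMr // mulrDr mulr1 => hn.
    by rewrite mulrAC -/B [_ * `|l - _|]mulrC; apply: le_lt_trans hn; rewrite lerDl.
  - by move=> n; rewrite subrr mul0mx.
have [p0 y0 l0] := scvg 0 (lexx 0).
have x00 : x0 0 = x_init by case: opt => -[_ []].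
pose xi n := y n 0 - x_init.
have xi0 : xi n @[n --> \oo] --> (0 : 'cV[R]_m).
  by rewrite -[0](subrr x_init) -{1}x00; apply: cvgB; [exact: y0|exact: cvg_cst].
have subn n : (n <= sub n)%N.
  elim: n => // n IH; apply: leq_ltn_trans IH _; exact: hsub.
have suboo : tau (sub n) @[n --> \oo] --> +oo.
  apply/cvgryPge => r; move/cvgryPge : tauoo => /(_ r) [N _ HN].
  by exists N => // n /= Nn; apply: HN => /=; apply: leq_trans (subn n).
have pE n : psi_ n 0 = lam n 0 *: I_ (xi n) (tau (sub n)).
  have [_ sp sx sl] := ssys n.
  have yE t : 0 <= t -> y n t = x_ (xi n) t.
    by apply: (flow_unique reg cu0 x_sol); split => //; rewrite addrC subrK.
  have lamE t : 0 <= t -> lam n t = lam n 0.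
    move=> t0; rewrite (solves_prim sl (loc_integrable_cst 0) t0).
    by rewrite prim_cst // mul0r addr0.
  have sp' : solves (psi_ n) (fun t => - dHdx f g (x_ (xi n) t) t (u0 t) (lam n 0) (psi_ n t)).
    by apply: solves_ext sp => //; apply: aeW => t t0; rewrite yE // lamE.
  have := adjoint_variation reg cu0 x_sol A_sol sp' (tau0 (sub n)).
  by rewrite svan mul0mx => /eqP; rewrite eq_sym subr_eq0 => /eqP.
have Icvg : I_ (xi n) (tau (sub n)) @[n --> \oo] --> l.
  have H : int_vec (dg_along g u0 (x_ (xi n)) (A_ (xi n))) 0 (tau (sub n)) @[n --> \oo] --> l.
    exact: (@cvg_comp _ _ _ _ _ _ _ _ (@cvg_pair _ _ _ _ _ _ _ _ _ _ _ xi0 suboo) I_lim).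
  apply: cvg_trans H; apply: near_eq_cvg; apply: nearW => n.
  by rewrite int_vec_mprim.
have H : lam n 0 *: I_ (xi n) (tau (sub n)) @[n --> \oo] --> lambda *: l.
  by apply: cvgZ; [exact: l0|exact: Icvg].
apply: (@cvg_unique _ (@norm_hausdorff _ _) _ _ _ _ p0).
apply: cvg_trans H; apply: near_eq_cvg; apply: nearW => n.
by rewrite pE.
Qed.

End transversality.

Theorem corollary8 (R : realType) (m k : nat)
    (f : R -> 'cV[R]_m -> 'cV[R]_k -> 'cV[R]_m)
    (g : R -> 'cV[R]_m -> 'cV[R]_k -> R)
    (U : R -> set 'cV[R]_k) (x_init : 'cV[R]_m) (tau : nat -> R)
    (u0 : R -> 'cV[R]_k) (x0 : R -> 'cV[R]_m)
    (x_ : 'cV[R]_m -> R -> 'cV[R]_m) (A_ : 'cV[R]_m -> R -> 'M[R]_m)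
    (closedU : closed_valued U)
    (borelU : borel_graph U)
    (reg : regularity_conditions f g)
    (tau_infty : times_to_infinity tau)
    (opt : tau_optimal f g U x_init tau u0 x0)
    (x_sol : forall xi : 'cV[R]_m, trajectory f (x_init + xi) u0 (x_ xi))
    (A_sol : forall xi, fundamental_matrix f u0 (x_ xi) (A_ xi))
    (I_lim : (fun z : 'cV[R]_m * R =>
                int_vec (dg_along g u0 (x_ z.1) (A_ z.1)) 0 z.2)
               @ (nbhs (0 : 'cV[R]_m), +oo)
             --> improper (dg_along g u0 x0 (A_ 0)) 0) :
  [/\ normal_pair f g U x0 u0,
      (exists lambda0 psi0,
        [/\ normalized_multiplier f g U x0 u0 lambda0 psi0,
            tau_vanishing f g U tau x0 u0 lambda0 psi0 &
            forall lambda psi,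
              normalized_multiplier f g U x0 u0 lambda psi ->
              tau_vanishing f g U tau x0 u0 lambda psi ->
              lambda = lambda0 /\ (forall t : R, 0 <= t -> psi t = psi0 t)]) &
      forall lambda0 psi0, normalized_multiplier f g U x0 u0 lambda0 psi0 ->
        let vanishing := tau_vanishing f g U tau x0 u0 lambda0 psi0 in
        [/\ vanishing <->
              limn_einf (fun n => (enorm (psi0 (tau n) *m A_ 0 (tau n)))%:E)
              = 0%E,
            vanishing <->
              enorm (psi0 t *m A_ 0 t) @[t --> +oo] --> (0 : R) &
            vanishing <->
              lambda0 = 1 /\
              (forall T : R, 0 <= T ->
                 psi0 T = improper (dg_along g u0 x0 (A_ 0)) T
                          *m invmx (A_ 0 T))]].
Proof.
have cu0 : control u0 by case: opt => -[au0 _] _; exact: admissible_control au0.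
have main := costate_multiplier reg borelU tau_infty opt x_sol A_sol I_lim.
set psi1 := (fun t => _) in main.
have n1 : normalized_multiplier f g U x0 u0 1 psi1 by split => //; left.
have form lambda psi (np : normalized_multiplier f g U x0 u0 lambda psi) :=
  closed_form reg opt x_sol A_sol I_lim np.
have vanish lambda psi (np : normalized_multiplier f g U x0 u0 lambda psi) :=
  vanishing_zero reg tau_infty opt x_sol A_sol I_lim np.
split.
- by exists psi1.
- exists 1, psi1; split => //.
    apply/(vanish _ _ n1)/(form _ _ n1); split => // T T0.
    by rewrite (improperE reg opt x_sol A_sol I_lim T0).
  move=> lambda psi np /(vanish _ _ np)/(form _ _ np)[-> psiE]; split => // t t0.
  by rewrite psiE // (improperE reg opt x_sol A_sol I_lim t0).
- move=> lambda0 psi0 np vanishing; have V := iff_sym (vanish _ _ np); split.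
  + exact: iff_trans V (liminf_zero reg tau_infty opt x_sol A_sol I_lim np).
  + exact: iff_trans V (lim_zero reg opt x_sol A_sol I_lim np).
  + exact: iff_trans V (form _ _ np).
Qed.
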